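(* Suppose the assumptions (O1), (M1), (F1), (L1), (E1), (E2) and (R1) written out in the context hold. Then for any $k\in[K]$, $$\frac{1}{d_k}\sum_{j=1}^{d_k}\big\|\widehat{\mathbf Q}_{k,j\cdot}-\mathbf H_{k,j}\mathbf Q_{k,j\cdot}\big\|^2=O_P\Big(d_k^{2(\alpha_{k,1}-\alpha_{k,r_k})-1}\Big(\frac{1}{Td_{-k}}+\frac1{d_k}\Big)\frac{d^2}{g_s^2}\Big)=o_P(1).$$ Furthermore, if for each $i,j\in[d_k]$ and $h\in[d_{-k}]$ the set $\psi_{k,ij,h}$ has cardinality satisfying $|\psi_{k,ij,h}|/T=1-\eta_{k,ij,h}\ge 1-\eta=\psi_0$, then $$\frac{1}{d_k}\sum_{j=1}^{d_k}\big\|\widehat{\mathbf Q}_{k,j\cdot}-\mathbf H_k^a\mathbf Q_{k,j\cdot}\big\|^2=\frac1{d_k}\big\|\widehat{\mathbf Q}_k-\mathbf Q_k(\mathbf H_k^{a})'\big\|_F^2=O_P\Big(d_k^{2(\alpha_{k,1}-\alpha_{k,r_k})-1}\Big[\Big(\frac1{Td_{-k}}+\frac1{d_k}\Big)\frac{d^2}{g_s^2}+\min\Big(\frac1T,\frac{\eta^2}{(1-\eta)^2}\Big)\Big]\Big)=o_P(1).$$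
   Context: Notation. $[m]=\{1,\dots,m\}$; $\mathbf X'$ is the transpose; $\mathbf X_{i\cdot}$ is the $i$-th row of a matrix written as a column vector, $\mathbf X_{\cdot i}$ its $i$-th column; $\|\cdot\|$ is the spectral norm of a matrix or $L_2$ norm of a vector, $\|\cdot\|_F$ the Frobenius norm, $\|\mathbf X\|_1=\max_j\sum_i|X_{ij}|$; $\circ$ is the Hadamard and $\otimes$ the Kronecker product; $a\asymp b$ means $a=O(b)$ and $b=O(a)$; $\mathrm{diag}(\mathbf X)$ is the diagonal matrix with the diagonal of $\mathbf X$. For an order-$K$ tensor, $\mathrm{mat}_k(\cdot)$ is the mode-$k$ unfolding (columns are the mode-$k$ fibres), and $\mathcal X\times_k\mathbf A$ is defined by $\mathrm{mat}_k(\mathcal X\times_k\mathbf A)=\mathbf A\,\mathrm{mat}_k(\mathcal X)$, the fibres being ordered so that $\mathrm{mat}_k(\mathcal X\times_1\mathbf A_1\cdots\times_K\mathbf A_K)=\mathbf A_k\mathrm{mat}_k(\mathcal X)(\mathbf A_K\otimes\cdots\otimes\mathbf A_{k+1}\otimes\mathbf A_{k-1}\otimes\cdots\otimes\mathbf A_1)'$. Model. For $t\in[T]$, $\mathcal Y_t=\mathcal C_t+\mathcal E_t\in\mathbb R^{d_1\times\cdots\times d_K}$ has mean zero, with $\mathcal C_t=\mathcal F_t\times_1\mathbf A_1\times_2\cdots\times_K\mathbf A_K$, core factor $\mathcal F_t\in\mathbb R^{r_1\times\cdots\times r_K}$ and loading matrices $\mathbf A_k\in\mathbb R^{d_k\times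 r_k}$. Put $d=\prod_kd_k$, $d_{-k}=d/d_k$, $\mathbf Z_k=\mathrm{diag}(\mathbf A_k'\mathbf A_k)$, $\mathbf Q_k=\mathbf A_k\mathbf Z_k^{-1/2}$, $\mathcal F_{Z,t}=\mathcal F_t\times_1\mathbf Z_1^{1/2}\cdots\times_K\mathbf Z_K^{1/2}$, $\mathbf\Lambda_k=\mathbf Q_K\otimes\cdots\otimes\mathbf Q_{k+1}\otimes\mathbf Q_{k-1}\otimes\cdots\otimes\mathbf Q_1$. The missingness tensor $\mathcal M_t$ has entry 1 if the corresponding entry of $\mathcal Y_t$ is observed and 0 otherwise; $\psi_{k,ij,h}=\{t\in[T]:\mathrm{mat}_k(\mathcal M_t)_{ih}\mathrm{mat}_k(\mathcal M_t)_{jh}=1\}$. Asymptotics: $T,d_1,\dots,d_K\to\infty$ with $K$ and all $r_k$ fixed. Estimators. $(\widehat S_k)_{ij}=\sum_{h=1}^{d_{-k}}\frac1{|\psi_{k,ij,h}|}\sum_{t\in\psi_{k,ij,h}}\mathrm{mat}_k(\mathcal Y_t)_{ih}\mathrm{mat}_k(\mathcal Y_t)_{jh}$; $\widehat{\mathbf Q}_k\in\mathbb R^{d_k\times r_k}$ has as columns the orthonormal eigenvectors of $\widehat{\mathbf S}_k$ for its $r_k$ largest eigenvalues ($r_k$ known); $\widehat{\mathbf D}_k=\widehat{\mathbf Q}_k'\widehat{\mathbf S}_k\widehat{\mathbf Q}_k$ is the diagonal matrix of these eigenvalues. With $\mathbf u_{t,h}=\mathrm{mat}_k(\mathcal F_{Z,t})\mathbf\Lambda_{k,h\cdot}$,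 $$\mathbf H_{k,j}=\widehat{\mathbf D}_k^{-1}\sum_{i=1}^{d_k}\widehat{\mathbf Q}_{k,i\cdot}\sum_{h=1}^{d_{-k}}\frac1{|\psi_{k,ij,h}|}\sum_{t\in\psi_{k,ij,h}}\mathbf u_{t,h}'\mathbf Q_{k,i\cdot}\,\mathbf u_{t,h}',\qquad \mathbf H_k^a=\frac1T\sum_{t=1}^T\widehat{\mathbf D}_k^{-1}\widehat{\mathbf Q}_k'\mathbf Q_k\mathrm{mat}_k(\mathcal F_{Z,t})\mathbf\Lambda_k'\mathbf\Lambda_k\mathrm{mat}_k(\mathcal F_{Z,t})'.$$ Assumptions. (O1) $\mathcal M_t$ is independent of $\mathcal F_s,\mathcal E_s$ for all $t,s\in[T]$; given the $\mathcal M_t$, there is a constant $\psi_0$ with $|\psi_{k,ij,h}|/T\ge\psi_0>0$ for all $k\in[K]$, $i,j\in[d_k]$, $h\in[d_{-k}]$. (M1) The elements of $\mathcal F_t$ and $\mathcal E_t$ are $\alpha$-mixing: for some $\gamma>2$ the mixing coefficients satisfy $\sum_{h\ge1}\alpha(h)^{1-2/\gamma}<\infty$, where $\alpha(h)=\sup_\tau\sup_{A\in\mathcal H_{-\infty}^\tau,B\in\mathcal H_{\tau+h}^\infty}|P(A\cap B)-P(A)P(B)|$ and $\mathcal H_\tau^s$ is the $\sigma$-field generated by the process at times $\tau\le t\le s$. (F1) $\mathcal F_t=\sum_{q\ge0}a_{f,q}\mathcal X_{f,t-q}$, where $\{\mathcal X_{f,t}\}$ has i.i.d. elements with mean 0,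 variance 1 and uniformly bounded fourth moments, $\sum_qa_{f,q}^2=1$ and $\sum_q|a_{f,q}|\le c$ for a constant $c$. (L1) For each $k$, $\mathbf A_k$ has full column rank and is independent of the factor and error series; as $d_k\to\infty$, $\mathbf Z_k^{-1/2}\mathbf A_k'\mathbf A_k\mathbf Z_k^{-1/2}\to\mathbf\Sigma_{A,k}$, positive definite with eigenvalues bounded away from 0 and infinity; $(\mathbf Z_k)_{jj}\asymp d_k^{\alpha_{k,j}}$ for $j\in[r_k]$ with $1/2<\alpha_{k,r_k}\le\cdots\le\alpha_{k,1}\le1$. (E1) $K$ is constant and $\mathcal E_t=\mathcal F_{e,t}\times_1\mathbf A_{e,1}\cdots\times_K\mathbf A_{e,K}+\mathbf\Sigma_\epsilon\circ\boldsymbol\epsilon_t$, where $\mathcal F_{e,t}\in\mathbb R^{r_{e,1}\times\cdots\times r_{e,K}}$ has independent elements with mean 0 and variance 1, $\boldsymbol\epsilon_t\in\mathbb R^{d_1\times\cdots\times d_K}$ has independent mean-zero unit-variance elements, $\{\boldsymbol\epsilon_t\}$ and $\{\mathcal F_{e,t}\}$ are independent, the tensor $\mathbf\Sigma_\epsilon$ of standard deviations has uniformly bounded elements, and $\mathbf A_{e,k}\in\mathbb R^{d_k\times r_{e,k}}$ satisfies $\|\mathbf A_{e,k}\|_1=O(1)$ for each $k$. (E2) $\mathcal F_{e,t}=\sum_{q\ge0}a_{e,q}\mathcal X_{e,t-q}$ and $\boldsymbol\epsilon_t=\sum_{q\ge0}a_{\epsilon,q}\mathcal X_{\epsilon,t-q}$,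 with $\{\mathcal X_{e,t}\},\{\mathcal X_{\epsilon,t}\}$ independent of each other and of $\{\mathcal X_{f,t}\}$, each having independent elements with mean 0, variance 1 and uniformly bounded fourth moments; $\sum_qa_{e,q}^2=\sum_qa_{\epsilon,q}^2=1$, and $\sum_q|a_{e,q}|,\sum_q|a_{\epsilon,q}|\le c$ for a constant $c$. (R1) With $g_s=\prod_{k=1}^Kd_k^{\alpha_{k,1}}$, for each $k$: $dg_s^{-2}T^{-1}d_k^{2(\alpha_{k,1}-\alpha_{k,r_k})+1}=o(1)$, $dg_s^{-1}T^{-1}d_k^{2(\alpha_{k,1}-\alpha_{k,r_k})}=o(1)$, $dg_s^{-1}d_k^{\alpha_{k,1}-\alpha_{k,r_k}-1/2}=o(1)$.
   Formalization: The loadings and the missingness tensors are assumed jointly independent of the factor and error series; with only the separate independences of (O1) and (L1) the second rate can fail, e.g. when the loadings are chosen depending on both the mask and the factors. *)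

(* Defs.v *)
(* MathComp-Analysis; everything is stated over an abstract [R : realType]. *)
From HB Require Import structures.
From mathcomp Require Import all_boot all_order all_algebra.
From mathcomp Require Import all_classical all_reals all_analysis.

Set Implicit Arguments.
Unset Strict Implicit.
Unset Printing Implicit Defensive.

Import Order.TTheory GRing.Theory Num.Theory.
Import numFieldNormedType.Exports.

Local Open Scope classical_set_scope.
Local Open Scope ring_scope.

(** * Tensors and their unfoldings *)

(* Entries of an order-K tensor of size d_1 x ... x d_K are indexed by [tidx d];
   a tensor with entries in V is a function [tidx d -> V]. *)
Definition tidx (K : nat) (d : 'I_K -> nat) := {dffun forall k : 'I_K, 'I_(d k)}.

(* Multi-indices over all modes but k, i.e. the mode-k fibres. *)
Definition fidx (K : nat) (d : 'I_K -> nat) (k : 'I_K) :=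
  {dffun forall l : {l : 'I_K | l != k}, 'I_(d (val l))}.

Definition nfib (K : nat) (d : 'I_K -> nat) (k : 'I_K) : nat := #|{: fidx d k}|.

Definition fibre (K : nat) (d : 'I_K -> nat) (k : 'I_K) (h : 'I_(nfib d k)) :
  fidx d k := enum_val h.

(* The position with k-th coordinate i on the fibre h. *)
Definition on_fibre (K : nat) (d : 'I_K -> nat) (k : 'I_K)
    (i : 'I_(d k)) (h : fidx d k) : tidx d :=
  [ffun l : 'I_K =>
     match decP (l =P k) with
     | left e => ecast x 'I_(d x) (esym e) i
     | right ne => h (exist (fun l => l != k) l (introN eqP ne))
     end].

(* Mode-k unfolding. The fibres are ordered by the enumeration of [fidx d k];
   the same enumeration orders the rows and columns of [kron_but], so that the
   defining identity [unfold_tucker] below holds. *)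
Definition unfold (V : Type) (K : nat) (d : 'I_K -> nat) (k : 'I_K)
    (X : tidx d -> V) : 'M[V]_(d k, nfib d k) :=
  \matrix_(i, h) X (on_fibre i (fibre h)).

(* B_K (x) ... (x) B_(k+1) (x) B_(k-1) (x) ... (x) B_1, entry by entry: rows and
   columns of this Kronecker product are labelled by multi-indices. *)
Definition kron_but (R : realType) (K : nat) (d r : 'I_K -> nat)
    (B : forall k, 'M[R]_(d k, r k)) (k : 'I_K) : 'M[R]_(nfib d k, nfib r k) :=
  \matrix_(h, m) \prod_(l : {l : 'I_K | l != k})
    B (val l) (fibre h l) (fibre m l).

(* X x_1 B_1 x_2 ... x_K B_K. *)
Definition tucker (R : realType) (K : nat) (d r : 'I_K -> nat)
    (B : forall k, 'M[R]_(d k, r k)) (X : tidx r -> R) : tidx d -> R :=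
  fun i => \sum_(m : tidx r) X m * \prod_(k < K) B k (i k) (m k).

Lemma on_fibre_mode (K : nat) (d : 'I_K -> nat) (k : 'I_K) (i : 'I_(d k))
    (h : fidx d k) : on_fibre i h k = i.
Proof.
rewrite /on_fibre ffunE; case: (decP _) => // e.
by rewrite (eq_axiomK (esym e)).
Qed.

Lemma on_fibre_other (K : nat) (d : 'I_K -> nat) (k : 'I_K) (i : 'I_(d k))
    (h : fidx d k) (l : {l : 'I_K | l != k}) : on_fibre i h (val l) = h l.
Proof.
rewrite /on_fibre ffunE; case: (decP _) => e.
  by exfalso; move/eqP: e; apply/negP/(valP l).
by case: l e => l lk e /=; rewrite (bool_irrelevance (introN eqP e) lk).
Qed.

Lemma on_fibre_bij (K : nat) (d : 'I_K -> nat) (k : 'I_K) :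
  bijective (fun p : 'I_(d k) * fidx d k => on_fibre p.1 p.2).
Proof.
exists (fun m : tidx d =>
  (m k, [ffun l : {l : 'I_K | l != k} => m (val l)] : fidx d k)).
  move=> [i h] /=; rewrite on_fibre_mode; congr pair.
  by apply/ffunP => l; rewrite ffunE on_fibre_other.
move=> m /=; apply/ffunP => l; have [->|lk] := eqVneq l k.
  by rewrite on_fibre_mode.
by rewrite -[l]/(val (exist (fun l => l != k) l lk)) on_fibre_other ffunE.
Qed.

Lemma unfold_tucker (R : realType) (K : nat) (d r : 'I_K -> nat)
    (B : forall k, 'M[R]_(d k, r k)) (X : tidx r -> R) (k : 'I_K) :
  unfold k (tucker B X) = B k *m unfold k X *m (kron_but B k)^T.
Proof.
apply/matrixP => i h; rewrite !mxE /tucker.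
rewrite (reindex _ (onW_bij _ (on_fibre_bij r k))) /=.
rewrite (eq_bigr (fun p : 'I_(r k) * fidx r k => X (on_fibre p.1 p.2) *
   (B k i p.1 * \prod_(l : {l : 'I_K | l != k})
      B (val l) (fibre h l) (p.2 l)))); last first.
  move=> [a m] _ /=; congr (_ * _).
  rewrite (bigD1 k) //= !on_fibre_mode; congr (_ * _).
  rewrite (reindex_omap (fun l : {l : 'I_K | l != k} => val l) insub) /=; last first.
    by move=> l lk; rewrite insubT.
  apply: eq_big => [l|l _]; last by rewrite !on_fibre_other.
  by rewrite (valP l) valK eqxx.
rewrite -(pair_bigA _ (fun a m => X (on_fibre a m) * (B k i a *
   \prod_(l : {l : 'I_K | l != k}) B (val l) (fibre h l) (m l)))) /=.
rewrite exchange_big /= (reindex _ (onW_bij _ (enum_val_bij (fidx r k)))) /=.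
apply: eq_bigr => m _; rewrite !mxE mulr_suml; apply: eq_bigr => a _.
by rewrite !mxE mulrA [X in X * _]mulrC.
Qed.

(** * The estimator and the rotation matrices, for one data set *)

Section Estimation.
Context {R : realType} {K : nat}.

Definition l2norm (p : nat) (v : 'cV[R]_p) : R := Num.sqrt (\sum_i v i 0 ^+ 2).

Definition frobenius_norm (p q : nat) (M : 'M[R]_(p, q)) : R :=
  Num.sqrt (\sum_i \sum_j M i j ^+ 2).

(* Maximal absolute column sum. *)
Definition norm1 (p q : nat) (M : 'M[R]_(p, q)) : R :=
  \big[Num.max/0]_j \sum_i `|M i j|.

(* X_(i.) as a column vector. *)
Definition rowv (p q : nat) (M : 'M[R]_(p, q)) (i : 'I_p) : 'cV[R]_q := (row i M)^T.

Definition posdef (p : nat) (S : 'M[R]_p) : Prop :=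
  S^T = S /\ forall x : 'cV[R]_p, x != 0 -> 0 < (x^T *m S *m x) 0 0.

(* The columns of Q are orthonormal eigenvectors of the symmetric matrix S for
   its q largest eigenvalues, in nonincreasing order and counted with
   multiplicity: they are the first q vectors of an ordered orthonormal
   eigenbasis. Signs, and bases of multiple eigenspaces, are left free. *)
Definition top_eigenvectors (p q : nat) (S : 'M[R]_p) (Q : 'M[R]_(p, q)) : Prop :=
  (q <= p)%N /\
  exists (U : 'M[R]_p) (lam : 'rV[R]_p),
    [/\ U^T *m U = 1%:M,
        S *m U = U *m diag_mx lam,
        (forall i j : 'I_p, (i <= j)%N -> lam 0 j <= lam 0 i) &
        forall (i : 'I_p) (j : 'I_q), i = j :> nat -> col j Q = col i U].

(* Z = diag(A'A) and its powers 1/2 and -1/2. *)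
Definition Zdiag (p q : nat) (A : 'M[R]_(p, q)) : 'rV[R]_q :=
  \row_j (A^T *m A) j j.
Definition Zhalf (p q : nat) (A : 'M[R]_(p, q)) : 'M[R]_q :=
  diag_mx (map_mx Num.sqrt (Zdiag A)).
Definition Zinvhalf (p q : nat) (A : 'M[R]_(p, q)) : 'M[R]_q :=
  diag_mx (map_mx (fun z => (Num.sqrt z)^-1) (Zdiag A)).
Definition normalized (p q : nat) (A : 'M[R]_(p, q)) : 'M[R]_(p, q) :=
  A *m Zinvhalf A.

Variables (T : nat) (d r : 'I_K -> nat).
Variable W : 'I_T -> tidx d -> bool.
Variable Y : 'I_T -> tidx d -> R.

Definition psi (k : 'I_K) (i j : 'I_(d k)) (h : 'I_(nfib d k)) : {set 'I_T} :=
  [set t | unfold k (W t) i h && unfold k (W t) j h]%SET.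

Definition Shat (k : 'I_K) : 'M[R]_(d k) :=
  \matrix_(i, j) \sum_h (#|psi i j h|%:R^-1 *
    \sum_(t in psi i j h) unfold k (Y t) i h * unfold k (Y t) j h).

Variable A : forall k, 'M[R]_(d k, r k).
Variable F : 'I_T -> tidx r -> R.

Definition FZ (t : 'I_T) : tidx r -> R := tucker (fun k => Zhalf (A k)) (F t).

Definition Lam (k : 'I_K) : 'M[R]_(nfib d k, nfib r k) :=
  kron_but (fun l => normalized (A l)) k.

Definition uvec (k : 'I_K) (t : 'I_T) (h : 'I_(nfib d k)) : 'cV[R]_(r k) :=
  unfold k (FZ t) *m rowv (Lam k) h.

Section Rotation.
Variables (k : 'I_K) (Qhat : 'M[R]_(d k, r k)).
Let Q := normalized (A k).

Definition Dhat : 'M[R]_(r k) := Qhat^T *m Shat k *m Qhat.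

(* [invmx] returns its argument on singular matrices, so the two matrices below
   have their intended meaning when Dhat is invertible, i.e. when the r k
   largest eigenvalues of Shat are nonzero. *)
Definition Hrow (j : 'I_(d k)) : 'M[R]_(r k) :=
  invmx Dhat *m \sum_i (rowv Qhat i *m
    \sum_h (#|psi i j h|%:R^-1 *:
      \sum_(t in psi i j h)
        ((uvec t h)^T *m rowv Q i) 0 0 *: (uvec t h)^T)).

Definition Hall : 'M[R]_(r k) :=
  T%:R^-1 *: \sum_(t < T)
    (invmx Dhat *m Qhat^T *m Q *m unfold k (FZ t) *m (Lam k)^T *m Lam k
       *m (unfold k (FZ t))^T).

End Rotation.
End Estimation.

(** * Probability *)

Section Probability.
Context {R : realType} {dO : measure_display} {Om : measurableType dO}.
Variable P : probability Om R.

(* Sigma-field generated by the random variables X i, i in D. *)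
Definition sigma_of (I : Type) (dV : measure_display) (V : measurableType dV)
    (D : set I) (X : I -> {RV P >-> V}) : set (set Om) :=
  <<s \bigcup_(i in D) preimage_set_system setT (X i) measurable >>.

Definition sigma_join (G1 G2 : set (set Om)) : set (set Om) :=
  <<s G1 `|` G2 >>.

Definition independent_fields (G1 G2 : set (set Om)) : Prop :=
  forall A B, G1 A -> G2 B -> P (A `&` B) = (P A * P B)%E.

Definition mutually_independent (I : eqType) (X : I -> {RV P >-> R}) : Prop :=
  forall (s : seq I) (B : I -> set R), uniq s -> (forall i, measurable (B i)) ->
    P (\bigcap_(i in [set` s]) X i @^-1` B i)
    = (\prod_(i <- s) P (X i @^-1` B i))%E.

Definition identically_distributed (I : Type) (X : I -> {RV P >-> R}) : Prop :=
  forall i j (B : set R), measurable B -> P (X i @^-1` B) = P (X j @^-1` B).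

Definition standardized (I : Type) (X : I -> {RV P >-> R}) : Prop :=
  forall i, ('E_P[X i] = 0)%E /\ ('V_P[X i] = 1)%E.

Definition fourth_moment_le (C : R) (X : {RV P >-> R}) : Prop :=
  ('E_P[fun w => (X w ^+ 4)%R] <= C%:E)%E.

Definition is_OP (X : nat -> Om -> R) (b : nat -> R) : Prop :=
  forall e : R, 0 < e -> exists2 C : R, 0 < C &
    \forall n \near \oo, (P [set w | (C * `|b n| < `|X n w|)%R] <= e%:E)%E.

Definition is_oP (X : nat -> Om -> R) (b : nat -> R) : Prop :=
  forall e : R, 0 < e ->
    P [set w | e * `|b n| < `|X n w| ] @[n --> \oo] --> 0%E.

(* alpha(h) for a scalar process in discrete time. *)
Definition alpha_coef (x : int -> {RV P >-> R}) (h : nat) : \bar R :=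
  ereal_sup [set v | exists tau A B,
    [/\ sigma_of [set t : int | t <= tau] x A,
        sigma_of [set t : int | tau + h%:Z <= t] x B &
        v = `|P (A `&` B) - P A * P B|%E]].

Definition alpha_mixing (gam : R) (x : int -> {RV P >-> R}) : Prop :=
  (\sum_(1 <= h <oo) (alpha_coef x h `^ (1 - 2 / gam)%R) < +oo)%E.

(* F_t = sum_(q >= 0) a_q X_(t-q), entrywise, as an almost surely convergent
   series. *)
Definition linear_process (I : Type) (a : nat -> R)
    (X F : int -> I -> {RV P >-> R}) : Prop :=
  forall t i, {ae P, forall w,
    series (fun q => a q * X (t - q%:Z) i w) @ \oo --> F t i w}.

Definition unit_l2 (a : nat -> R) : Prop :=
  (\sum_(0 <= q <oo) (a q ^+ 2)%:E = 1)%E.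

Definition l1_bounded (a : nat -> R) : Prop :=
  exists c : R, (\sum_(0 <= q <oo) `|a q|%:E <= c%:E)%E.

End Probability.

(** * The factor model along an asymptotic sequence *)

(* Stage n of the asymptotics has [sampleT n] time points and dimensions
   [dims n]; K and the core sizes r, re do not depend on n, and neither do the
   core factor series and the coefficients of the linear processes. Processes
   run over all integer times; the observed ones are 1, ..., sampleT n. *)
Record factor_model (R : realType) (dO : measure_display)
    (Om : measurableType dO) (P : probability Om R)
    (K : nat) (r re : 'I_K -> nat) := FactorModel {
  sampleT : nat -> nat;
  dims : nat -> 'I_K -> nat;
  loading : forall n (k : 'I_K), 'I_(dims n k) -> 'I_(r k) -> {RV P >-> R};
  core : int -> tidx r -> {RV P >-> R};
  err : forall n, int -> tidx (dims n) -> {RV P >-> R};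
  observed : forall n, 'I_(sampleT n) -> tidx (dims n) -> {RV P >-> bool};
  coef_f : nat -> R;
  innov_f : int -> tidx r -> {RV P >-> R};
  loading_e : forall n (k : 'I_K), 'M[R]_(dims n k, re k);
  core_e : int -> tidx re -> {RV P >-> R};
  coef_e : nat -> R;
  innov_e : int -> tidx re -> {RV P >-> R};
  sd_eps : forall n, tidx (dims n) -> R;
  eps : forall n, int -> tidx (dims n) -> {RV P >-> R};
  coef_eps : nat -> R;
  innov_eps : forall n, int -> tidx (dims n) -> {RV P >-> R}
}.

Arguments loading {R dO Om P K r re} f n k _ _.
Arguments err {R dO Om P K r re} f n _ _.
Arguments observed {R dO Om P K r re} f n _ _.
Arguments loading_e {R dO Om P K r re} f n k.
Arguments sd_eps {R dO Om P K r re} f n _.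
Arguments eps {R dO Om P K r re} f n _ _.
Arguments innov_eps {R dO Om P K r re} f n _ _.

Section Model.
Context {R : realType} {dO : measure_display} {Om : measurableType dO}.
Context {P : probability Om R} {K : nat} {r re : 'I_K -> nat}.
Variable m : factor_model P r re.

Definition obs_time (T : nat) (t : 'I_T) : int := t.+1%:Z.

Definition loading_mx (n : nat) (w : Om) (k : 'I_K) : 'M[R]_(dims m n k, r k) :=
  \matrix_(i, j) loading m n k i j w.

Definition core_at (n : nat) (w : Om) (t : 'I_(sampleT m n)) : tidx r -> R :=
  fun i => core m (obs_time t) i w.

Definition mask_at (n : nat) (w : Om) (t : 'I_(sampleT m n)) :
  tidx (dims m n) -> bool := fun i => observed m n t i w.

Definition obs (n : nat) (w : Om) (t : 'I_(sampleT m n)) :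
    tidx (dims m n) -> R :=
  fun i => tucker (loading_mx n w) (core_at w t) i + err m n (obs_time t) i w.

Definition observed_ratio (n : nat) (w : Om) (k : 'I_K)
    (i j : 'I_(dims m n k)) (h : 'I_(nfib (dims m n) k)) : R :=
  #|psi (mask_at w) i j h|%:R / (sampleT m n)%:R.

Definition dk (n : nat) (k : 'I_K) : R := (dims m n k)%:R.
Definition dtot (n : nat) : R := \prod_(k < K) dk n k.
Definition dmk (n : nat) (k : 'I_K) : R := dtot n / dk n k.
Definition Tn (n : nat) : R := (sampleT m n)%:R.

Definition asymptotic_regime : Prop :=
  sampleT m n @[n --> \oo] --> \oo /\
  forall k, dims m n k @[n --> \oo] --> \oo.

Definition mean_zero : Prop :=
  forall n (t : 'I_(sampleT m n)) (i : tidx (dims m n)),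
    ('E_P[fun w => obs w t i] = 0)%E.

(* Sigma-fields of the loadings and of the missingness pattern at stage n, and
   of the factor and error series over the set D of times. *)
Definition sigma_loading (n : nat) : set (set Om) :=
  sigma_of [set: {k : 'I_K & ('I_(dims m n k) * 'I_(r k))%type}]
    (fun p => loading m n (tag p) (tagged p).1 (tagged p).2).

Definition sigma_mask (n : nat) : set (set Om) :=
  sigma_of [set: ('I_(sampleT m n) * tidx (dims m n))%type]
    (fun p => observed m n p.1 p.2).

Definition sigma_FE (n : nat) (D : set int) : set (set Om) :=
  sigma_join
    (sigma_of [set p : int * tidx r | D p.1] (fun p => core m p.1 p.2))
    (sigma_of [set p : int * tidx (dims m n) | D p.1]
       (fun p => err m n p.1 p.2)).

(* Almost surely, a uniform lower bound psi0 for all n, k, i, j, h.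
   The loadings act as fixed parameters in the requirement on the missingness
   pattern: the pattern together with the loadings is independent of factors
   and errors, rather than each of the two separately. *)
Definition assumption_O1 (psi0 : R) : Prop :=
  [/\ forall n, independent_fields P
        (sigma_join (sigma_loading n) (sigma_mask n))
        (sigma_FE n [set s | exists t : 'I_(sampleT m n), s = obs_time t]),
      0 < psi0 &
      forall n (k : 'I_K) (i j : 'I_(dims m n k)) (h : 'I_(nfib (dims m n) k)),
        {ae P, forall w, psi0 <= observed_ratio w i j h}].

Definition assumption_M1 : Prop :=
  exists2 gam : R, 2 < gam &
    (forall i, alpha_mixing gam (fun t => core m t i)) /\
    (forall n i, alpha_mixing gam (fun t => err m n t i)).

Definition assumption_F1 : Prop :=
  [/\ linear_process (coef_f m) (innov_f m) (core m),
      let X := fun p : int * tidx r => innov_f m p.1 p.2 in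
      [/\ mutually_independent X, identically_distributed X,
          standardized X &
          exists C : R, forall p, fourth_moment_le C (X p)],
      unit_l2 (coef_f m) &
      l1_bounded (coef_f m)].

(* The loadings are random: their rank, limits and rates are almost sure, with
   constants in the rates that may depend on the realization. [alpha k j] is
   alpha_(k,j) with j counted from 1. *)
Definition assumption_L1 (alpha : 'I_K -> nat -> R) : Prop :=
  [/\ forall n k, {ae P, forall w, \rank (loading_mx n w k) = r k},
      forall n, independent_fields P (sigma_loading n) (sigma_FE n setT),
      forall k, exists2 SigmaA : 'M[R]_(r k),
        posdef SigmaA /\
        (exists c C : R, 0 < c /\
           forall a, eigenvalue SigmaA a -> c <= a <= C) &
        {ae P, forall w, forall i j,
          (let A := loading_mx n w k in
           Zinvhalf A *m A^T *m A *m Zinvhalf A) i j @[n --> \oo]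
          --> SigmaA i j},
      forall k (j : 'I_(r k)), {ae P, forall w,
        let z := fun n => Zdiag (loading_mx n w k) 0 j : R^o in
        let v := fun n => dk n k `^ alpha k j.+1 : R^o in
        z =O_\oo v /\ v =O_\oo z} &
      forall k, [/\ 1 / 2 < alpha k (r k),
        (forall i j, (1 <= i <= j)%N -> (j <= r k)%N -> alpha k j <= alpha k i) &
        alpha k 1 <= 1]].

Definition assumption_E1 : Prop :=
  [/\ forall n t (i : tidx (dims m n)) w,
        err m n t i w = tucker (loading_e m n)
                        (fun j => core_e m t j w) i
                      + sd_eps m n i * eps m n t i w,
      forall t, mutually_independent (core_e m t) /\ standardized (core_e m t),
      forall n t, mutually_independent (eps m n t) /\
                  standardized (eps m n t),
      forall n, independent_fields P
        (sigma_of setT (fun p : int * tidx (dims m n) => eps m n p.1 p.2))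
        (sigma_of setT (fun p : int * tidx re => core_e m p.1 p.2)) &
      (exists C : R, forall n (i : tidx (dims m n)), 0 <= sd_eps m n i <= C) /\
      (forall k, (fun n => norm1 (loading_e m n k) : R^o) =O_\oo
                 (fun=> 1 : R^o))].

Definition assumption_E2 : Prop :=
  let Xf := fun p : int * tidx r => innov_f m p.1 p.2 in
  let Xe := fun p : int * tidx re => innov_e m p.1 p.2 in
  let Xeps := fun n (p : int * tidx (dims m n)) => innov_eps m n p.1 p.2 in
  [/\ linear_process (coef_e m) (innov_e m) (core_e m) /\
      (forall n, linear_process (coef_eps m) (innov_eps m n)
                   (eps m n)),
      forall n,
        independent_fields P (sigma_of setT Xe) (sigma_of setT (Xeps n)) /\
        independent_fields P (sigma_of setT Xf)
          (sigma_join (sigma_of setT Xe) (sigma_of setT (Xeps n))),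
      [/\ mutually_independent Xe, standardized Xe &
          exists C : R, forall p, fourth_moment_le C (Xe p)],
      (forall n, mutually_independent (Xeps n) /\ standardized (Xeps n)) /\
      (exists C : R, forall n p, fourth_moment_le C (Xeps n p)) &
      [/\ unit_l2 (coef_e m), unit_l2 (coef_eps m),
          l1_bounded (coef_e m) & l1_bounded (coef_eps m)]].

Definition gs (alpha : 'I_K -> nat -> R) (n : nat) : R :=
  \prod_(k < K) dk n k `^ alpha k 1%N.

(* alpha_(k,1) - alpha_(k,r_k) *)
Definition spread (alpha : 'I_K -> nat -> R) (k : 'I_K) : R :=
  alpha k 1%N - alpha k (r k).

Definition assumption_R1 (alpha : 'I_K -> nat -> R) : Prop :=
  forall k,
  [/\ dtot n * (gs alpha n ^+ 2)^-1 * (Tn n)^-1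
        * dk n k `^ (2 * spread alpha k + 1) @[n --> \oo] --> 0,
      dtot n * (gs alpha n)^-1 * (Tn n)^-1
        * dk n k `^ (2 * spread alpha k) @[n --> \oo] --> 0 &
      dtot n * (gs alpha n)^-1
        * dk n k `^ (spread alpha k - 1 / 2) @[n --> \oo] --> 0].

Section Errors.
Variables (k : 'I_K)
  (Qhat : forall n, 'I_(dims m n k) -> 'I_(r k) -> {RV P >-> R}).

Definition Qhat_mx (n : nat) (w : Om) : 'M[R]_(dims m n k, r k) :=
  \matrix_(i, j) Qhat i j w.

Definition Q_mx (n : nat) (w : Om) : 'M[R]_(dims m n k, r k) :=
  normalized (loading_mx n w k).

Definition is_estimator : Prop :=
  forall n w, top_eigenvectors (Shat (mask_at w) (obs w) k) (Qhat_mx n w).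

Definition H_mx (n : nat) (w : Om) (j : 'I_(dims m n k)) : 'M[R]_(r k) :=
  Hrow (mask_at w) (obs w) (loading_mx n w) (core_at w) (Qhat_mx n w) j.

Definition Ha_mx (n : nat) (w : Om) : 'M[R]_(r k) :=
  Hall (mask_at w) (obs w) (loading_mx n w) (core_at w) (Qhat_mx n w).

End Errors.
End Model.
Arguments spread {R K} r alpha k.

(* Main.v *)
(* Let N be the difference between Shat_k and the same weighted average of products
   formed from the common component alone. Since Qhat_k = Shat_k Qhat_k Dhat_k^-1, and
   since H_(k,j) Q_(k,j.) is the j-th row of the average for the common component times
   Qhat_k Dhat_k^-1, the total squared error of the rows is the squared Frobenius norm
   of N Qhat_k Dhat_k^-1, at most ||N||_F^2 / lambda^2 with lambda the smallest of the
   r_k leading eigenvalues. For H_k^a the average of the common component has the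
   weights 1/T instead of those of the mask.
   Loadings and mask are independent of the factors and errors, so they may be frozen.
   The mean of ||N||_F^2 is then a sum of second moments of bilinear forms in linear
   processes; expanding these over the lags leaves bilinear forms in the innovations,
   whose terms are orthogonal off the diagonal. The same computation shows that the
   averages of the common component differ from their mean ||A_(-k)||_F^2 A_k A_k' by
   O(g_s^2 / T) in mean square, with A_(-k) the Kronecker product of the other loading
   matrices; under (R1) this bounds lambda below by a constant times
   g_s d_k^(alpha_(k,r_k) - alpha_(k,1)). *)

Require Import Defs.
From HB Require Import structures.
From mathcomp Require Import all_boot all_order all_algebra.
From mathcomp Require Import all_classical all_reals all_analysis.
From mathcomp Require Import measurable_realfun ring lra zify.

Set Implicit Arguments.
Unset Strict Implicit.
Unset Printing Implicit Defensive.

Import Order.TTheory GRing.Theory Num.Theory.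
Import numFieldNormedType.Exports.

Local Open Scope classical_set_scope.
Local Open Scope ring_scope.

(** * Mean squares *)

(** The constants in the rates of the loadings are random and only almost surely finite, so no bound
    on an unconditional mean is available. Every estimate is made on an event of probability at
    least 1 - e with constants depending on e, which is what O_P allows. Conditioning on loadings
    and mask is replaced by a product law: for two independent sub-sigma-fields, the diagonal map
    has a product distribution. Orthogonality is used only where it pays. Products that involve the
    factor part of the error are bounded by the triangle inequality, since bounded column sums of
    the A_e make the total load of that part O(1). The remaining products with the idiosyncratic
    part are orthogonal over times and fibres, except for its own squares on the diagonal i = j,
    whose mean is not zero: these are the source of the term 1/d_k of the rate, the orthogonal sums
    that of 1/(T d_(-k)). Masked and full averages have the same mean because both kinds of weights
    sum to one over time; the mask enters the bounds only through the sum of squared weights, at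
    most 1/(psi0 T). *)

Lemma sum_sqr_le (R : realFieldType) (I : Type) (s : seq I) (P : pred I)
    (x a b : I -> R) :
  (forall i, 0 <= a i) -> (forall i, 0 <= b i) ->
  (forall i, x i ^+ 2 <= a i * b i) ->
  (\sum_(i <- s | P i) x i) ^+ 2
    <= (\sum_(i <- s | P i) a i) * (\sum_(i <- s | P i) b i).
Proof.
move=> a0 b0 xab; elim: s => [|i s IH]; first by rewrite !big_nil expr0n mul0r.
rewrite !big_cons; case: ifP => // _.
set S := \sum_(j <- s | P j) x j in IH *.
set A := \sum_(j <- s | P j) a j in IH *.
set B := \sum_(j <- s | P j) b j in IH *.
have A0 : 0 <= A by apply: sumr_ge0.
have B0 : 0 <= B by apply: sumr_ge0.
have := xab i; have := a0 i; have := b0 i.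
move: (x i) (a i) (b i) => u p q q0 p0 upq.
(* The cross term in the induction for Cauchy-Schwarz: its square is at most 4 (p B) (q A), hence at
   most (p B + q A)^2. *)
have key : 2 * u * S <= p * B + q * A.
  have pq0 : 0 <= p * B + q * A by rewrite addr_ge0 ?mulr_ge0.
  have [us|us] := leP 0 (2 * u * S); last exact: le_trans (ltW us) _.
  rewrite -ler_sqr ?nnegrE //.
  have : u ^+ 2 * S ^+ 2 <= (p * q) * (A * B) by rewrite ler_pM ?sqr_ge0.
  have := sqr_ge0 (p * B - q * A); nra.
nra.
Qed.

Section MeanSquare.
Context d (T : measurableType d) (R : realType) (P : probability T R).
Implicit Types (f g : T -> R) (B : R).

(** A finite bound on the extended integral already contains square integrability, so products of
    two such functions are integrable. *)
Definition msq_le f B : Prop :=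
  measurable_fun setT f /\ (\int[P]_w ((f w) ^+ 2)%:E <= B%:E)%E.

Lemma measurable_sqrE f : measurable_fun setT f ->
  measurable_fun setT (EFin \o (fun w => (f w) ^+ 2)).
Proof. by move=> mf; apply/measurable_EFinP; exact: measurable_funX. Qed.

Lemma msq_le_ge0 f B : msq_le f B -> 0 <= B.
Proof.
case=> mf; rewrite -lee_fin; apply: le_trans.
by apply: integral_ge0 => w _; rewrite lee_fin sqr_ge0.
Qed.

Lemma msq_leW f B B' : msq_le f B -> B <= B' -> msq_le f B'.
Proof. by case=> mf fB BB'; split=> //; rewrite (le_trans fB) ?lee_fin. Qed.

Lemma integral_wsum_sqr_le (I : Type) (s : seq I) (c : I -> R)
    (f : I -> T -> R) (B : I -> R) :
  (forall i, 0 <= c i) -> (forall i, msq_le (f i) (B i)) ->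
  (\int[P]_w (\sum_(i <- s) c i * f i w ^+ 2)%:E
     <= (\sum_(i <- s) c i * B i)%:E)%E.
Proof.
move=> c0 fB; under eq_integral do rewrite -sumEFin.
rewrite ge0_integral_sum //; first 1 last.
- move=> i; apply/measurable_EFinP/measurable_funM => //.
  by apply/measurable_funX; case: (fB i).
- by move=> i w _; rewrite lee_fin mulr_ge0 ?sqr_ge0.
rewrite -sumEFin; apply: lee_sum => i _.
under eq_integral do rewrite EFinM.
rewrite ge0_integralZl_EFin //.
- by rewrite EFinM lee_wpmul2l ?lee_fin //; case: (fB i).
- by move=> w _; rewrite lee_fin sqr_ge0.
- by apply: measurable_sqrE; case: (fB i).
Qed.

Lemma measurable_wsum (I : Type) (s : seq I) (c : I -> R) (f : I -> T -> R) :
  (forall i, measurable_fun setT (f i)) ->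
  measurable_fun setT (fun w => \sum_(i <- s) c i * f i w).
Proof.
by move=> mf; apply: measurable_sum => i; exact: measurable_funM.
Qed.

(** Triangle inequality in L2, from the pointwise bound (sum c_i f_i)^2 <= (sum |c_i|) (sum |c_i|
    f_i^2). It ignores all cancellation between the terms. *)
Lemma msq_le_comb (I : Type) (s : seq I) (c : I -> R) (f : I -> T -> R) B :
  (forall i, msq_le (f i) B) ->
  msq_le (fun w => \sum_(i <- s) c i * f i w) ((\sum_(i <- s) `|c i|) ^+ 2 * B).
Proof.
move=> fB; split; first by apply: measurable_wsum => i; case: (fB i).
pose C := \sum_(i <- s) `|c i|.
have C0 : 0 <= C by apply: sumr_ge0.
apply: (@le_trans _ _
  (\int[P]_w (C%:E * (\sum_(i <- s) `|c i| * f i w ^+ 2)%:E))%E).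
  apply: ge0_le_integral => //.
  - by move=> w _; rewrite lee_fin sqr_ge0.
  - by apply: measurable_sqrE; apply: measurable_wsum => i; case: (fB i).
  - apply: measurable_funeM; apply/measurable_EFinP.
    by apply: measurable_wsum => i; apply: measurable_funX; case: (fB i).
  - move=> w _; rewrite -EFinM lee_fin; apply: sum_sqr_le => // i.
      by rewrite mulr_ge0 ?sqr_ge0.
    by rewrite exprMn [leRHS]mulrA -(expr2 `|c i|) real_normK ?num_real.
rewrite ge0_integralZl_EFin //.
- rewrite expr2 -mulrA EFinM lee_wpmul2l ?lee_fin //.
  by apply: le_trans (integral_wsum_sqr_le _ _ fB) _; rewrite // -mulr_suml.
- by move=> w _; rewrite lee_fin sumr_ge0 // => i _; rewrite mulr_ge0 ?sqr_ge0.
- apply/measurable_EFinP.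
  by apply: measurable_wsum => i; apply: measurable_funX; case: (fB i).
Qed.

(** Unit weights in Cauchy-Schwarz cost the factor [#|I|] but allow a separate bound for each
    term. *)
Lemma msq_le_sum (I : finType) (f : I -> T -> R) (B : I -> R) :
  (forall i, msq_le (f i) (B i)) ->
  msq_le (fun w => \sum_i f i w) (#|I|%:R * \sum_i B i).
Proof.
move=> fB; split; first by apply: measurable_sum => i; case: (fB i).
apply: (@le_trans _ _
  (\int[P]_w (#|I|%:R%:E * (\sum_i 1 * f i w ^+ 2)%:E))%E).
  apply: ge0_le_integral => //.
  - by move=> w _; rewrite lee_fin sqr_ge0.
  - by apply: measurable_sqrE; apply: measurable_sum => i; case: (fB i).
  - apply: measurable_funeM; apply/measurable_EFinP.
    by apply: measurable_wsum => i; apply: measurable_funX; case: (fB i).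
  - move=> w _; rewrite -EFinM lee_fin.
    rewrite -[X in X%:R]sum1_card natr_sum; apply: sum_sqr_le => // i.
      by rewrite mulr_ge0 ?sqr_ge0.
    by rewrite !mul1r.
rewrite ge0_integralZl_EFin //.
- rewrite EFinM lee_wpmul2l ?lee_fin //.
  apply: le_trans (integral_wsum_sqr_le _ _ fB) _ => //.
  by under eq_bigr do rewrite mul1r.
- by move=> w _; rewrite lee_fin sumr_ge0 // => i _; rewrite mulr_ge0 ?sqr_ge0.
- apply/measurable_EFinP.
  by apply: measurable_wsum => i; apply: measurable_funX; case: (fB i).
Qed.

Lemma msq_leD f g B B' : msq_le f B -> msq_le g B' ->
  msq_le (fun w => f w + g w) (2 * (B + B')).
Proof.
move=> fB gB; have := @msq_le_sum bool (fun b => if b then f else g)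
  (fun b => if b then B else B').
rewrite card_bool big_bool /=; under eq_fun do rewrite big_bool /=.
by apply => -[].
Qed.

Lemma integrable_mul_msq f g B B' : msq_le f B -> msq_le g B' ->
  P.-integrable setT (EFin \o (fun w => f w * g w)).
Proof.
move=> [mf fB] [mg gB].
have int2 (h : T -> R) (C : R) : measurable_fun setT h ->
    (\int[P]_w ((h w) ^+ 2)%:E <= C%:E)%E ->
    P.-integrable setT (fun w => ((h w) ^+ 2)%:E).
  move=> mh hC; apply/integrableP; split; first exact: measurable_sqrE.
  under eq_integral do rewrite abse_EFin ger0_norm ?sqr_ge0 //.
  exact: le_lt_trans hC (ltry _).
have fgi := integrableD measurableT (int2 _ _ mf fB) (int2 _ _ mg gB).
apply: le_integrable fgi => //.
  by apply/measurable_EFinP; exact: measurable_funM.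
move=> w _ /=; rewrite lee_fin [leRHS]ger0_norm ?addr_ge0 ?sqr_ge0 //.
rewrite normrM -(real_normK (num_real (f w))) -(real_normK (num_real (g w))).
by have := sqr_ge0 (`|f w| - `|g w|); have := sqr_ge0 (`|f w| + `|g w|); nra.
Qed.

(** Pythagoras: orthogonality replaces the squared l1 norm of the coefficients by their squared l2
    norm. For averages over T times this is the gain of 1/T. *)
Lemma msq_le_orth (I : finType) (c : I -> R) (f : I -> T -> R) B :
  (forall i, msq_le (f i) B) ->
  (forall i j, i != j -> (\int[P]_w (f i w * f j w)%:E = 0)%E) ->
  msq_le (fun w => \sum_i c i * f i w) ((\sum_i c i ^+ 2) * B).
Proof.
move=> fB f0; split; first by apply: measurable_wsum => i; case: (fB i).
have ifij i j : P.-integrable setT (EFin \o (fun w => f i w * f j w)).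
  exact: integrable_mul_msq (fB i) (fB j).
have -> : (\int[P]_w ((\sum_i c i * f i w) ^+ 2)%:E =
    \sum_i \sum_j ((c i * c j)%:E * \int[P]_w (f i w * f j w)%:E))%E.
  transitivity (\int[P]_w (\sum_i \sum_j ((c i * c j)%:E * (f i w * f j w)%:E)))%E.
    apply: eq_integral => w _; rewrite expr2 mulr_suml -sumEFin.
    apply: eq_bigr => i _; rewrite mulr_sumr -sumEFin; apply: eq_bigr => j _.
    by rewrite -EFinM; congr EFin; ring.
  rewrite integral_sum //; last first.
    by move=> i; apply: integrable_sum => // j _; apply: integrableZl => //; exact: ifij.
  apply: eq_bigr => i _; rewrite integral_sum //; last first.
    by move=> j; apply: integrableZl => //; exact: ifij.
  by apply: eq_bigr => j _; rewrite integralZl //; exact: ifij.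
rewrite mulr_suml -sumEFin; apply: lee_sum => i _.
rewrite (bigD1 i) //= big1 ?adde0; last first.
  by move=> j ji; rewrite f0 1?eq_sym // mule0.
rewrite -(expr2 (c i)) [leRHS]EFinM lee_wpmul2l ?lee_fin ?sqr_ge0 //.
by under eq_integral do rewrite -expr2; case: (fB i).
Qed.

(** From f^2 g^2 <= (f^4 + g^4) / 2. *)
Lemma msq_leM f g B : msq_le (fun w => f w * f w) B ->
  msq_le (fun w => g w * g w) B ->
  measurable_fun setT f -> measurable_fun setT g ->
  msq_le (fun w => f w * g w) B.
Proof.
move=> fB gB mf mg.
have mfg : measurable_fun setT (fun w => f w * g w) by exact: measurable_funM.
split=> //.
have [[mff _] [mgg _]] := (fB, gB).
have := @integral_wsum_sqr_le bool [:: true; false] (fun=> 2^-1)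
  (fun b => if b then fun w => f w * f w else fun w => g w * g w)
  (fun=> B) (fun=> _) _.
have -> : \sum_(i <- [:: true; false]) 2^-1 * B = B.
  by rewrite !big_cons big_nil; field.
move=> h; apply: le_trans (h _ _); [|by rewrite invr_ge0|by case].
apply: ge0_le_integral => //.
- by move=> w _; rewrite lee_fin sqr_ge0.
- exact: measurable_sqrE.
- apply/measurable_EFinP; apply: measurable_wsum => -[];
  exact: measurable_funX.
- move=> w _; rewrite lee_fin !big_cons big_nil addr0.
  move: (f w) (g w) => x y; clear; have := sqr_ge0 (x ^+ 2 - y ^+ 2); nra.
Qed.

(** Fatou's lemma for the squares; almost sure convergence identifies their lower limit with g^2. *)
Lemma msq_le_lim (f : nat -> T -> R) g B :
  (forall n, msq_le (f n) B) -> measurable_fun setT g ->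
  {ae P, forall w, f n w @[n --> \oo] --> g w} -> msq_le g B.
Proof.
move=> fB mg fg; split=> //.
pose F n w := ((f n w) ^+ 2)%:E.
have mF n : measurable_fun setT (F n) by apply: measurable_sqrE; case: (fB n).
have F0 n w : (0 <= F n w)%E by rewrite lee_fin sqr_ge0.
have -> : (\int[P]_w ((g w) ^+ 2)%:E = \int[P]_w limn_einf (F ^~ w))%E.
  apply: ge0_ae_eq_integral => //.
  - exact: measurable_sqrE.
  - apply: (measurableT_comp (f := -%E)) => //.
    by apply: measurable_fun_limn_esup => n; exact: measurableT_comp.
  - by move=> w _; rewrite lee_fin sqr_ge0.
  - move=> w _; rewrite limn_einf_lim; apply: lime_ge; first exact: is_cvg_einfs.
    by near=> n; apply: le_ereal_inf_tmp => _ [m _ <-].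
  - apply: filterS fg => w fgw _.
    apply/esym; rewrite (cvg_limn_einf_sup (l := ((g w) ^+ 2)%:E)) //.
    apply: cvg_EFin; first by near=> n.
    by apply: (@cvg_comp _ _ _ (f ^~ w) (fun x : R => x ^+ 2)); [exact: fgw|
      exact: exprn_continuous].
apply: (le_trans (fatou P measurableT mF _)) => //.
rewrite limn_einf_lim; apply: lime_le; first exact: is_cvg_einfs.
near=> n; apply: le_trans (ereal_inf_lbound _) (proj2 (fB n)).
by exists n => //=.
Unshelve. all: by end_near. Qed.

End MeanSquare.

(** * Independence *)

Section Independence.
Context d (Om : measurableType d) (R : realType) (P : probability Om R).

Lemma g_sigma_measurable (H : set (set Om)) :
  H `<=` measurable -> <<s H >> `<=` measurable.
Proof. by move=> Hm; apply: smallest_sub => //; exact: sigma_algebra_measurable. Qed.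

(** Dynkin's pi-lambda argument: for fixed [A], the sets [B] that satisfy the product formula form a
    Dynkin system. *)
Lemma indep_g_sigma (A : set Om) (G : set (set Om)) :
  measurable A -> G `<=` measurable -> setI_closed G ->
  (forall B, G B -> P (A `&` B) = P A * P B)%E ->
  forall B, <<s G >> B -> P (A `&` B) = (P A * P B)%E.
Proof.
move=> mA mG GI GA B.
rewrite -setI_closed_g_dynkin_g_sigma_algebra // => GB.
suff : measurable B /\ (P (A `&` B) = P A * P B)%E by case.
move: B GB; apply: smallest_sub; last by move=> B GB; split; [exact: mG|exact: GA].
have Pfin (C : set Om) : measurable C -> P C \is a fin_num.
  by move=> mC; rewrite fin_num_measure.
split.
- by split; rewrite // setIT probability_setT mule1.
- move=> B [mB AB]; split; first exact: measurableC.
  rewrite -setDE measureD //; last by rewrite ltey_eq Pfin.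
  by rewrite probability_setC // muleBr ?Pfin ?mule1 // -AB.
- move=> F tF HF; split; first by apply: bigcup_measurable => i _; case: (HF i).
  have mF i : measurable (F i) by case: (HF i).
  rewrite setI_bigcupr measure_bigcup //; first 1 last.
  + by move=> i _; exact: measurableI.
  + by apply: trivIset_setIl.
  rewrite measure_bigcup // -(fineK (Pfin _ mA)) -nneseriesZl //.
  by apply: eq_eseriesr => i _; rewrite fineK ?Pfin //; case: (HF i).
Qed.

Section Decoupling.
Variables H1 H2 : set (set Om).
Hypotheses (mH1 : H1 `<=` measurable) (mH2 : H2 `<=` measurable).
Hypothesis indep : independent_fields P <<s H1 >> <<s H2 >>.

Notation S1 := (g_sigma_algebraType H1).
Notation S2 := (g_sigma_algebraType H2).

Let id1 (w : Om) : S1 := w.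
Let id2 (w : Om) : S2 := w.
Let diag (w : Om) : (S1 * S2)%type := (w, w).

Let mid1 : measurable_fun setT id1.
Proof. by move=> _ B mB; rewrite setTI; exact: (g_sigma_measurable mH1). Qed.
Let mid2 : measurable_fun setT id2.
Proof. by move=> _ B mB; rewrite setTI; exact: (g_sigma_measurable mH2). Qed.
Let mdiag : measurable_fun setT diag.
Proof. exact: (measurable_fun_pair mid1 mid2). Qed.

HB.instance Definition _ := isMeasurableFun.Build _ _ _ _ id1 mid1.
HB.instance Definition _ := isMeasurableFun.Build _ _ _ _ id2 mid2.
HB.instance Definition _ := isMeasurableFun.Build _ _ _ _ diag mdiag.

Let m1 := distribution P id1.
Let m2 := distribution P id2.

(** Independence says that the two measures agree on rectangles, and these determine the product
    measure. *)
Let distribution_diag (X : set (S1 * S2)) : measurable X ->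
  (m1 \x m2)%E X = distribution P diag X.
Proof.
by move=> mX; apply: product_measure_unique.
Qed.

Lemma integral_decouple (g : S1 * S2 -> \bar R) :
  measurable_fun setT g -> (forall x, 0 <= g x)%E ->
  (\int[P]_w g (w, w) = \int[P]_w \int[P]_w' g (w, w'))%E.
Proof.
move=> mg g0.
have -> : (\int[P]_w g (w, w) = \int[distribution P diag]_z g z)%E.
  by rewrite (ge0_integral_distribution diag).
rewrite (eq_measure_integral (m1 \x m2)%E); last first.
  by move=> A mA _; rewrite /= distribution_diag.
rewrite fubini_tonelli1 // (ge0_integral_distribution id1) /=.
- apply: eq_integral => w _ /=; rewrite /fubini_F.
  rewrite (ge0_integral_distribution id2) //.
  exact: measurableT_comp.
- exact: measurable_fun_fubini_tonelli_F.
- by move=> x; apply: integral_ge0.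
Qed.

Lemma measurable_decouple (g : S1 * S2 -> \bar R) :
  measurable_fun setT g -> (forall x, 0 <= g x)%E ->
  measurable_fun (setT : set S1) (fun w : S1 => \int[P]_w' g (w, w'))%E.
Proof.
move=> mg g0.
have := measurable_fun_fubini_tonelli_F (m2 := m2) g mg g0.
apply: eq_measurable_fun => w _; rewrite /fubini_F.
rewrite (ge0_integral_distribution id2) //.
exact: measurableT_comp.
Qed.

(** The law of the diagonal is a product, so by Fubini the integral factors, and the centred factor
    makes it vanish. *)
Lemma integral_indep_mul0 (f : S1 -> R) (h : S2 -> R) :
  measurable_fun setT f -> measurable_fun setT h ->
  P.-integrable setT (EFin \o (fun w : Om => f w * h w)) ->
  P.-integrable setT (EFin \o (f : Om -> R)) ->
  P.-integrable setT (EFin \o (h : Om -> R)) ->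
  (\int[P]_w (f w)%:E = 0)%E ->
  (\int[P]_w (f w * h w)%:E = 0)%E.
Proof.
move=> mf mh ifh i_f ih f0.
pose F (z : S1 * S2) : \bar R := (f z.1 * h z.2)%:E.
have mF : measurable_fun setT F.
  by apply/measurable_EFinP; apply: measurable_funM; exact: measurableT_comp.
have iF : (m1 \x m2)%E.-integrable setT F.
  apply/integrableP; split=> //.
  rewrite (eq_measure_integral (distribution P diag)); last first.
    by move=> A mA _; rewrite /= distribution_diag.
  rewrite (ge0_integral_distribution diag) //=.
    by case/integrableP : ifh.
  by apply/measurable_EFinP/measurableT_comp => //; exact/measurable_EFinP.
transitivity (\int[distribution P diag]_z F z)%E.
  by rewrite (@integral_distribution _ _ _ _ _ P diag).
rewrite (eq_measure_integral (m1 \x m2)%E); last first.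
  by move=> A mA _; rewrite /= distribution_diag.
rewrite -integral12_prod_meas1 //.
have hfin : (\int[m2]_y (h y)%:E)%E \is a fin_num.
  rewrite (@integral_distribution _ _ _ _ _ P id2) //; last exact/measurable_EFinP.
  exact: integrable_fin_num ih.
have ih2 : m2.-integrable setT (EFin \o h).
  apply/integrableP; split; first exact/measurable_EFinP.
  rewrite (ge0_integral_distribution id2) //=.
    by case/integrableP : ih.
  by apply/measurable_EFinP/measurableT_comp.
have i_f1 : m1.-integrable setT (EFin \o f).
  apply/integrableP; split; first exact/measurable_EFinP.
  rewrite (ge0_integral_distribution id1) //=.
    by case/integrableP : i_f.
  by apply/measurable_EFinP/measurableT_comp.
transitivity (\int[m1]_x ((fine (\int[m2]_y (h y)%:E))%:E * (f x)%:E))%E.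
  apply: eq_integral => x _; rewrite /fubini_F /F /=.
  under eq_integral do rewrite EFinM.
  by rewrite integralZl // fineK // muleC.
rewrite integralZl // (@integral_distribution _ _ _ _ _ P id1) //; last first.
  exact/measurable_EFinP.
by rewrite /= f0 mule0.
Qed.

End Decoupling.

End Independence.

(** * Families of mutually independent variables *)

Section MutualIndependence.
Context d (Om : measurableType d) (R : realType) (P : probability Om R).

Lemma measurable_fun_g_sigma dV (V : measurableType dV) (H : set (set Om)) (Y : Om -> V) :
  preimage_set_system setT Y measurable `<=` H ->
  measurable_fun (setT : set (g_sigma_algebraType H)) Y.
Proof.
move=> YH _ B mB; suff : <<s H >> (setT `&` Y @^-1` B) by [].
have HB : H (setT `&` Y @^-1` B) by apply: YH; exists B.
exact: (@sub_sigma_algebra _ setT H _ HB).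
Qed.

Variables (I : eqType) (X : I -> {RV P >-> R}).
Hypothesis indep : mutually_independent X.

Let preim (i : I) := preimage_set_system setT (X i) measurable.

Let preim_measurable i : preim i `<=` measurable.
Proof. by move=> _ [B mB <-]; exact: (measurable_funPT (X i)). Qed.

(** Finite-dimensional cylinder sets: a pi-system generating the sigma-field of the [X i] with [i]
    in [D]. *)
Let rect (D : set I) : set (set Om) := [set A | exists (s : seq I) (B : I -> set R),
  [/\ uniq s, [set` s] `<=` D, (forall i, measurable (B i)) &
      A = \bigcap_(i in [set` s]) X i @^-1` B i]].

Let rect_measurable D : rect D `<=` measurable.
Proof.
move=> _ [s [B [_ _ mB ->]]]; elim: s => [|i s IH].
  by rewrite set_nil bigcap_set0.
have -> : [set` i :: s] = i |` [set` s].
  apply/seteqP; split=> j /=; rewrite inE; first by case/predU1P; [left|right].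
  by case=> [->|->]; rewrite ?eqxx ?orbT.
rewrite bigcap_setU1; apply: measurableI => //.
by rewrite -[_ @^-1` _]setTI; exact: (measurable_funPT (X i)).
Qed.

Let rectI D : setI_closed (rect D).
Proof.
move=> _ _ [s [B [us sD mB ->]]] [s' [B' [us' sD' mB' ->]]].
(* An index missing from one of the lists is not constrained by that cylinder, hence the whole space
   as its factor. *)
exists (undup (s ++ s')), (fun i => (if i \in s then B i else setT) `&`
                                    (if i \in s' then B' i else setT)).
split; first exact: undup_uniq.
- move=> i /=; rewrite mem_undup mem_cat => /orP[]; [exact: sD|exact: sD'].
- by move=> i; apply: measurableI; case: ifP.
apply/seteqP; split=> w /=.
  move=> [h h'] i /= _; split; case: ifP => // ii; [exact: h|exact: h'].
move=> h; split=> i /= ii.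
  by have := h i; rewrite /= mem_undup mem_cat ii => /(_ isT) [].
by have := h i; rewrite /= mem_undup mem_cat ii orbT => /(_ isT) [].
Qed.

(** The product formula spreads from cylinder sets to sigma-fields one side at a time, with the
    other side held fixed. *)
Lemma mutually_independent_fields (i : I) :
  independent_fields P (sigma_of [set i] X) (sigma_of [set j | j != i] X).
Proof.
rewrite /sigma_of bigcup_set1 -/(preim i) => A B sA sB.
have preimI : setI_closed (preim i).
  move=> _ _ [B1 mB1 <-] [B2 mB2 <-]; exists (B1 `&` B2); first exact: measurableI.
  by rewrite !setTI preimage_setI.
have mB : measurable B.
  apply: (g_sigma_measurable _ sB) => C [j _]; exact: preim_measurable.
rewrite setIC muleC.
apply: (indep_g_sigma mB (@preim_measurable i)) sA => // {}A pA.
rewrite setIC muleC.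
have mA := preim_measurable pA.
apply: (indep_g_sigma mA (@rect_measurable [set j | j != i])) => //; last first.
  apply: smallest_sub sB; first exact: smallest_sigma_algebra.
  move=> C [j jD [B0 mB0 <-]]; apply: sub_sigma_algebra.
  exists [:: j], (fun=> B0); split=> //.
    by move=> j' /=; rewrite inE => /eqP ->.
  by rewrite set_cons1 bigcap_set1 setTI.
move=> {sB mB}_ [s [C [us sD mC ->]]].
have [B0 mB0 <-] := pA; rewrite setTI.
have is' : i \notin s by apply/negP => /sD /=; rewrite eqxx.
(* [C'] presents the intersection of the two sets as a cylinder over [i :: s]; comparing the product
   formulas for [i :: s] and for [s] gives the claim. *)
pose C' j := if j == i then B0 else C j.
have C's j : j \in s -> C' j = C j.
  by rewrite /C'; case: eqP => // -> /(negP is').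
have mC' j : measurable (C' j) by rewrite /C'; case: ifP.
have := indep (s := i :: s) (B := C').
rewrite /= is' us => /(_ isT mC').
have C'i : C' i = B0 by rewrite /C' eqxx.
rewrite big_cons C'i => h.
have e : (\prod_(j <- s) P (X j @^-1` C' j) = \prod_(j <- s) P (X j @^-1` C j))%E.
  by apply: eq_big_seq => j js; rewrite C's.
rewrite (indep us mC) -e -h; congr (P _); apply/seteqP; split=> w /=.
  move=> [h0 h1] j /=; rewrite inE => /predU1P[->|js]; first by rewrite C'i.
  by have := h1 j js; rewrite /= -(C's j js).
move=> h0; split; first by have := h0 i (mem_head i s); rewrite /= C'i.
by move=> j js; have := h0 j (mem_behead (s := i :: s) js); rewrite /= C's.
Qed.

(** A centred function of one variable is orthogonal to whatever depends only on the others. *)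
Lemma integral_mutual_mul0 (i : I) (f : R -> R) (g : Om -> R) :
  measurable_fun setT f ->
  measurable_fun (setT : set (g_sigma_algebraType
    (\bigcup_(j in [set j | j != i]) preim j))) g ->
  P.-integrable setT (EFin \o (fun w => f (X i w) * g w)) ->
  P.-integrable setT (EFin \o (fun w => f (X i w))) ->
  P.-integrable setT (EFin \o g) ->
  (\int[P]_w (f (X i w))%:E = 0)%E ->
  (\int[P]_w (f (X i w) * g w)%:E = 0)%E.
Proof.
move=> mf mg ifg i_f ig f0.
apply: (@integral_indep_mul0 _ _ _ P (preim i)
  (\bigcup_(j in [set j | j != i]) preim j) _ _ _ (fun w => f (X i w)) g) => //.
- by move=> C [j _]; exact: preim_measurable.
- by have := @mutually_independent_fields i; rewrite /sigma_of bigcup_set1.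
- apply: (measurableT_comp mf); exact: measurable_fun_g_sigma.
Qed.

End MutualIndependence.

(** * Orthogonality of products of innovations *)

Section Innovations.
Context d (Om : measurableType d) (R : realType) (P : probability Om R).

Lemma msq_le_cst (c : R) : msq_le P (fun=> c) (c ^+ 2).
Proof.
by split; rewrite // integral_cst //= probability_setT mule1.
Qed.

Lemma integrable_msq f B : msq_le P f B -> P.-integrable setT (EFin \o f).
Proof.
move=> fB; have := integrable_mul_msq fB (msq_le_cst 1).
by under eq_fun do rewrite mulr1.
Qed.

Section Family.
Variables (I : eqType) (X : I -> {RV P >-> R}) (C : R).
Hypothesis indep : mutually_independent X.
Hypothesis stdX : standardized X.
Hypothesis fourthX : forall i, fourth_moment_le C (X i).

Lemma innov_mean i : (\int[P]_w (X i w)%:E = 0)%E.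
Proof. by have [] := stdX i; rewrite expectation_def. Qed.

Lemma innov_sqr i : (\int[P]_w (X i w * X i w)%:E = 1)%E.
Proof.
have [] := stdX i => m0; rewrite /variance unlock m0 /= unlock => <-.
by apply: eq_integral => w _; rewrite /= [in RHS]/GRing.mul /= !subr0.
Qed.

Lemma innov_msq i : msq_le P (X i) 1.
Proof.
split=> //; rewrite -(innov_sqr i).
by under eq_integral do rewrite expr2.
Qed.

Lemma innov_msq_mul i j : msq_le P (fun w => X i w * X j w) C.
Proof.
have h k : msq_le P (fun w => X k w * X k w) C.
  split; first exact: measurable_funM.
  have := fourthX k; rewrite /fourth_moment_le unlock.
  by congr (_ <= _)%E; apply: eq_integral => w _ /=; congr EFin; ring.
exact: msq_leM.
Qed.

Let gen i := \bigcup_(j in [set j | j != i]) preimage_set_system setT (X j) measurable.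

Let measurable_gen i j : j != i ->
  measurable_fun (setT : set (g_sigma_algebraType (gen i))) (X j).
Proof.
by move=> ji; apply: measurable_fun_g_sigma => A; exists j.
Qed.

(** An innovation that occurs only once among four factors is centred and independent of the product
    of the other three. *)
Lemma innov_orth4 i j k l : j != i -> k != i -> l != i ->
  (\int[P]_w (X i w * X j w * (X k w * X l w))%:E = 0)%E.
Proof.
move=> ji ki li; pose g w := X j w * (X k w * X l w).
have -> : (\int[P]_w (X i w * X j w * (X k w * X l w))%:E =
           \int[P]_w (id (X i w) * g w)%:E)%E.
  by apply: eq_integral => w _; rewrite /g -mulrA.
apply: (@integral_mutual_mul0 _ _ _ _ _ _ indep i id g) => //.
- by apply: measurable_funM; [|apply: measurable_funM]; exact: measurable_gen.
- have := integrable_mul_msq (innov_msq_mul i j) (innov_msq_mul k l).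
  by under eq_fun do rewrite -mulrA.
- exact: integrable_msq (innov_msq i).
- exact: integrable_mul_msq (innov_msq j) (innov_msq_mul k l).
- exact: innov_mean.
Qed.

Lemma innov_orth2 i j : j != i -> (\int[P]_w (X i w * X j w)%:E = 0)%E.
Proof.
move=> ji; apply: (@integral_mutual_mul0 _ _ _ _ _ _ indep i id) => //.
- exact: measurable_gen.
- exact: integrable_mul_msq (innov_msq i) (innov_msq j).
- exact: integrable_msq (innov_msq i).
- exact: integrable_msq (innov_msq j).
- exact: innov_mean.
Qed.

Lemma innov_msq_sqrB1 i : msq_le P (fun w => X i w * X i w - 1) (2 * (C + 1)).
Proof.
have := msq_leD (innov_msq_mul i i) (msq_le_cst (- 1)).
by rewrite sqrrN expr1n.
Qed.

(** Both factors are functions of single innovations, centred because the variance is 1. *)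
Lemma innov_orth_sqr i j : j != i ->
  (\int[P]_w ((X i w * X i w - 1) * (X j w * X j w - 1))%:E = 0)%E.
Proof.
move=> ji; pose f (x : R) := x * x - 1.
apply: (@integral_mutual_mul0 _ _ _ _ _ _ indep i f (fun w => f (X j w))) => //.
- by apply: measurable_funB => //; apply: measurable_funM.
- apply: measurable_funB => //; apply: measurable_funM; exact: measurable_gen.
- exact: integrable_mul_msq (innov_msq_sqrB1 i) (innov_msq_sqrB1 j).
- exact: integrable_msq (innov_msq_sqrB1 i).
- exact: integrable_msq (innov_msq_sqrB1 j).
- under eq_integral do rewrite /f EFinB.
  rewrite integralB_EFin //.
  + rewrite innov_sqr (integral_cst _ _ 1) // mul1e -[RHS](@subee _ 1%E) //.
    by congr (_ - _)%E; exact: probability_setT.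
  + exact: integrable_mul_msq (innov_msq i) (innov_msq i).
  + exact: integrable_msq (msq_le_cst 1).
Qed.

End Family.

(** The mean factors over the two independent families, so one vanishing factor suffices. With the
    roles of the families exchanged, it can come from either of them. *)
Lemma innov_cross (I J : eqType) (X : I -> {RV P >-> R}) (Y : J -> {RV P >-> R})
    (H1 H2 : set (set Om)) (C D : R) :
  independent_fields P <<s H1 >> <<s H2 >> ->
  H1 `<=` measurable -> H2 `<=` measurable ->
  (forall i, preimage_set_system setT (X i) measurable `<=` H1) ->
  (forall j, preimage_set_system setT (Y j) measurable `<=` H2) ->
  standardized X -> (forall i, fourth_moment_le C (X i)) ->
  standardized Y -> (forall j, fourth_moment_le D (Y j)) ->
  forall i i' j j',
  (\int[P]_w (X i w * X i' w)%:E = 0)%E ->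
  (\int[P]_w (X i w * X i' w * (Y j w * Y j' w))%:E = 0)%E.
Proof.
move=> ind mH1 mH2 XH YH sX fX sY fY i i' j j' X0.
apply: (integral_indep_mul0 mH1 mH2 ind
  (f := fun w => X i w * X i' w) (h := fun w => Y j w * Y j' w)) => //.
- by apply: measurable_funM; apply: measurable_fun_g_sigma.
- by apply: measurable_funM; apply: measurable_fun_g_sigma.
- exact: integrable_mul_msq (innov_msq_mul fX i i') (innov_msq_mul fY j j').
- exact: integrable_msq (innov_msq_mul fX i i').
- exact: integrable_msq (innov_msq_mul fY j j').
Qed.

End Innovations.

(** * From innovations to linear processes *)

Section LinearProcesses.
Context d (Om : measurableType d) (R : realType) (P : probability Om R).

(* Expanding both processes over their lags and weighting by |a_q b_q'| reduces
   second moments of bilinear sums to those of the innovations at fixed lags,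
   so that no autocovariance has to be computed. *)
Lemma msq_le_linear_process (S : finType) (c : S -> R) (a b : nat -> R)
    (La Lb : R) (X Y : S -> nat -> {RV P >-> R}) (x y : S -> {RV P >-> R})
    (kk : nat -> nat -> R) (kap B : R) :
  (forall N, \sum_(0 <= q < N) `|a q| <= La) ->
  (forall N, \sum_(0 <= q < N) `|b q| <= Lb) ->
  (forall s, {ae P, forall w,
     series (fun q => a q * X s q w) n @[n --> \oo] --> x s w}) ->
  (forall s, {ae P, forall w,
     series (fun q => b q * Y s q w) n @[n --> \oo] --> y s w}) ->
  (forall q q',
     msq_le P (fun w => \sum_s c s * (X s q w * Y s q' w - kk q q')) B) ->
  \sum_(0 <= q < N) \sum_(0 <= q' < N) a q * b q' * kk q q' @[N --> \oo] --> kap ->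
  msq_le P (fun w => \sum_s c s * (x s w * y s w - kap)) ((La * Lb) ^+ 2 * B).
Proof.
move=> aL bL ax byy zB kkap.
have B0 : 0 <= B := msq_le_ge0 (zB 0 0).
(* Both series cut off after [N] lags and centred term by term: [kk q q'] stands for the mean of the
   product at lags [q] and [q'], so the centring tends to [kap]. The bound is uniform in [N] and
   survives the limit by Fatou. *)
pose f N w := \sum_(0 <= q < N) \sum_(0 <= q' < N)
  (a q * b q') * \sum_s c s * (X s q w * Y s q' w - kk q q').
have fE N w : f N w = \sum_s c s *
    (series (fun q => a q * X s q w) N * series (fun q => b q * Y s q w) N
     - \sum_(0 <= q < N) \sum_(0 <= q' < N) a q * b q' * kk q q').
  rewrite /f; under eq_bigr do under eq_bigr do rewrite mulr_sumr.
  under eq_bigr do rewrite exchange_big /=.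
  rewrite exchange_big /=; apply: eq_bigr => s _.
  rewrite /series /= mulr_suml -sumrB mulr_sumr; apply: eq_bigr => q _.
  rewrite mulr_sumr -sumrB mulr_sumr; apply: eq_bigr => q' _.
  by ring.
apply: (@msq_le_lim _ _ _ _ f).
- move=> N; rewrite (_ : f N = fun w => \sum_(p <- [seq (q, q') |
      q <- index_iota 0 N, q' <- index_iota 0 N]) (a p.1 * b p.2) *
      \sum_s c s * (X s p.1 w * Y s p.2 w - kk p.1 p.2)); last first.
    by apply/funext => w; rewrite /f big_allpairs_dep.
  apply: msq_leW (msq_le_comb _ _ (fun p => zB p.1 p.2)) _.
  rewrite ler_wpM2r // big_allpairs_dep /=.
  under eq_bigr do under eq_bigr do rewrite normrM.
  under eq_bigr do rewrite -mulr_sumr.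
  rewrite -mulr_suml ler_sqr ?nnegrE.
  + by rewrite ler_pM ?sumr_ge0.
  + by rewrite mulr_ge0 ?sumr_ge0.
  + rewrite mulr_ge0 //.
      by apply: le_trans (aL 0%N); rewrite sumr_ge0.
    by apply: le_trans (bL 0%N); rewrite sumr_ge0.
- apply: measurable_wsum => s.
  by apply: measurable_funB => //; apply: measurable_funM.
- have axs : {ae P, forall w, forall s,
      series (fun q => a q * X s q w) n @[n --> \oo] --> x s w}.
    by apply: filter_forall => s; exact: ax.
  have bys : {ae P, forall w, forall s,
      series (fun q => b q * Y s q w) n @[n --> \oo] --> y s w}.
    by apply: filter_forall => s; exact: byy.
  apply: filterS2 axs bys => w axw byw.
  under eq_fun do rewrite fE.
  apply: cvg_big => [z|s _]; first exact: add_continuous.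
  apply: cvgM; first exact: cvg_cst.
  apply: cvgB => //.
  by apply: cvgM; [exact: axw|exact: byw].
Qed.

End LinearProcesses.

(** * Stochastic boundedness *)

Section Tails.
Context d (Om : measurableType d) (R : realType) (P : probability Om R).

Lemma markov_ge0 (h : Om -> R) (B e : R) : measurable_fun setT h ->
  (forall w, 0 <= h w) -> 0 < B -> 0 < e ->
  (\int[P]_w (h w)%:E <= B%:E)%E ->
  (P [set w | (B / e <= h w)%R] <= e%:E)%E.
Proof.
move=> mh h0 B0 e0 hB.
have mset : measurable [set w | (B / e <= h w)%R].
  by rewrite -[X in measurable X]setTI; exact: measurable_fun_ler.
have Be : 0 < B / e by rewrite divr_gt0.
have h1 : ((B / e)%:E * P [set w | (B / e <= h w)%R] <= B%:E)%E.
  apply: le_trans hB.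
  rewrite -(setIT [set w | (B / e <= h w)%R]) -integral_indic // -ge0_integralZl_EFin //.
  - apply: ge0_le_integral => //.
    + by move=> w _; rewrite mule_ge0 // lee_fin ?ltW.
    + by apply: measurable_funeM; apply/measurable_EFinP; exact: measurable_indic.
    + exact/measurable_EFinP.
    + move=> w _; rewrite indicE; case: (boolP (w \in _)) => [|_].
        by rewrite inE /= mule1 lee_fin.
      by rewrite mule0 lee_fin.
  - by apply/measurable_EFinP; exact: measurable_indic.
  - exact: ltW.
have Pfin : P [set w | (B / e <= h w)%R] \is a fin_num by rewrite fin_num_measure.
rewrite -(fineK Pfin) -EFinM !lee_fin in h1 *.
by move: h1; rewrite mulrAC ler_pdivrMr // ler_pM2l.
Qed.

Lemma probability_le_cover (A B C : set Om) (b c : R) :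
  measurable A -> measurable B -> measurable C -> A `<=` B `|` C ->
  (P B <= b%:E)%E -> (P C <= c%:E)%E -> (P A <= (b + c)%:E)%E.
Proof.
move=> mA mB mC ABC Bb Cc.
apply: (@le_trans _ _ (P (B `|` C))).
  by apply: le_measure; rewrite ?inE //; exact: measurableU.
by rewrite (le_trans (measureU2 P mB mC)) // EFinD leeD.
Qed.

Lemma event_ae (G : set Om) (e : R) (Q : Om -> Prop) :
  measurable G -> (P (~` G) <= e%:E)%E -> {ae P, forall w, Q w} ->
  exists G' : set Om, [/\ measurable G', (P (~` G') <= e%:E)%E &
    forall w, G' w -> G w /\ Q w].
Proof.
move=> mG PG [N [mN PN subN]]; exists (G `&` ~` N); split.
- by apply: measurableI => //; exact: measurableC.
- rewrite -[e]addr0; apply: (probability_le_cover (B := ~` G) (C := N)) => //.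
  + by apply: measurableC; apply: measurableI => //; exact: measurableC.
  + exact: measurableC.
  + by rewrite setCI setCK.
  + by rewrite PN.
- by move=> w [Gw Nw]; split=> //; apply: contrapT => h; apply: Nw; exact: subN.
Qed.

(* Independence turns the law of the diagonal [(w, w)] into a product law, so that a
   bound on the mean with the first argument frozen yields, by Markov, a bound on
   [g (w, w)]. *)
Lemma tail_decouple (H1 H2 : set (set Om)) (mH1 : H1 `<=` measurable)
    (mH2 : H2 `<=` measurable) (ind : independent_fields P <<s H1 >> <<s H2 >>)
    (g : g_sigma_algebraType H1 * g_sigma_algebraType H2 -> R)
    (G : set Om) (B e : R) :
  measurable_fun setT g -> (forall z, 0 <= g z) ->
  measurable G -> 0 < B -> 0 < e ->
  (P (~` G) <= e%:E)%E ->
  (forall w, G w -> \int[P]_w' (g (w, w'))%:E <= B%:E)%E ->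
  exists G' : set Om, [/\ measurable G', (P (~` G') <= (e + e)%:E)%E &
    forall w, G' w -> g (w, w) <= B / e].
Proof.
move=> mg g0 mG B0 e0 PG GB.
pose phi (w : g_sigma_algebraType H1) := (\int[P]_w' (g (w, w'))%:E)%E.
have mEg : measurable_fun setT (EFin \o g) by exact/measurable_EFinP.
have mphi : measurable_fun setT phi.
  by apply: (measurable_decouple P mH2 mEg) => z; rewrite lee_fin.
(* [G] is only measurable in [Om]. [K] contains it, lies in the first sigma-field and carries the
   same bound, so it can be used inside the product integral. *)
pose K : set (g_sigma_algebraType H1) := [set w | (phi w <= B%:E)%E].
have mK : measurable K.
  by rewrite -[K]setTI; exact: emeasurable_fun_infty_c.
have mK' : measurable (K : set Om) by exact: (g_sigma_measurable mH1 mK).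
pose h (z : g_sigma_algebraType H1 * g_sigma_algebraType H2) := g z * \1_K z.1.
have mh : measurable_fun setT h.
  apply: measurable_funM => //.
  by apply: (measurableT_comp (f := (\1_K : g_sigma_algebraType H1 -> R))).
have h0 z : 0 <= h z by rewrite mulr_ge0.
have mdiag : measurable_fun (setT : set Om)
    (fun w => (w, w) : g_sigma_algebraType H1 * g_sigma_algebraType H2).
  apply: measurable_fun_pair => _ A mA; rewrite setTI;
    [exact: (g_sigma_measurable mH1 mA)|exact: (g_sigma_measurable mH2 mA)].
pose hd (w : Om) := h (w, w).
have mhd : measurable_fun setT hd by exact: (measurableT_comp mh mdiag).
have hB : (\int[P]_w (hd w)%:E <= B%:E)%E.
  rewrite (integral_decouple mH1 mH2 ind (g := EFin \o h)); first last.
  - by move=> z; rewrite lee_fin.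
  - exact/measurable_EFinP.
  apply: (@le_trans _ _ (\int[P]_w B%:E)%E); last first.
    rewrite integral_cst // -[leRHS]mule1 lee_wpmul2l ?lee_fin ?(ltW B0) //.
    exact: probability_le1.
  apply: ge0_le_integral => //.
  - by move=> w _; apply: integral_ge0 => w' _; rewrite lee_fin.
  - have mEh : measurable_fun setT (EFin \o h) by exact/measurable_EFinP.
    have mdec := measurable_decouple P mH2 mEh (fun z => h0 z).
    by move=> _ Y mY; exact: (g_sigma_measurable mH1 (mdec measurableT Y mY)).
  - move=> w _; rewrite /h /= indicE; case: (boolP (w \in K)) => [|_].
      by rewrite inE /K /= => wK; under eq_integral do rewrite mulr1.
    by under eq_integral do rewrite mulr0; rewrite integral0 lee_fin ltW.
have mtail : measurable [set w | (B / e <= hd w)%R].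
  by rewrite -[X in measurable X]setTI; exact: measurable_fun_ler.
have PK : (P (~` (K : set Om)) <= e%:E)%E.
  apply: le_trans PG; apply: le_measure; rewrite ?inE; [exact: measurableC..|].
  by apply: subsetC => w /GB.
exists ((K : set Om) `&` ~` [set w | (B / e <= hd w)%R]); split.
- by apply: measurableI => //; exact: measurableC.
- apply: (probability_le_cover (B := ~` K) (C := [set w | (B / e <= hd w)%R])) => //.
  + by apply: measurableC; apply: measurableI => //; exact: measurableC.
  + exact: measurableC.
  + by rewrite setCI setCK.
  + by apply: (markov_ge0 mhd _ B0 e0 hB) => w; exact: h0.
- move=> w [wK /= /negP]; rewrite -ltNge /hd /h /= indicE mem_set // mulr1.
  exact: ltW.
Qed.

(** Continuity from below makes a random threshold deterministic outside an event of probability at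
    most [e]. The number [c] is at once the constant in [Q] and the starting index, which makes the
    events increase. *)
Lemma ae_uniform (Q : nat -> nat -> set Om) (e : R) : 0 < e ->
  (forall c n, measurable (Q c n)) ->
  (forall c c' n, (c <= c')%N -> Q c n `<=` Q c' n) ->
  {ae P, forall w, exists c, forall n, (c <= n)%N -> Q c n w} ->
  exists c (G : set Om), [/\ measurable G, (P (~` G) <= e%:E)%E &
    forall w n, G w -> (c <= n)%N -> Q c n w].
Proof.
move=> e0 mQ Qmono aeQ.
pose E c := \bigcap_(n in [set n | (c <= n)%N]) Q c n.
have mE c : measurable (E c) by apply: bigcap_measurable => // ; exists c => /=.
have Emono : nondecreasing_seq E.
  move=> c c' cc'; apply/subsetPset => w Ew n /= cn.
  by apply: (Qmono _ _ _ cc'); apply: Ew; exact: leq_trans cn.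
have mUE : measurable (\bigcup_c E c) by exact: bigcupT_measurable.
have PUE : P (~` \bigcup_c E c) = 0%E.
  apply: measure_negligible; first exact: measurableC.
  move: aeQ; apply: negligibleS => w /= nUE [c Qc].
  by apply: nUE; exists c.
have PE1 : P (\bigcup_c E c) = 1%E.
  rewrite -(setCK (\bigcup_c E c)) probability_setC ?PUE ?sube0 //.
  exact: measurableC.
have /fine_cvgP[_ PE] : P (E c) @[c --> \oo] --> 1%E.
  by rewrite -PE1; exact: (nondecreasing_cvg_mu (mu := P) mE mUE Emono).
have : \forall c \near \oo, 1 - e < fine (P (E c)).
  by apply: (cvgr_gt _ PE); rewrite ltrBlDr ltrDl.
case=> c _ /(_ c (leqnn c)) /= Ec.
exists c, (E c); split=> //; last by move=> w n Ew cn; exact: Ew.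
rewrite probability_setC // -(fineK (_ : P (E c) \is a fin_num)); last first.
  by rewrite fin_num_measure.
by rewrite -EFinB lee_fin; move: Ec; lra.
Qed.

End Tails.

(** * Tensors *)

Section Tensors.
Context (R : realType).

(** Distributivity of products over sums, in a dependent form because the modes of a tensor have
    different sizes; tagging the indices reduces it to a single index type. *)
Lemma sum_dffun_prod (I : finType) (J : I -> finType)
    (F : forall i, J i -> R) :
  \sum_(f : {dffun forall i, J i}) \prod_i F i (f i) = \prod_i \sum_j F i j.
Proof.
rewrite (reindex _ (onW_bij _ (dffun_of_fprod_bij J))) /=.
have -> : \sum_(t : fprod J) \prod_i F i (dffun_of_fprod t i) =
    \sum_(t : fprod J) \prod_i finfun (F i) (t i).
  by apply: eq_bigr => t _; apply: eq_bigr => i _; rewrite !ffunE.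
rewrite (@big_fprod R 0 1 _ _ I J (fun i => finfun (F i))).
rewrite -(@bigA_distr_big_dep R 0 1 _ _ I {i : I & J i} (fun i => tagged_with J i)
  (fun i x => untag 0 (finfun (F i)) x)).
apply: eq_bigr => i _.
have -> := big_tag (op := +%R) (fun i (x : J i) => F i x) i.
by apply: eq_bigr => j _; congr (untag 0 _ j); apply/funext => x; rewrite ffunE.
Qed.

Context (K : nat).

Lemma tuckerM (d e r : 'I_K -> nat) (B : forall k, 'M[R]_(d k, e k))
    (C : forall k, 'M[R]_(e k, r k)) (X : tidx r -> R) :
  tucker B (tucker C X) = tucker (fun k => B k *m C k) X.
Proof.
apply/funext => i; rewrite /tucker.
under eq_bigr do rewrite mulr_suml.
rewrite exchange_big /=; apply: eq_bigr => m _.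
under eq_bigr do rewrite -mulrA -big_split /=.
rewrite -mulr_sumr; congr (_ * _).
rewrite (sum_dffun_prod (fun k j => C k j (m k) * B k (i k) j)).
by apply: eq_bigr => k _; rewrite mxE; apply: eq_bigr => j _; rewrite mulrC.
Qed.

Lemma sum_on_fibre (d : 'I_K -> nat) (k : 'I_K) (f : tidx d -> R) :
  \sum_(i < d k) \sum_(h < nfib d k) f (on_fibre i (fibre h)) = \sum_x f x.
Proof.
rewrite [RHS](reindex _ (onW_bij _ (on_fibre_bij d k))) /=.
rewrite -(pair_bigA _ (fun i h => f (on_fibre i h))) /=.
apply: eq_bigr => i _.
by rewrite (reindex _ (onW_bij _ (enum_val_bij (fidx d k)))).
Qed.

End Tensors.

(** * Matrices *)

Section Matrices.
Context (R : realType).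

(** The squared Frobenius norm: without the root, its mean is the sum of the means of the squared
    entries. *)
Definition fsq (p q : nat) (X : 'M[R]_(p, q)) : R := \sum_i \sum_j X i j ^+ 2.

Lemma fsq_ge0 (p q : nat) (X : 'M[R]_(p, q)) : 0 <= fsq X.
Proof. by apply: sumr_ge0 => i _; apply: sumr_ge0 => j _; rewrite sqr_ge0. Qed.

Lemma fsq_tr (p q : nat) (X : 'M[R]_(p, q)) : fsq X = \tr (X^T *m X).
Proof.
rewrite /fsq /mxtrace exchange_big /=; apply: eq_bigr => j _.
by rewrite mxE; apply: eq_bigr => i _; rewrite mxE expr2.
Qed.

Lemma fsq_trmx (p q : nat) (X : 'M[R]_(p, q)) : fsq X^T = fsq X.
Proof.
by rewrite /fsq exchange_big; apply: eq_bigr => i _; apply: eq_bigr => j _; rewrite mxE.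
Qed.

Lemma fsq_cV (p : nat) (x : 'cV[R]_p) : fsq x = \sum_i x i 0 ^+ 2.
Proof. by apply: eq_bigr => i _; rewrite big_ord1. Qed.

Lemma fsq_dot (p : nat) (x : 'cV[R]_p) : (x^T *m x) 0 0 = fsq x.
Proof. by rewrite fsq_tr /mxtrace big_ord1. Qed.

Lemma fsq_gt0 (p q : nat) (X : 'M[R]_(p, q)) : X != 0 -> 0 < fsq X.
Proof.
move=> X0; rewrite lt_neqAle fsq_ge0 andbT; apply: contra_neq X0 => /esym X0.
apply/matrixP => i j; rewrite mxE; apply/eqP.
rewrite -sqrf_eq0; apply/eqP.
have := psumr_eq0P (fun i _ => sumr_ge0 _ (fun j _ => sqr_ge0 (X i j))) X0 => /(_ i isT).
by move=> /(psumr_eq0P (fun j _ => sqr_ge0 (X i j))) /(_ j isT).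
Qed.

Lemma dot_sqr_le (p : nat) (x y : 'cV[R]_p) :
  (x^T *m y) 0 0 ^+ 2 <= fsq x * fsq y.
Proof.
rewrite !fsq_cV mxE; apply: sum_sqr_le => i; rewrite ?sqr_ge0 //.
by rewrite !mxE exprMn.
Qed.

Lemma fsqD (p q : nat) (X Y : 'M[R]_(p, q)) : fsq (X + Y) <= 2 * (fsq X + fsq Y).
Proof.
rewrite /fsq -big_split mulr_sumr; apply: ler_sum => i _ /=.
rewrite -big_split mulr_sumr; apply: ler_sum => j _ /=; rewrite mxE.
have := sqr_ge0 (X i j - Y i j); nra.
Qed.

(** Used with [X] the matrix [Shat], [Y] and [Z] the masked and the full average of the common
    component, and [M] the mean that both averages share. *)
Lemma fsq_detour (p q : nat) (X Y Z M : 'M[R]_(p, q)) :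
  fsq (X - Z) <= 4 * (fsq (X - Y) + fsq (Y - M) + fsq (Z - M)).
Proof.
have fsqC : fsq (M - Z) = fsq (Z - M).
  by apply: eq_bigr => i _; apply: eq_bigr => j _; rewrite !mxE -sqrrN opprB.
have -> : X - Z = (X - Y) + ((Y - M) + (M - Z)) by rewrite !addrA !subrK.
rewrite -fsqC; have := fsqD (X - Y) ((Y - M) + (M - Z)).
by have := fsqD (Y - M) (M - Z); have := fsq_ge0 (X - Y); lra.
Qed.

(** The Frobenius norm dominates the operator norm. *)
Lemma quad_form_le (p : nat) (S : 'M[R]_p) (x : 'cV[R]_p) (rho : R) :
  0 <= rho -> fsq S <= rho ^+ 2 -> - rho * fsq x <= (x^T *m S *m x) 0 0.
Proof.
move=> rho0 Srho.
have hS : fsq (S *m x) <= rho ^+ 2 * fsq x.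
  apply: (@le_trans _ _ (fsq S * fsq x)); last by rewrite ler_wpM2r ?fsq_ge0.
  rewrite fsq_cV [fsq S]/fsq mulr_suml; apply: ler_sum => i _.
  rewrite mxE fsq_cV; apply: sum_sqr_le => j; rewrite ?sqr_ge0 //.
  by rewrite exprMn.
have h : (x^T *m (S *m x)) 0 0 ^+ 2 <= (rho * fsq x) ^+ 2.
  apply: le_trans (dot_sqr_le _ _) _.
  by rewrite exprMn [leLHS]mulrC expr2 mulrA ler_wpM2r ?fsq_ge0 // -expr2.
have b0 : 0 <= rho * fsq x by rewrite mulr_ge0 ?fsq_ge0.
rewrite -mulmxA mulNr leNgt; apply/negP.
move: h b0; move: ((x^T *m (S *m x)) 0 0) (rho * fsq x) => u v *; nra.
Qed.

(** The difference of the two sides is the squared norm of the residual X - Q Q' X. *)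
Lemma bessel (p q s : nat) (Q : 'M[R]_(p, q)) (X : 'M[R]_(p, s)) :
  Q^T *m Q = 1%:M -> fsq (Q^T *m X) <= fsq X.
Proof.
move=> QQ; rewrite -subr_ge0.
have -> : fsq X - fsq (Q^T *m X) = fsq (X - Q *m (Q^T *m X)).
  rewrite !fsq_tr -linearB /=; congr (\tr _).
  rewrite [(X - _)^T]linearB /= mulmxBl !mulmxBr !trmx_mul !trmxK !mulmxA.
  by rewrite -(mulmxA (X^T *m Q) Q^T Q) QQ mulmx1 subrr subr0.
exact: fsq_ge0.
Qed.

Lemma diag_mx_inv (q : nat) (lam : 'rV[R]_q) : (forall a, lam 0 a != 0) ->
  diag_mx lam \in unitmx /\
  invmx (diag_mx lam) = diag_mx (map_mx GRing.inv lam).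
Proof.
move=> lam0.
have dd : diag_mx (map_mx GRing.inv lam) *m diag_mx lam = 1%:M.
  apply/matrixP => i j; rewrite mul_diag_mx !mxE.
  by case: (i =P j) => [->|_]; rewrite ?mulr0 // mulr1n mulVf.
have [_ dU] := mulmx1_unit dd.
by split=> //; rewrite -[LHS]mul1mx -dd mulmxK.
Qed.

(** Row [a] is divided by an eigenvalue of size at least [delta], and multiplication by Q' does not
    increase the Frobenius norm. *)
Lemma fsq_invmx_diag (p q s : nat) (Q : 'M[R]_(p, q)) (lam : 'rV[R]_q)
    (X : 'M[R]_(p, s)) (delta : R) :
  Q^T *m Q = 1%:M -> 0 < delta -> (forall a, delta <= lam 0 a) ->
  fsq (invmx (diag_mx lam) *m Q^T *m X) <= (delta ^+ 2)^-1 * fsq X.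
Proof.
move=> QQ delta0 dlam.
have lam0 a : 0 < lam 0 a := lt_le_trans delta0 (dlam a).
have [|_ ->] := @diag_mx_inv q lam; first by move=> a; rewrite gt_eqF.
apply: (@le_trans _ _ ((delta ^+ 2)^-1 * fsq (Q^T *m X))); last first.
  by rewrite ler_wpM2l ?invr_ge0 ?sqr_ge0 ?bessel.
rewrite -mulmxA /fsq mulr_sumr; apply: ler_sum => a _.
rewrite mulr_sumr; apply: ler_sum => j _.
rewrite mul_diag_mx !mxE exprMn ler_wpM2r ?sqr_ge0 // exprVn lef_pV2 ?posrE ?exprn_gt0 //.
by rewrite ler_sqr ?nnegrE ?(ltW delta0) ?(ltW (lam0 _)) ?dlam.
Qed.

(** As quadratic forms, [S] is at least kap A A' - rho I, and A A' is at least [g] on the image of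
    [A], which has dimension [q]. *)
Lemma top_eigenvectors_lower (p q : nat) (S : 'M[R]_p) (Q A : 'M[R]_(p, q))
    (kap rho g : R) :
  S^T = S -> top_eigenvectors S Q -> 0 <= kap -> 0 < g ->
  (forall x : 'cV_p, kap * fsq (A^T *m x) - rho * fsq x <= (x^T *m S *m x) 0 0) ->
  (forall y : 'cV_q, g * fsq y <= fsq (A *m y)) ->
  exists lam : 'rV[R]_q, [/\ Q^T *m S = diag_mx lam *m Q^T, Q^T *m Q = 1%:M &
    forall a, kap * g - rho <= lam 0 a].
Proof.
move=> Ssym [qp [U [lam0 [UU SU lam_mono QU]]]] kap0 g0 Slow Alow.
pose w := widen_ord qp.
have Qw a i : Q i a = U i (w a).
  by have := QU (w a) a erefl => /colP /(_ i); rewrite !mxE.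
exists (\row_a lam0 0 (w a)); split.
- have US : U^T *m S = diag_mx lam0 *m U^T.
    by rewrite -{1}Ssym -trmx_mul SU trmx_mul tr_diag_mx.
  apply/matrixP => a i; have := US => /matrixP /(_ (w a) i).
  rewrite !mul_diag_mx !mxE Qw => <-.
  by apply: eq_bigr => j _; rewrite !mxE Qw.
- apply/matrixP => a b; have := UU => /matrixP /(_ (w a) (w b)).
  rewrite !mxE => h; transitivity ((w a == w b)%:R : R); last first.
    by congr (_%:R); apply/idP/idP => /eqP // [] ab; apply/eqP/val_inj.
  by rewrite -h; apply: eq_bigr => j _; rewrite !mxE !Qw.
move=> a; rewrite mxE.
(* Courant-Fischer: the image of [A] contains a nonzero vector [x] orthogonal to the
   first [a] eigenvectors. *)
have ap : (a < p)%N := leq_trans (ltn_ord a) qp.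
pose Ua : 'M[R]_(p, a) := \matrix_(i, b) U i (widen_ord (ltnW ap) b).
pose N := A^T *m Ua.
have kN0 : kermx N != 0.
  rewrite -mxrank_eq0 mxrank_ker subn_eq0 -ltnNge.
  exact: leq_ltn_trans (rank_leq_col N) (ltn_ord a).
have [y yN y0] := rowV0Pn kN0.
have {}yN : y *m N = 0 by apply/eqP; rewrite -sub_kermx.
pose x := A *m y^T.
have yT0 : y^T != 0 by rewrite trmx_eq0.
have x0 : 0 < fsq x.
  by apply: lt_le_trans (Alow _); rewrite mulr_gt0 ?fsq_gt0.
(* Since x = A y, |x|^4 = (y' A' x)^2 <= |y|^2 |A' x|^2, and g |y|^2 <= |x|^2. *)
have Ax : g * fsq x <= fsq (A^T *m x).
  have h : fsq x ^+ 2 <= fsq y^T * fsq (A^T *m x).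
    rewrite -[X in X ^+ 2]fsq_dot; apply: le_trans (dot_sqr_le _ _).
    by rewrite /x trmx_mul -!mulmxA.
  have h2 := Alow y^T; rewrite -/x in h2.
  have hA := fsq_ge0 (A^T *m x); have hy := fsq_gt0 yT0.
  rewrite -(ler_pM2l x0).
  move: h h2 hA hy x0 g0; move: (fsq x) (fsq y^T) (fsq (A^T *m x)) => u v t.
  by move=> *; nra.
pose z := U^T *m x.
have za (j : 'I_p) : (j < a)%N -> z j 0 = 0.
  move=> ja; have := yN => /matrixP /(_ 0 (Ordinal ja)).
  rewrite /N mulmxA -[y *m A^T]trmxK trmx_mul trmxK -/x !mxE => h.
  rewrite -[RHS]h; apply: eq_bigr => i _; rewrite !mxE mulrC; congr (_ * U i _).
  exact: val_inj.
have zz : fsq z = fsq x.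
  by rewrite -!fsq_dot /z trmx_mul trmxK -mulmxA (mulmxA U) (mulmx1C UU) mul1mx.
have Sz : (x^T *m S *m x) 0 0 = \sum_j lam0 0 j * z j 0 ^+ 2.
  have -> : x^T *m S *m x = z^T *m (diag_mx lam0 *m z).
    rewrite /z (trmx_mul U^T) trmxK mulmxA -(mulmxA x^T U) -SU -!mulmxA.
    by rewrite (mulmxA U U^T) (mulmx1C UU) mul1mx.
  rewrite mul_diag_mx mxE; apply: eq_bigr => j _; rewrite !mxE expr2.
  by rewrite mulrCA.
have Sup : (x^T *m S *m x) 0 0 <= lam0 0 (w a) * fsq x.
  rewrite Sz -zz fsq_cV mulr_sumr; apply: ler_sum => j _.
  have [ja|aj] := ltnP j a; first by rewrite za // expr0n !mulr0.
  by rewrite ler_wpM2r ?sqr_ge0 //; apply: lam_mono.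
rewrite -(ler_pM2r x0); apply: le_trans Sup; apply: le_trans (Slow x).
by rewrite mulrBl lerB // -mulrA ler_wpM2l.
Qed.

End Matrices.

(** * The estimation error *)

Section WeightedProducts.
Context (R : realType) (p q T : nat).
Implicit Types (v : 'I_p -> 'I_p -> 'I_q -> 'I_T -> R) (X Z : 'I_T -> 'M[R]_(p, q)).

(* [Shat] and both rotation matrices are built from such products, with the weights
   [obs_weight] below or, for [Hall], with the constant weights 1/T. *)
Definition wprod v X Z : 'M[R]_p :=
  \matrix_(i, j) \sum_h \sum_t v i j h t * (X t i h * Z t j h).

Lemma wprodDl v X X' Z :
  wprod v (fun t => X t + X' t) Z = wprod v X Z + wprod v X' Z.
Proof.
apply/matrixP => i j; rewrite !mxE -big_split; apply: eq_bigr => h _ /=.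
by rewrite -big_split; apply: eq_bigr => t _ /=; rewrite mxE; ring.
Qed.

Lemma wprodDr v X Z Z' :
  wprod v X (fun t => Z t + Z' t) = wprod v X Z + wprod v X Z'.
Proof.
apply/matrixP => i j; rewrite !mxE -big_split; apply: eq_bigr => h _ /=.
by rewrite -big_split; apply: eq_bigr => t _ /=; rewrite mxE; ring.
Qed.

End WeightedProducts.

Lemma col_mulmx (R : pzSemiRingType) (p q s : nat) (X : 'M[R]_(p, q))
    (Z : 'M[R]_(q, s)) j : col j (X *m Z) = X *m col j Z.
Proof. by rewrite !colE mulmxA. Qed.

Section EstimationError.
Context {R : realType} {K : nat}.
Variables (T : nat) (d r : 'I_K -> nat).
Variables (W : 'I_T -> tidx d -> bool) (Y : 'I_T -> tidx d -> R).
Variables (A : forall k, 'M[R]_(d k, r k)) (F : 'I_T -> tidx r -> R).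
Variable k : 'I_K.

(** The average over the jointly observed times, written as a weighted sum over all times so that it
    compares with the weights 1/T. If no time is jointly observed, all weights are 0. *)
Definition obs_weight (i j : 'I_(d k)) (h : 'I_(nfib d k)) (t : 'I_T) : R :=
  (t \in psi W i j h)%:R / #|psi W i j h|%:R.

Definition common (t : 'I_T) : 'M[R]_(d k, nfib d k) := unfold k (tucker A (F t)).

Lemma psiC (i j : 'I_(d k)) h : psi W i j h = psi W j i h.
Proof. by apply/setP => t; rewrite !inE andbC. Qed.

Lemma obs_weightC i j h t : obs_weight i j h t = obs_weight j i h t.
Proof. by rewrite /obs_weight psiC. Qed.

Lemma sum_psi (i j : 'I_(d k)) h (x : 'I_T -> R) :
  #|psi W i j h|%:R^-1 * (\sum_(t in psi W i j h) x t)
  = \sum_t obs_weight i j h t * x t.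
Proof.
rewrite mulr_sumr big_mkcond; apply: eq_bigr => t _; rewrite /obs_weight.
by case: ifP => _; rewrite ?mul1r // !mul0r.
Qed.

Lemma Shat_wprod :
  Shat W Y k = wprod obs_weight (fun t => unfold k (Y t)) (fun t => unfold k (Y t)).
Proof. by apply/matrixP => i j; rewrite !mxE; apply: eq_bigr => h _; rewrite sum_psi. Qed.

Lemma Shat_sym : (Shat W Y k)^T = Shat W Y k.
Proof.
rewrite Shat_wprod; apply/matrixP => i j; rewrite !mxE.
apply: eq_bigr => h _; apply: eq_bigr => t _.
by rewrite obs_weightC [X in _ * X]mulrC.
Qed.

Hypothesis Z_gt0 : forall l j, 0 < Zdiag (A l) 0 j.

Lemma normalizedK l : normalized (A l) *m Zhalf (A l) = A l.
Proof.
rewrite /normalized -mulmxA mulmx_diag; apply/matrixP => i j.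
rewrite mul_mx_diag !mxE mulVf ?mulr1 // sqrtr_eq0 -ltNge.
by have := @Z_gt0 l j; rewrite !mxE.
Qed.

(** The normalizations cancel mode by mode: Q_l Z_l^(1/2) = A_l. *)
Lemma common_FZ t :
  normalized (A k) *m unfold k (FZ A F t) *m (Lam A k)^T = common t.
Proof.
rewrite -unfold_tucker /FZ tuckerM /common; congr (unfold k (tucker _ _)).
by apply/functional_extensionality_dep => l; exact: normalizedK.
Qed.

Lemma common_uvec t i h :
  ((uvec A F t h)^T *m rowv (normalized (A k)) i) 0 0 = common t i h.
Proof.
rewrite -common_FZ -mulmxA mxE [RHS]mxE; apply: eq_bigr => s _.
by rewrite mulrC /uvec /rowv !mxE; congr (_ * _); apply: eq_bigr => a _; rewrite !mxE.
Qed.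

Variable Qhat : 'M[R]_(d k, r k).

Notation Q := (normalized (A k)).
Notation Dh := (Dhat W Y Qhat).

Lemma sum_l2norm_cols (X : 'M[R]_(r k, d k)) :
  \sum_j l2norm (col j X) ^+ 2 = fsq X.
Proof.
rewrite /fsq exchange_big; apply: eq_bigr => j _.
rewrite /l2norm sqr_sqrtr; last by apply: sumr_ge0 => i _; rewrite sqr_ge0.
by apply: eq_bigr => i _; rewrite mxE.
Qed.

Lemma rowv_col (X : 'M[R]_(d k, r k)) j : rowv X j = col j X^T.
Proof. by apply/colP => i; rewrite !mxE. Qed.

(** The scalars u_(t,h)' Q_i and u_(t,h)' Q_j are the entries (i, h) and (j, h) of the common
    component. The weights depend on both [i] and [j], which is why each row has its own
    rotation. *)
Lemma Hrow_col j : Hrow W Y A F Qhat j *m rowv Q j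
  = col j (invmx Dh *m Qhat^T *m wprod obs_weight common common).
Proof.
rewrite /Hrow -!mulmxA !col_mulmx; congr (_ *m _).
rewrite mulmx_suml; apply/colP => a; rewrite summxE [RHS]mxE.
apply: eq_bigr => i _.
rewrite -mulmxA mxE big_ord1; congr (_ * _); first by rewrite !mxE.
rewrite mulmx_suml summxE [RHS]mxE [RHS]mxE; apply: eq_bigr => h _.
rewrite -scalemxAl mxE mulmx_suml summxE sum_psi; apply: eq_bigr => t _.
by rewrite -scalemxAl mxE !common_uvec.
Qed.

Lemma Hall_mul : Hall W Y A F Qhat *m Q^T
  = invmx Dh *m Qhat^T *m wprod (fun _ _ _ _ => T%:R^-1) common common.
Proof.
have -> : wprod (fun _ _ _ _ => T%:R^-1) common common =
    T%:R^-1 *: \sum_t common t *m (common t)^T.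
  apply/matrixP => i j; rewrite mxE [RHS]mxE summxE mulr_sumr exchange_big /=.
  apply: eq_bigr => t _; rewrite [in RHS]mxE mulr_sumr.
  by apply: eq_bigr => h _; congr (_ * (_ * _)); rewrite [RHS]mxE.
rewrite /Hall -scalemxAl -scalemxAr; congr (_ *: _).
rewrite mulmx_suml mulmx_sumr; apply: eq_bigr => t _.
by rewrite -common_FZ !trmx_mul trmxK !mulmxA.
Qed.

Variables (lam : 'rV[R]_(r k)) (delta : R).
Hypotheses (QS : Qhat^T *m Shat W Y k = diag_mx lam *m Qhat^T)
  (QQ : Qhat^T *m Qhat = 1%:M) (delta_gt0 : 0 < delta)
  (lam_ge : forall a, delta <= lam 0 a).

Lemma Dhat_diag : Dh = diag_mx lam.
Proof. by rewrite /Dhat QS -mulmxA QQ mulmx1. Qed.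

Lemma Qhat_fix : Qhat^T = invmx Dh *m Qhat^T *m Shat W Y k.
Proof.
rewrite -mulmxA QS Dhat_diag mulmxA mulVmx ?mul1mx //.
by apply: (proj1 (diag_mx_inv _)) => a; rewrite gt_eqF // (lt_le_trans delta_gt0).
Qed.

Lemma Hrow_error_le :
  \sum_j l2norm (rowv Qhat j - Hrow W Y A F Qhat j *m rowv Q j) ^+ 2
  <= (delta ^+ 2)^-1 * fsq (Shat W Y k - wprod obs_weight common common).
Proof.
have -> : \sum_j l2norm (rowv Qhat j - Hrow W Y A F Qhat j *m rowv Q j) ^+ 2 =
    \sum_j l2norm (col j (invmx Dh *m Qhat^T *m
      (Shat W Y k - wprod obs_weight common common))) ^+ 2.
  apply: eq_bigr => j _; congr (l2norm _ ^+ 2).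
  by rewrite rowv_col {1}Qhat_fix Hrow_col mulmxBr linearB.
by rewrite sum_l2norm_cols Dhat_diag; exact: fsq_invmx_diag.
Qed.

Lemma Hall_error_le :
  \sum_j l2norm (rowv Qhat j - Hall W Y A F Qhat *m rowv Q j) ^+ 2
  <= (delta ^+ 2)^-1 *
     fsq (Shat W Y k - wprod (fun _ _ _ _ => T%:R^-1) common common).
Proof.
have -> : \sum_j l2norm (rowv Qhat j - Hall W Y A F Qhat *m rowv Q j) ^+ 2 =
    \sum_j l2norm (col j (invmx Dh *m Qhat^T *m
      (Shat W Y k - wprod (fun _ _ _ _ => T%:R^-1) common common))) ^+ 2.
  apply: eq_bigr => j _; congr (l2norm _ ^+ 2).
  by rewrite !rowv_col {1}Qhat_fix -col_mulmx Hall_mul mulmxBr linearB.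
by rewrite sum_l2norm_cols Dhat_diag; exact: fsq_invmx_diag.
Qed.

End EstimationError.

Lemma Hall_error_frobenius (R : realType) (K : nat) (r d : 'I_K -> nat) (k : 'I_K)
    (Qhat Q : 'M[R]_(d k, r k)) (H : 'M[R]_(r k)) :
  \sum_j l2norm (rowv Qhat j - H *m rowv Q j) ^+ 2
  = frobenius_norm (Qhat - Q *m H^T) ^+ 2.
Proof.
rewrite /frobenius_norm sqr_sqrtr -/(fsq _) ?fsq_ge0 //.
rewrite -fsq_trmx -sum_l2norm_cols; apply: eq_bigr => j _; congr (l2norm _ ^+ 2).
by rewrite !rowv_col [in RHS]linearB /= trmx_mul trmxK linearB /= col_mulmx.
Qed.

(** * Loadings of the common component *)

Section CommonComponent.
Context {R : realType} {K : nat}.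
Variables (d r : 'I_K -> nat) (A : forall k, 'M[R]_(d k, r k)).

(** The coefficient of the core entry [m] in the entry [x] of the common component, that is, an
    entry of the Kronecker product of all loading matrices. *)
Definition load (x : tidx d) (m : tidx r) : R := \prod_(k < K) A k (x k) (m k).

Lemma load_on_fibre k i h s mu :
  load (on_fibre i (fibre h)) (on_fibre s (fibre mu))
  = A k i s * kron_but A k h mu.
Proof.
rewrite /load (bigD1 k) //= !on_fibre_mode mxE; congr (_ * _).
rewrite (reindex_omap (fun l : {l : 'I_K | l != k} => val l) insub) /=; last first.
  by move=> l lk; rewrite insubT.
apply: eq_big => [l|l _]; last by rewrite !on_fibre_other.
by rewrite (valP l) valK eqxx.
Qed.

(** The left side is the mean of the products of common components summed over fibres, for
    uncorrelated core entries of unit variance. The Kronecker structure splits off a scalar that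
    gathers the other modes. *)
Lemma sum_load_mul k i j :
  \sum_(h < nfib d k) \sum_m load (on_fibre i (fibre h)) m * load (on_fibre j (fibre h)) m
  = fsq (kron_but A k) * (A k *m (A k)^T) i j.
Proof.
under eq_bigr do rewrite -(sum_on_fibre k).
under eq_bigr do under eq_bigr do under eq_bigr do rewrite !load_on_fibre mulrACA.
rewrite [LHS]exchange_big mxE mulr_sumr /=; apply: eq_bigr => s _.
rewrite [X in _ = _ * (_ * X)]mxE [RHS]mulrC /fsq mulr_sumr; apply: eq_bigr => h _.
by rewrite mulr_sumr; apply: eq_bigr => mu _; rewrite expr2.
Qed.

Lemma sum_load_sqr m : \sum_x load x m ^+ 2 = \prod_(k < K) Zdiag (A k) 0 (m k).
Proof.
rewrite (eq_bigr (fun x : tidx d => \prod_(k < K) A k (x k) (m k) ^+ 2)); last first.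
  by move=> x _; rewrite prodrXl.
rewrite (sum_dffun_prod (fun k i => A k i (m k) ^+ 2)).
apply: eq_bigr => k _; rewrite !mxE; apply: eq_bigr => i _.
by rewrite mxE expr2.
Qed.

Lemma sum_load_norm m : \sum_x `|load x m| = \prod_(k < K) \sum_i `|A k i (m k)|.
Proof.
under eq_bigr do rewrite /load normr_prod.
by rewrite (sum_dffun_prod (fun k i => `|A k i (m k)|)).
Qed.

(** The column of the Kronecker product at the multi-index [s] alone has this squared length. The
    strongest column in each mode then gives the order of g_s without mode [k]. *)
Lemma fsq_kron_ge k (s : forall l, 'I_(r l)) :
  \prod_(l < K | l != k) Zdiag (A l) 0 (s l) <= fsq (kron_but A k).
Proof.
pose f : fidx r k := [ffun l => s (val l)].
have -> : \prod_(l < K | l != k) Zdiag (A l) 0 (s l) =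
    \sum_h kron_but A k h (enum_rank f) ^+ 2.
  rewrite [RHS](eq_bigr (fun h => \prod_l
      A (val l) (fibre h l) (fibre (enum_rank f) l) ^+ 2)); last first.
    by move=> h _; rewrite mxE prodrXl.
  transitivity (\sum_(h : fidx d k) \prod_l A (val l) (h l) (s (val l)) ^+ 2).
    rewrite (sum_dffun_prod (fun l i => A (val l) i (s (val l)) ^+ 2)).
    rewrite (reindex_omap (fun l : {l : 'I_K | l != k} => val l) insub) /=; last first.
      by move=> l lk; rewrite insubT.
    apply: eq_big => [l|l _]; first by rewrite (valP l) valK eqxx.
    by rewrite !mxE; apply: eq_bigr => i _; rewrite mxE expr2.
  rewrite (reindex _ (onW_bij _ (enum_val_bij (fidx d k)))) /=.
  apply: eq_bigr => h _; apply: eq_bigr => l _.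
  by rewrite /fibre enum_rankK ffunE.
rewrite /fsq; apply: ler_sum => h _.
by rewrite (bigD1 (enum_rank f)) //= lerDl; apply: sumr_ge0 => mu _; rewrite sqr_ge0.
Qed.

End CommonComponent.

(** * Moment bounds for given weights and loadings *)

Section ExpectedFrobenius.
Context d (Om : measurableType d) (R : realType) (P : probability Om R).

Definition efsq_le (p q : nat) (M : Om -> 'M[R]_(p, q)) (B : R) : Prop :=
  (forall i j, measurable_fun setT (fun w => M w i j)) /\
  (\int[P]_w (fsq (M w))%:E <= B%:E)%E.

Lemma measurable_fsq (p q : nat) (M : Om -> 'M[R]_(p, q)) :
  (forall i j, measurable_fun setT (fun w => M w i j)) ->
  measurable_fun setT (fun w => fsq (M w)).
Proof.
move=> mM; apply: measurable_sum => i; apply: measurable_sum => j.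
exact: measurable_funX.
Qed.

Lemma efsq_le_entries (p q : nat) (M : Om -> 'M[R]_(p, q)) (B : 'I_p -> 'I_q -> R) :
  (forall i j, msq_le P (fun w => M w i j) (B i j)) ->
  efsq_le M (\sum_i \sum_j B i j).
Proof.
move=> MB; split; first by move=> i j; case: (MB i j).
have := integral_wsum_sqr_le (index_enum ('I_p * 'I_q)%type) (fun=> ler01)
  (fun ij => MB ij.1 ij.2).
rewrite (eq_bigr (fun ij => B ij.1 ij.2)) => [|ij _]; last by rewrite mul1r.
rewrite -(pair_bigA _ (fun i j => B i j)) /=; apply: le_trans.
rewrite le_eqVlt; apply/orP; left; apply/eqP/eq_integral => w _.
rewrite /fsq pair_bigA /=; congr EFin; apply: eq_bigr => ij _.
by rewrite mul1r.
Qed.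

Lemma efsq_le_ge0 (p q : nat) (M : Om -> 'M[R]_(p, q)) B : efsq_le M B -> 0 <= B.
Proof.
case=> _; rewrite -lee_fin; apply: le_trans.
by apply: integral_ge0 => w _; rewrite lee_fin fsq_ge0.
Qed.

Lemma efsq_leW (p q : nat) (M : Om -> 'M[R]_(p, q)) B B' :
  efsq_le M B -> B <= B' -> efsq_le M B'.
Proof. by case=> mM MB BB'; split=> //; rewrite (le_trans MB) ?lee_fin. Qed.

Lemma efsq_leD (p q : nat) (M N : Om -> 'M[R]_(p, q)) B B' :
  efsq_le M B -> efsq_le N B' -> efsq_le (fun w => M w + N w) (2 * (B + B')).
Proof.
move=> [mM MB] [mN NB].
have mMN i j : measurable_fun setT (fun w => (M w + N w) i j).
  by under eq_fun do rewrite mxE; exact: measurable_funD.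
split=> //.
have [mfM mfN] := (measurable_fsq mM, measurable_fsq mN).
apply: (@le_trans _ _ (\int[P]_w (2%:E * ((fsq (M w))%:E + (fsq (N w))%:E)))%E).
  apply: ge0_le_integral => //.
  - by move=> w _; rewrite lee_fin fsq_ge0.
  - by apply/measurable_EFinP; exact: measurable_fsq.
  - apply: measurable_funeM; apply: emeasurable_funD; exact/measurable_EFinP.
  - by move=> w _; rewrite -EFinD -EFinM lee_fin fsqD.
rewrite ge0_integralZl_EFin //; first last.
- by apply: emeasurable_funD; exact/measurable_EFinP.
- by move=> w _; rewrite adde_ge0 // lee_fin fsq_ge0.
rewrite ge0_integralD //; first last.
- exact/measurable_EFinP.
- by move=> w _; rewrite lee_fin fsq_ge0.
- exact/measurable_EFinP.
- by move=> w _; rewrite lee_fin fsq_ge0.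
by rewrite EFinM lee_wpmul2l ?lee_fin // EFinD leeD.
Qed.

End ExpectedFrobenius.

Lemma sum_sum_sqr_le (R : realFieldType) (I J H : finType) (u : I -> H -> R)
    (v : J -> H -> R) :
  \sum_i \sum_j (\sum_h u i h * v j h) ^+ 2
  <= (\sum_i \sum_h u i h ^+ 2) * (\sum_j \sum_h v j h ^+ 2).
Proof.
rewrite mulr_suml; apply: ler_sum => i _; rewrite mulr_sumr; apply: ler_sum => j _.
by apply: sum_sqr_le => h; rewrite ?sqr_ge0 // exprMn.
Qed.

Section EntryBounds.
Context d (Om : measurableType d) (R : realType) (P : probability Om R).
Variables (q T : nat) (v : 'I_q -> 'I_T -> R).
Hypotheses (v_ge0 : forall h t, 0 <= v h t) (v_sum : forall h, \sum_t v h t = 1).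

(** Triangle inequality over all indices; the weights sum to one over time, so the sample size
    leaves no trace in the bound. *)
Lemma msq_le_bilinear (J J' : finType) (x : 'I_T -> 'I_q -> J -> Om -> R)
    (y : 'I_T -> 'I_q -> J' -> Om -> R) (a : 'I_q -> J -> R) (b : 'I_q -> J' -> R) B :
  (forall t h m m', msq_le P (fun w => x t h m w * y t h m' w) B) ->
  msq_le P (fun w => \sum_h \sum_t v h t *
      ((\sum_m x t h m w * a h m) * (\sum_m' y t h m' w * b h m')))
    ((\sum_h (\sum_m `|a h m|) * (\sum_m' `|b h m'|)) ^+ 2 * B).
Proof.
move=> xyB.
have := @msq_le_comb _ _ _ P _ (index_enum ('I_q * 'I_T * (J * J'))%type)
  (fun z => v z.1.1 z.1.2 * (a z.1.1 z.2.1 * b z.1.1 z.2.2))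
  (fun z w => x z.1.2 z.1.1 z.2.1 w * y z.1.2 z.1.1 z.2.2 w) B
  (fun z => xyB _ _ _ _).
congr (msq_le P _ (_ ^+ 2 * B)).
  apply/funext => w.
  rewrite -(pair_bigA _ (fun z1 z2 => v z1.1 z1.2 * (a z1.1 z2.1 * b z1.1 z2.2)
     * (x z1.2 z1.1 z2.1 w * y z1.2 z1.1 z2.2 w))) /=.
  rewrite -(pair_bigA _ (fun h t => \sum_(z2 : J * J') v h t * (a h z2.1 * b h z2.2)
     * (x t h z2.1 w * y t h z2.2 w))) /=.
  apply: eq_bigr => h _; apply: eq_bigr => t _.
  rewrite mulr_suml mulr_sumr -(pair_bigA _ (fun m m' => v h t * (a h m * b h m')
     * (x t h m w * y t h m' w))) /=.
  apply: eq_bigr => m _; rewrite mulr_sumr mulr_sumr; apply: eq_bigr => m' _.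
  by ring.
rewrite -(pair_bigA _ (fun z1 z2 => `|v z1.1 z1.2 * (a z1.1 z2.1 * b z1.1 z2.2)|)) /=.
rewrite -(pair_bigA _ (fun h t => \sum_(z2 : J * J')
    `|v h t * (a h z2.1 * b h z2.2)|)) /=.
apply: eq_bigr => h _.
transitivity (\sum_t v h t * ((\sum_m `|a h m|) * (\sum_m' `|b h m'|))).
  apply: eq_bigr => t _.
  rewrite -(pair_bigA _ (fun m m' => `|v h t * (a h m * b h m')|)) /=.
  rewrite mulr_suml mulr_sumr; apply: eq_bigr => m _.
  rewrite mulr_sumr mulr_sumr; apply: eq_bigr => m' _.
  by rewrite !normrM (ger0_norm (v_ge0 _ _)).
by rewrite -mulr_suml v_sum mul1r.
Qed.

(** Weights that sum to one give a centring without weights; this is why masked and full averages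
    share their mean. The time sum stays inside the hypothesis, where orthogonality can act on
    it. *)
Lemma msq_le_fluctuation (J : finType) (x : 'I_T -> J -> Om -> R)
    (a b : 'I_q -> J -> R) (B : R) :
  (forall h m m', msq_le P
     (fun w => \sum_t v h t * (x t m w * x t m' w - (m == m')%:R)) B) ->
  msq_le P (fun w => \sum_h \sum_t v h t *
      ((\sum_m x t m w * a h m) * (\sum_m' x t m' w * b h m'))
      - \sum_h \sum_m a h m * b h m)
    ((\sum_h (\sum_m `|a h m|) * (\sum_m' `|b h m'|)) ^+ 2 * B).
Proof.
move=> xB.
have := @msq_le_comb _ _ _ P _ (index_enum ('I_q * (J * J))%type)
  (fun z => a z.1 z.2.1 * b z.1 z.2.2)
  (fun z w => \sum_t v z.1 t * (x t z.2.1 w * x t z.2.2 w - (z.2.1 == z.2.2)%:R)) B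
  (fun z => xB _ _ _).
congr (msq_le P _ (_ ^+ 2 * B)).
  apply/funext => w.
  rewrite -(pair_bigA _ (fun h z2 => a h z2.1 * b h z2.2 *
     (\sum_t v h t * (x t z2.1 w * x t z2.2 w - (z2.1 == z2.2)%:R)))) /=.
  rewrite -sumrB; apply: eq_bigr => h _.
  rewrite -(pair_bigA _ (fun m m' => a h m * b h m' *
     (\sum_t v h t * (x t m w * x t m' w - (m == m')%:R)))) /=.
  transitivity (\sum_m \sum_m' \sum_t v h t * (x t m w * a h m * (x t m' w * b h m'))
      - \sum_m \sum_m' a h m * b h m' * (m == m')%:R).
    rewrite -sumrB; apply: eq_bigr => m _; rewrite -sumrB; apply: eq_bigr => m' _.
    rewrite -[X in _ - X]mulr1 -(v_sum h) mulr_sumr mulr_sumr -sumrB.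
    by apply: eq_bigr => t _; ring.
  congr (_ - _).
    under [LHS]eq_bigr => m _ do rewrite exchange_big /=.
    rewrite exchange_big /=; apply: eq_bigr => t _.
    rewrite mulr_suml mulr_sumr; apply: eq_bigr => m _.
    by rewrite mulr_sumr mulr_sumr.
  apply: eq_bigr => m _; rewrite (bigD1 m) //= eqxx mulr1 big1 ?addr0 //.
  by move=> m' /negbTE mm'; rewrite eq_sym mm' mulr0.
rewrite -(pair_bigA _ (fun h z2 => `|a h z2.1 * b h z2.2|)) /=.
apply: eq_bigr => h _; rewrite -(pair_bigA _ (fun m m' => `|a h m * b h m'|)) /=.
rewrite mulr_suml; apply: eq_bigr => m _; rewrite mulr_sumr.
by apply: eq_bigr => m' _; rewrite normrM.
Qed.

End EntryBounds.

(** * Moments of linear processes *)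

Lemma msq_le_linear_process0 d (Om : measurableType d) (R : realType)
    (P : probability Om R) (S : finType) (c : S -> R) (a b : nat -> R)
    (La Lb : R) (X Y : S -> nat -> {RV P >-> R}) (x y : S -> {RV P >-> R}) (B : R) :
  (forall N, \sum_(0 <= q < N) `|a q| <= La) ->
  (forall N, \sum_(0 <= q < N) `|b q| <= Lb) ->
  (forall s, {ae P, forall w,
     series (fun q => a q * X s q w) n @[n --> \oo] --> x s w}) ->
  (forall s, {ae P, forall w,
     series (fun q => b q * Y s q w) n @[n --> \oo] --> y s w}) ->
  (forall q q', msq_le P (fun w => \sum_s c s * (X s q w * Y s q' w)) B) ->
  msq_le P (fun w => \sum_s c s * (x s w * y s w)) ((La * Lb) ^+ 2 * B).
Proof.
move=> aL bL ax byy zB.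
have e (f g : S -> Om -> R) : (fun w => \sum_s c s * (f s w * g s w - 0)) =
    (fun w => \sum_s c s * (f s w * g s w)).
  by apply/funext => w; apply: eq_bigr => s _; rewrite subr0.
rewrite -e; apply: (msq_le_linear_process aL bL ax byy (kk := fun _ _ => 0)).
  by move=> q q'; rewrite e.
rewrite (_ : (fun N => _) = fun=> 0); first exact: cvg_cst.
by apply/funext => N; rewrite big1 // => i _; rewrite big1 // => j _; rewrite mulr0.
Qed.

Section LinearProcessMoments.
Context d (Om : measurableType d) (R : realType) (P : probability Om R).
Variables (J : eqType) (a : nat -> R) (X F : int -> J -> {RV P >-> R}) (L C : R).
Let Xp (p : int * J) := X p.1 p.2.
Hypotheses (lin : linear_process a X F) (indep : mutually_independent Xp)
  (stdX : standardized Xp) (fourthX : forall p, fourth_moment_le C (Xp p))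
  (aL : forall N, \sum_(0 <= q < N) `|a q| <= L).

Lemma linear_process_fourth t m :
  msq_le P (fun w => F t m w * F t m w) ((L * L) ^+ 2 * C).
Proof.
have un (G : unit -> R) : \sum_s G s = G tt.
  by rewrite (bigD1 tt) //= big1 ?addr0 // => -[].
have e (f g : Om -> R) : (fun w => \sum_(s : unit) 1 * (f w * g w)) = (fun w => f w * g w).
  by apply/funext => w; rewrite un mul1r.
rewrite -e; apply: (msq_le_linear_process0 aL aL (X := fun _ q => X (t - q%:Z) m)
  (Y := fun _ q => X (t - q%:Z) m) (x := fun=> F t m) (y := fun=> F t m)) => //.
move=> q q'; rewrite e.
exact: (innov_msq_mul fourthX (t - q%:Z, m) (t - q'%:Z, m)).
Qed.

(** At fixed lags the innovation at (tau s - q, u s) occurs once in a product of two terms: the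
    components [u] and [v] never meet, and a common lag keeps distinct pairs (tau, u) distinct. *)
Lemma linear_process_orth (S : finType) (tau : S -> int) (u v : S -> J) (c : S -> R) :
  (forall s s', u s != v s') ->
  (forall s s', s != s' -> (tau s, u s) != (tau s', u s')) ->
  msq_le P (fun w => \sum_s c s * (F (tau s) (u s) w * F (tau s) (v s) w))
    ((L * L) ^+ 2 * ((\sum_s c s ^+ 2) * C)).
Proof.
move=> uv uinj.
apply: (msq_le_linear_process0 aL aL (X := fun s q => X (tau s - q%:Z) (u s))
  (Y := fun s q => X (tau s - q%:Z) (v s))) => // q q'.
apply: msq_le_orth => [s|s s' ss'].
  exact: (innov_msq_mul fourthX (tau s - q%:Z, u s) (tau s - q'%:Z, v s)).
have := @innov_orth4 _ _ _ P _ _ C indep stdX fourthX (tau s - q%:Z, u s)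
  (tau s - q'%:Z, v s) (tau s' - q%:Z, u s') (tau s' - q'%:Z, v s').
apply.
- by apply/eqP => -[_ /esym/eqP]; apply/negP/uv.
- apply/eqP => -[h1 h2]; move: (uinj _ _ ss'); rewrite h2 => /eqP; apply.
  by congr pair; apply/esym; apply: (addIr (- q%:Z)).
- by apply/eqP => -[_ /esym/eqP]; apply/negP/uv.
Qed.

(** Squares of one component have mean 1, so here the lag expansion needs centring before
    orthogonality applies. *)
Lemma linear_process_sqr (S : finType) (tau : S -> int) (m : J) (c : S -> R) :
  unit_l2 a -> injective tau ->
  msq_le P (fun w => \sum_s c s * (F (tau s) m w * F (tau s) m w - 1))
    ((L * L) ^+ 2 * ((\sum_s c s ^+ 2) * (2 * (C + 1)))).
Proof.
move=> a2 tau_inj.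
(* Only equal lags have a nonzero mean, and sum a_q^2 = 1 makes these means add up to 1. *)
pose kk (q q' : nat) : R := (q == q')%:R.
have k1 : \sum_(0 <= q < N) \sum_(0 <= q' < N) a q * a q' * kk q q' @[N --> \oo] --> (1 : R).
  have kE N : \sum_(0 <= q < N) \sum_(0 <= q' < N) a q * a q' * kk q q' =
      \sum_(0 <= q < N) a q ^+ 2.
    rewrite !big_mkord; apply: eq_bigr => q _.
    rewrite big_mkord (bigD1 q) //= /kk eqxx mulr1 -expr2 big1 ?addr0 // => q' q'q.
    rewrite (_ : (q == q' :> nat) = false) ?mulr0 //.
    by apply/negbTE; rewrite eq_sym.
  under eq_fun do rewrite kE.
  have h : (\sum_(0 <= q < n) (a q ^+ 2)%:E)%E @[n --> \oo] --> 1%:E.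
    rewrite -a2; apply: is_cvg_nneseries => q _ _.
    by rewrite lee_fin sqr_ge0.
  have /fine_cvgP[_] := h; apply: cvg_trans.
  by apply: near_eq_cvg; apply: nearW => N; rewrite /= sumEFin.
have C0 : 0 <= C := msq_le_ge0 (innov_msq_mul fourthX (0, m) (0, m)).
apply: (@msq_le_linear_process _ _ _ P S c a a L L
  (fun s q => X (tau s - q%:Z) m) (fun s q => X (tau s - q%:Z) m)
  (fun s => F (tau s) m) (fun s => F (tau s) m) kk) => //.
move=> q q'; rewrite /kk; have [<-|qq'] := eqVneq q q'.
  apply: msq_le_orth => [s|s s' ss'].
    exact: (innov_msq_sqrB1 fourthX (tau s - q%:Z, m)).
  apply: (@innov_orth_sqr _ _ _ P _ _ C indep stdX fourthX (tau s - q%:Z, m)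
    (tau s' - q%:Z, m)).
  apply/eqP => -[h]; move/eqP: ss'; apply; apply: tau_inj.
  by apply/esym; apply: (addIr (- q%:Z)).
under eq_fun do under eq_bigr do rewrite subr0.
apply: msq_le_orth => [s|s s' ss'].
  apply: msq_leW (innov_msq_mul fourthX (tau s - q%:Z, m) (tau s - q'%:Z, m)) _.
  by rewrite mulrDr mulr1 ler_wpDr // mulr_natl mulr2n ler_wpDr.
have tau_ne : tau s <> tau s' by move/tau_inj/eqP; rewrite (negbTE ss').
have qq : q%:Z <> q'%:Z by case=> /eqP; rewrite (negbTE qq').
(* Among the four times one always occurs once: tau s - q can only coincide with tau s' - q', and if
   it does, then tau s - q' differs from the other three. *)
have [h|h] := eqVneq (tau s' - q'%:Z) (tau s - q%:Z).
  have := @innov_orth4 _ _ _ P _ _ C indep stdX fourthX (tau s - q'%:Z, m)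
    (tau s - q%:Z, m) (tau s' - q%:Z, m) (tau s' - q'%:Z, m).
  under eq_integral do rewrite [X in X * _]mulrC.
  by apply; apply/eqP => -[]; lia.
have := @innov_orth4 _ _ _ P _ _ C indep stdX fourthX (tau s - q%:Z, m)
  (tau s - q'%:Z, m) (tau s' - q%:Z, m) (tau s' - q'%:Z, m).
by apply; apply/eqP => -[]; lia.
Qed.

End LinearProcessMoments.

(** * Products of two independent linear processes *)

Section CrossMoments.
Context d (Om : measurableType d) (R : realType) (P : probability Om R).
Variables (J J' : eqType) (a b : nat -> R) (X F : int -> J -> {RV P >-> R})
  (Y G : int -> J' -> {RV P >-> R}) (L L' C C' : R) (H1 H2 : set (set Om)).
Let Xp (p : int * J) := X p.1 p.2.
Let Yp (p : int * J') := Y p.1 p.2.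
Hypotheses (linX : linear_process a X F) (linY : linear_process b Y G)
  (indepX : mutually_independent Xp) (indepY : mutually_independent Yp)
  (stdX : standardized Xp) (stdY : standardized Yp)
  (fourthX : forall p, fourth_moment_le C (Xp p))
  (fourthY : forall p, fourth_moment_le C (Yp p))
  (aL : forall N, \sum_(0 <= q < N) `|a q| <= L)
  (bL : forall N, \sum_(0 <= q < N) `|b q| <= L')
  (indepXY : independent_fields P <<s H1 >> <<s H2 >>)
  (mH1 : H1 `<=` measurable) (mH2 : H2 `<=` measurable)
  (XH : forall p, preimage_set_system setT (Xp p) measurable `<=` H1)
  (YH : forall p, preimage_set_system setT (Yp p) measurable `<=` H2).

(** The mean of a product of two terms factors over the processes: different times make the factor
    of [X] vanish, different components [v] that of [Y]. The components [u] may repeat, as one core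
    entry meets many positions. *)
Lemma linear_process_cross (S : finType) (tau : S -> int) (u : S -> J) (v : S -> J')
    (c : S -> R) :
  (forall s s', s != s' -> tau s != tau s' \/ v s != v s') ->
  msq_le P (fun w => \sum_s c s * (F (tau s) (u s) w * G (tau s) (v s) w))
    ((L * L') ^+ 2 * ((\sum_s c s ^+ 2) * C)).
Proof.
move=> uv.
apply: (msq_le_linear_process0 aL bL (X := fun s q => X (tau s - q%:Z) (u s))
  (Y := fun s q => Y (tau s - q%:Z) (v s))) => // q q'.
apply: msq_le_orth => [s|s s' ss'].
  apply: msq_leM => //.
  - exact: (innov_msq_mul fourthX (tau s - q%:Z, u s) (tau s - q%:Z, u s)).
  - exact: (innov_msq_mul fourthY (tau s - q'%:Z, v s) (tau s - q'%:Z, v s)).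
have indepYX : independent_fields P <<s H2 >> <<s H1 >>.
  by move=> A B sA sB; rewrite setIC muleC; exact: indepXY.
have [tt'|vv'] := uv _ _ ss'.
  have := @innov_cross _ _ _ P _ _ Xp Yp H1 H2 C C indepXY mH1 mH2 XH YH
    stdX fourthX stdY fourthY (tau s - q%:Z, u s) (tau s' - q%:Z, u s')
    (tau s - q'%:Z, v s) (tau s' - q'%:Z, v s').
  rewrite /Xp /Yp /= => h.
  under eq_integral do rewrite mulrACA.
  apply: h; have := @innov_orth2 _ _ _ P _ Xp indepX stdX
    (tau s - q%:Z, u s) (tau s' - q%:Z, u s').
  rewrite /Xp /=; apply; apply/eqP => -[h _]; move/eqP: tt'; apply; apply/esym.
  exact: (addIr (- q%:Z)).
have := @innov_cross _ _ _ P _ _ Yp Xp H2 H1 C C indepYX mH2 mH1 YH XH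
  stdY fourthY stdX fourthX (tau s - q'%:Z, v s) (tau s' - q'%:Z, v s')
  (tau s - q%:Z, u s) (tau s' - q%:Z, u s').
rewrite /Xp /Yp /= => h.
have e w : X (tau s - q%:Z) (u s) w * Y (tau s - q'%:Z) (v s) w *
    (X (tau s' - q%:Z) (u s') w * Y (tau s' - q'%:Z) (v s') w) =
    Y (tau s - q'%:Z) (v s) w * Y (tau s' - q'%:Z) (v s') w *
    (X (tau s - q%:Z) (u s) w * X (tau s' - q%:Z) (u s') w) by ring.
under eq_integral do rewrite e.
apply: h; have := @innov_orth2 _ _ _ P _ Yp indepY stdY
  (tau s - q'%:Z, v s) (tau s' - q'%:Z, v s').
by rewrite /Yp /=; apply; apply/eqP => -[_ /esym/eqP]; apply/negP.
Qed.

End CrossMoments.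

(** * Moment bounds for the factor model *)

Definition lp_bounded d (Om : measurableType d) (R : realType) (P : probability Om R)
    (J : eqType) (a : nat -> R) (X F : int -> J -> {RV P >-> R}) (L C : R) : Prop :=
  [/\ linear_process a X F, mutually_independent (fun p : int * J => X p.1 p.2),
      standardized (fun p : int * J => X p.1 p.2),
      forall p : int * J, fourth_moment_le C (X p.1 p.2) &
      forall N, \sum_(0 <= q < N) `|a q| <= L].

Lemma msq_le_ext d (Om : measurableType d) (R : realType) (P : probability Om R)
    (f g : Om -> R) B : f =1 g -> msq_le P f B -> msq_le P g B.
Proof. by move=> /funext ->. Qed.

Section ModelMoments.
Context dO (Om : measurableType dO) (R : realType) (P : probability Om R).
Variables (K : nat) (d r re : 'I_K -> nat) (k : 'I_K) (T : nat).
Variables (af ae aeps : nat -> R)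
  (Xf F : int -> tidx r -> {RV P >-> R}) (Xe Fe : int -> tidx re -> {RV P >-> R})
  (Xeps eps : int -> tidx d -> {RV P >-> R}) (L C : R) (H1 H2 : set (set Om)).
Hypotheses (lpF : lp_bounded af Xf F L C) (lpE : lp_bounded ae Xe Fe L C)
  (lpeps : lp_bounded aeps Xeps eps L C) (af2 : unit_l2 af)
  (indepFeps : independent_fields P <<s H1 >> <<s H2 >>)
  (mH1 : H1 `<=` measurable) (mH2 : H2 `<=` measurable)
  (XH : forall p : int * tidx r,
     preimage_set_system setT (Xf p.1 p.2) measurable `<=` H1)
  (YH : forall p : int * tidx d,
     preimage_set_system setT (Xeps p.1 p.2) measurable `<=` H2).
Variables (A : forall l, 'M[R]_(d l, r l)) (Ae : forall l, 'M[R]_(d l, re l))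
  (sd : tidx d -> R) (Cs : R).
Hypothesis sd_le : forall x, 0 <= sd x <= Cs.

Let p := d k.
Let q := nfib d k.
Let pos (i : 'I_p) (h : 'I_q) : tidx d := on_fibre i (fibre h).

Hypothesis C_ge0 : 0 <= C.

Variables (v : 'I_p -> 'I_p -> 'I_q -> 'I_T -> R) (tau : R).
Hypotheses (tau_ge0 : 0 <= tau) (v_ge0 : forall i j h t, 0 <= v i j h t)
  (v_sum : forall i j h, \sum_t v i j h t = 1)
  (v_sqr : forall i j h, \sum_t v i j h t ^+ 2 <= tau)
  (vC : forall i j h t, v i j h t = v j i h t).

Definition common_part (w : Om) (t : 'I_T) : 'M[R]_(p, q) :=
  unfold k (tucker A (fun m => F (obs_time t) m w)).
Definition error_factor_part (w : Om) (t : 'I_T) : 'M[R]_(p, q) :=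
  unfold k (tucker Ae (fun m => Fe (obs_time t) m w)).
Definition idiosyncratic_part (w : Om) (t : 'I_T) : 'M[R]_(p, q) :=
  unfold k (fun x => sd x * eps (obs_time t) x w).

(** One constant for all products of two processes: 2 (C + 1) bounds the second moment of a centred
    squared innovation and exceeds [C]; L^4 is the price of the lag expansion. *)
Let Bc := (L * L) ^+ 2 * (2 * (C + 1)).

Let BcE : (L * L) ^+ 2 * C <= Bc.
Proof. by rewrite ler_wpM2l ?sqr_ge0 // /Bc; move: C_ge0; lra. Qed.

Let Bc_ge0 : 0 <= Bc.
Proof. by rewrite mulr_ge0 ?sqr_ge0 //; move: C_ge0; lra. Qed.

Lemma obs_time_inj : injective (@obs_time T).
Proof. by move=> t t' [] tt'; apply: val_inj. Qed.

Lemma lp_bounded_fourth (J : eqType) a X G : lp_bounded (P := P) (J := J) a X G L C ->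
  forall t m, msq_le P (fun w => G t m w * G t m w) Bc.
Proof.
by move=> [lin ind std f4 aL] t m; apply: msq_leW BcE; exact: linear_process_fourth.
Qed.

Lemma lp_bounded_mul (J J' : eqType) a X G a' X' G' :
  lp_bounded (P := P) (J := J) a X G L C -> lp_bounded (P := P) (J := J') a' X' G' L C ->
  forall t t' m m', msq_le P (fun w => G t m w * G' t' m' w) Bc.
Proof.
by move=> lpG lpG' t t' m m'; apply: msq_leM => //;
  [exact: (lp_bounded_fourth lpG)|exact: (lp_bounded_fourth lpG')].
Qed.

(** [U] and [V] measure loads in l1 over the core index, [Sa] in l2. Along the sequence [U] and [Sa]
    are O(g_s), while [V] stays bounded. *)
Let U := \sum_i \sum_h (\sum_m `|load A (pos i h) m|) ^+ 2.
Let V := \sum_i \sum_h (\sum_m `|load Ae (pos i h) m|) ^+ 2.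
Let Sa := \sum_x \sum_m load A x m ^+ 2.

Let pos_inj i : injective (pos i).
Proof.
move=> h h' e; apply: enum_val_inj; apply/ffunP => l.
by have := congr1 (fun x : tidx d => x (val l)) e; rewrite /pos !on_fibre_other.
Qed.

Let entryF (w : Om) t i h :
  common_part w t i h = \sum_m F (obs_time t) m w * load A (pos i h) m.
Proof. by rewrite mxE. Qed.
Let entryE (w : Om) t i h :
  error_factor_part w t i h = \sum_m Fe (obs_time t) m w * load Ae (pos i h) m.
Proof. by rewrite mxE. Qed.
Let entryI (w : Om) t i h :
  idiosyncratic_part w t i h = \sum_(m : unit) eps (obs_time t) (pos i h) w * sd (pos i h).
Proof. by rewrite mxE (bigD1 tt) //= big1 ?addr0 1?mulrC // => -[]. Qed.

(** For each pair of core entries the sum over time is orthogonal and gives [tau], of order 1/T. All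
    fibres share the same core, so they are summed by the triangle inequality. *)
Lemma common_fluctuation_le :
  efsq_le P (fun w => wprod v (common_part w) (common_part w)
                      - fsq (kron_but A k) *: (A k *m (A k)^T)) (U ^+ 2 * (Bc * tau)).
Proof.
apply: (@efsq_leW _ _ _ _ _ _ _ (\sum_i \sum_j (\sum_h (\sum_m `|load A (pos i h) m|)
    * (\sum_m `|load A (pos j h) m|)) ^+ 2 * (Bc * tau))); last first.
  under eq_bigr do rewrite -mulr_suml.
  rewrite -mulr_suml; apply: ler_wpM2r; first exact: mulr_ge0.
  by rewrite [leRHS]expr2; exact: sum_sum_sqr_le.
apply: efsq_le_entries => i j.
apply: (@msq_le_ext _ _ _ _ _ _ _ _ (@msq_le_fluctuation _ _ _ P q T (v i j)
  (v_sum i j) (tidx r) (fun t m => F (obs_time t) m) (fun h => load A (pos i h))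
  (fun h => load A (pos j h)) (Bc * tau) _)) => [w|].
  rewrite [RHS]mxE [X in _ = X + _]mxE [X in _ = _ + X]mxE [X in _ = _ - X]mxE.
  rewrite -sum_load_mul; congr (_ - _).
  by apply: eq_bigr => h _; apply: eq_bigr => t _; rewrite !entryF.
move=> h m m'; have [lin ind std f4 aL] := lpF.
have vtau : (L * L) ^+ 2 * ((\sum_t v i j h t ^+ 2) * (2 * (C + 1))) <= Bc * tau.
  rewrite [X in X <= _]mulrCA [_ * tau]mulrC ler_wpM2r //.
have [<-|mm'] := eqVneq m m'.
  by apply: msq_leW vtau; apply: (linear_process_sqr lin) => //; exact: obs_time_inj.
under eq_fun do under eq_bigr do rewrite subr0.
have vtau' : (L * L) ^+ 2 * ((\sum_t v i j h t ^+ 2) * C) <= Bc * tau.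
  apply: le_trans vtau; apply: ler_wpM2l; first exact: sqr_ge0.
  apply: ler_wpM2l; first by apply: sumr_ge0 => t _; exact: sqr_ge0.
  by move: C_ge0; lra.
apply: msq_leW vtau'.
apply: (linear_process_orth lin ind std f4 aL (tau := @obs_time T)
  (u := fun=> m) (v := fun=> m')) => // s s' ss'.
by apply/eqP => -[]; move/eqP: ss' => ss' h'; apply: ss'; apply: val_inj.
Qed.

(** Triangle inequality in each entry, then Cauchy-Schwarz over fibres to separate the loads. It
    serves every product with the factor part of the error. *)
Lemma efsq_bilinear (J J' : finType) (x : Om -> 'I_T -> 'M[R]_(p, q))
    (y : Om -> 'I_T -> 'M[R]_(p, q)) (a : tidx d -> J -> R) (b : tidx d -> J' -> R)
    (f : 'I_T -> tidx d -> J -> Om -> R) (g : 'I_T -> tidx d -> J' -> Om -> R) :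
  (forall w t i h, x w t i h = \sum_m f t (pos i h) m w * a (pos i h) m) ->
  (forall w t i h, y w t i h = \sum_m g t (pos i h) m w * b (pos i h) m) ->
  (forall t z z' m m', msq_le P (fun w => f t z m w * g t z' m' w) Bc) ->
  efsq_le P (fun w => wprod v (x w) (y w))
    ((\sum_i \sum_h (\sum_m `|a (pos i h) m|) ^+ 2)
     * (\sum_i \sum_h (\sum_m `|b (pos i h) m|) ^+ 2) * Bc).
Proof.
move=> xE yE fgB.
apply: (@efsq_leW _ _ _ _ _ _ _ (\sum_i \sum_j (\sum_h (\sum_m `|a (pos i h) m|)
    * (\sum_m `|b (pos j h) m|)) ^+ 2 * Bc)); last first.
  under eq_bigr do rewrite -mulr_suml.
  by rewrite -mulr_suml; apply: ler_wpM2r => //; exact: sum_sum_sqr_le.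
apply: efsq_le_entries => i j.
have := @msq_le_bilinear _ _ _ P q T (v i j) (v_ge0 i j) (v_sum i j) J J'
  (fun t h m => f t (pos i h) m) (fun t h m => g t (pos j h) m)
  (fun h => a (pos i h)) (fun h => b (pos j h)) Bc (fun t h m m' => fgB _ _ _ _ _).
congr (msq_le P _ _); apply/funext => w; rewrite !mxE.
by apply: eq_bigr => h _; apply: eq_bigr => t _; rewrite xE yE.
Qed.

(** For symmetric weights, exchanging the factors is a transposition. *)
Lemma efsq_wprodC (x y : Om -> 'I_T -> 'M[R]_(p, q)) B :
  efsq_le P (fun w => wprod v (x w) (y w)) B ->
  efsq_le P (fun w => wprod v (y w) (x w)) B.
Proof.
have e w : wprod v (y w) (x w) = (wprod v (x w) (y w))^T.
  apply/matrixP => i j; rewrite !mxE; apply: eq_bigr => h _; apply: eq_bigr => t _.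
  by rewrite vC [X in _ * X]mulrC.
case=> mB iB; split.
  by move=> i j; under eq_fun do rewrite e mxE; exact: mB.
by under eq_integral do rewrite e fsq_trmx.
Qed.

Let sd_norm x : `|sd x| <= Cs.
Proof. by have /andP[s0 sC] := sd_le x; rewrite ger0_norm. Qed.

Let Cs_sqr x : sd x ^+ 2 <= Cs ^+ 2.
Proof.
have /andP[s0 sC] := sd_le x.
by rewrite ler_sqr ?nnegrE // (le_trans s0).
Qed.

(** For each core entry, the products with the idiosyncratic errors are orthogonal over pairs of a
    time and a fibre; only the fixed number of core entries is summed by Cauchy-Schwarz. *)
Lemma common_idiosyncratic_le :
  efsq_le P (fun w => wprod v (common_part w) (idiosyncratic_part w))
    (p%:R * (#|{: tidx r}|%:R * (Bc * tau * Cs ^+ 2 * Sa))).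
Proof.
pose beta i (j : 'I_p) := #|{: tidx r}|%:R *
  (Bc * tau * Cs ^+ 2 * \sum_m \sum_h load A (pos i h) m ^+ 2).
apply: (@efsq_leW _ _ _ _ _ _ _ (\sum_i \sum_j beta i j)); last first.
  pose g i := p%:R * (#|{: tidx r}|%:R * (Bc * tau * Cs ^+ 2 *
    \sum_m \sum_h load A (pos i h) m ^+ 2)).
  rewrite (eq_bigr g) => [|i _]; last first.
    by rewrite /beta sumr_const card_ord -[LHS]mulr_natl.
  rewrite /g -!mulr_sumr exchange_big /=.
  rewrite [X in _ <= _ * (_ * (_ * X))]exchange_big /=.
  rewrite le_eqVlt; apply/orP; left; apply/eqP; do 3!congr (_ * _).
  by apply: eq_bigr => m _; exact: (sum_on_fibre k (fun x => load A x m ^+ 2)).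
apply: efsq_le_entries => i j; rewrite /beta mulr_sumr.
apply: (@msq_le_ext _ _ _ _ _ _ _ _ (@msq_le_sum _ _ _ P (tidx r)
  (fun m w => \sum_(s : 'I_T * 'I_q)
     (v i j s.2 s.1 * (load A (pos i s.2) m * sd (pos j s.2))) *
     (F (obs_time s.1) m w * eps (obs_time s.1) (pos j s.2) w))
  (fun m => Bc * tau * Cs ^+ 2 * \sum_h load A (pos i h) m ^+ 2) _)) => [w|].
  rewrite !mxE.
  transitivity (\sum_m \sum_(t < T) \sum_(h < q)
    (v i j h t * (load A (pos i h) m * sd (pos j h))) *
    (F (obs_time t) m w * eps (obs_time t) (pos j h) w)).
    by apply: eq_bigr => m _; rewrite pair_bigA.
  rewrite exchange_big [RHS]exchange_big /=; apply: eq_bigr => t _.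
  rewrite exchange_big /=; apply: eq_bigr => h _.
  rewrite entryF [idiosyncratic_part _ _ _ _]mxE mulr_suml mulr_sumr.
  by apply: eq_bigr => m _; ring.
move=> m; have [lin ind std f4 aL] := lpF; have [lin' ind' std' f4' aL'] := lpeps.
apply: msq_leW (linear_process_cross lin lin' ind ind' std std' f4 f4' aL aL'
  indepFeps mH1 mH2 XH YH (tau := fun s : 'I_T * 'I_q => obs_time s.1) (fun=> m)
  (v := fun s => pos j s.2) _ _) _.
  move=> [t h] [t' h'] /= thth'; have [tt'|/eqP tt'] := eqVneq t t'; last first.
    by left; apply/eqP => /obs_time_inj.
  right; apply/eqP => hh'; move/eqP: thth'; apply; rewrite tt'; congr pair.
  exact: pos_inj hh'.
rewrite (_ : Bc * tau * _ * _ = Bc * (tau * Cs ^+ 2 * \sum_h load A (pos i h) m ^+ 2));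
  last by ring.
have h1 : (\sum_(s : 'I_T * 'I_q)
    (v i j s.2 s.1 * (load A (pos i s.2) m * sd (pos j s.2))) ^+ 2)
    <= tau * Cs ^+ 2 * \sum_h load A (pos i h) m ^+ 2.
  rewrite -(pair_bigA _ (fun t h => (v i j h t * (load A (pos i h) m * sd (pos j h))) ^+ 2)) /=.
  rewrite exchange_big mulr_sumr; apply: ler_sum => h _ /=.
  under eq_bigr do rewrite exprMn.
  rewrite -mulr_suml -[leRHS]mulrA; apply: ler_pM => //.
  - by apply: sumr_ge0 => t _; exact: sqr_ge0.
  - exact: sqr_ge0.
  - by rewrite exprMn [leLHS]mulrC ler_wpM2r ?sqr_ge0.
apply: (@le_trans _ _ ((L * L) ^+ 2 * C * (tau * Cs ^+ 2 * \sum_h load A (pos i h) m ^+ 2))).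
  rewrite [leLHS](_ : _ = (L * L) ^+ 2 * C * (\sum_(s : 'I_T * 'I_q)
    (v i j s.2 s.1 * (load A (pos i s.2) m * sd (pos j s.2))) ^+ 2)); last by ring.
  by apply: ler_wpM2l => //; rewrite mulr_ge0 ?sqr_ge0.
apply: ler_wpM2r => //; apply: mulr_ge0; first by rewrite mulr_ge0 ?sqr_ge0.
by apply: sumr_ge0 => h _; exact: sqr_ge0.
Qed.

(** On the diagonal the squares do not cancel, and each of the [p] entries costs q^2. Off the
    diagonal the two positions differ in mode [k], and orthogonality over times and fibres leaves q
    tau for each entry. *)
Lemma idiosyncratic_le :
  efsq_le P (fun w => wprod v (idiosyncratic_part w) (idiosyncratic_part w))
    (Bc * Cs ^+ 4 * (p%:R * q%:R ^+ 2 + p%:R ^+ 2 * (q%:R * tau))).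
Proof.
have Cs40 : 0 <= Cs ^+ 4 by rewrite (exprM Cs 2 2) sqr_ge0.
pose b1 := Bc * Cs ^+ 4 * q%:R ^+ 2; pose b2 := Bc * Cs ^+ 4 * (q%:R * tau).
have b20 : 0 <= b2 by apply: mulr_ge0; apply: mulr_ge0.
apply: (@efsq_leW _ _ _ _ _ _ _ (\sum_i \sum_j if i == j :> 'I_p then b1 else b2)); last first.
  have -> : Bc * Cs ^+ 4 * (p%:R * q%:R ^+ 2 + p%:R ^+ 2 * (q%:R * tau))
      = \sum_(i < p) (b1 + p%:R * b2).
    by rewrite sumr_const card_ord -[RHS]mulr_natl /b1 /b2; ring.
  apply: ler_sum => i _; rewrite (bigD1 i) //= eqxx lerD2l.
  apply: (@le_trans _ _ (\sum_(j < p | j != i) b2)).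
    by apply: ler_sum => j /negbTE ji; rewrite eq_sym ji.
  apply: (@le_trans _ _ (\sum_(j < p) b2)).
    by rewrite [leRHS](bigID (fun j => j != i)) /= lerDl sumr_ge0.
  by rewrite sumr_const card_ord -[X in X <= _]mulr_natl.
apply: efsq_le_entries => i j; have [lin ind std f4 aL] := lpeps.
have [<-|ij] := eqVneq i j.
  have h := @msq_le_bilinear _ _ _ P q T (v i i) (v_ge0 i i) (v_sum i i) unit unit
    (fun t h _ => eps (obs_time t) (pos i h)) (fun t h _ => eps (obs_time t) (pos i h))
    (fun h _ => sd (pos i h)) (fun h _ => sd (pos i h)) Bc
    (fun t h m m' => lp_bounded_mul lpeps lpeps _ _ _ _).
  apply: msq_leW (msq_le_ext _ h) _ => [w|].
    rewrite mxE; apply: eq_bigr => h' _; apply: eq_bigr => t _.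
    by rewrite !entryI.
  rewrite [leLHS]mulrC /b1 -mulrA ler_wpM2l // (exprM Cs 2 2) -exprMn.
  rewrite ler_sqr ?nnegrE; first 1 last.
  - by apply: sumr_ge0 => h' _; rewrite mulr_ge0 ?sumr_ge0.
  - by rewrite mulr_ge0 ?sqr_ge0.
  rewrite mulrC mulr_natl -[q in _ *+ q]card_ord -sumr_const; apply: ler_sum => h' _.
  have un (G : unit -> R) : \sum_s G s = G tt by rewrite (bigD1 tt) //= big1 ?addr0 // => -[].
  by rewrite !un expr2 ler_pM.
apply: (@msq_le_ext _ _ _ _ (fun w => \sum_(s : 'I_T * 'I_q)
   (v i j s.2 s.1 * (sd (pos i s.2) * sd (pos j s.2))) *
   (eps (obs_time s.1) (pos i s.2) w * eps (obs_time s.1) (pos j s.2) w))) => [w|].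
  rewrite mxE -(pair_bigA _ (fun t h => (v i j h t * (sd (pos i h) * sd (pos j h))) *
   (eps (obs_time t) (pos i h) w * eps (obs_time t) (pos j h) w))) exchange_big /=.
  apply: eq_bigr => h _; apply: eq_bigr => t _.
  by rewrite ![idiosyncratic_part _ _ _ _]mxE; ring.
apply: msq_leW (linear_process_orth lin ind std f4 aL
  (tau := fun s : 'I_T * 'I_q => obs_time s.1) (u := fun s => pos i s.2)
  (v := fun s => pos j s.2) _ _ _) _.
- move=> s s'; apply/eqP => /(congr1 (fun x : tidx d => x k)).
  by rewrite /pos !on_fibre_mode; apply/eqP.
- move=> [t h] [t' h'] /= thth'; apply/eqP => -[] tt' hh'.
  move/eqP: thth'; apply; congr pair; last exact: pos_inj hh'.
  exact: val_inj.
have h1 : (\sum_(s : 'I_T * 'I_q)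
    (v i j s.2 s.1 * (sd (pos i s.2) * sd (pos j s.2))) ^+ 2) <= Cs ^+ 4 * (q%:R * tau).
  rewrite -(pair_bigA _ (fun t h => (v i j h t * (sd (pos i h) * sd (pos j h))) ^+ 2)) /=.
  rewrite exchange_big mulrCA mulr_natl -[X in _ *+ X]card_ord -sumr_const.
  apply: ler_sum => h _ /=; under eq_bigr do rewrite exprMn.
  rewrite -mulr_suml mulrC; apply: ler_pM => //.
  - exact: sqr_ge0.
  - by apply: sumr_ge0 => t _; exact: sqr_ge0.
  - by rewrite exprMn (exprM Cs 2 2) [leRHS]expr2 ler_pM ?sqr_ge0.
rewrite /b2 -mulrA [X in X <= _](_ : _ = ((L * L) ^+ 2 * C) * \sum_(s : 'I_T * 'I_q)
    (v i j s.2 s.1 * (sd (pos i s.2) * sd (pos j s.2))) ^+ 2); last by ring.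
apply: ler_pM => //; first by rewrite mulr_ge0 ?sqr_ge0.
by apply: sumr_ge0 => s _; exact: sqr_ge0.
Qed.

Let Sd := \sum_i \sum_h (\sum_(m : unit) `|sd (pos i h)|) ^+ 2.

Let Sd_le : Sd <= p%:R * q%:R * Cs ^+ 2.
Proof.
have -> : p%:R * q%:R * Cs ^+ 2 = \sum_(i < p) \sum_(h < q) Cs ^+ 2.
  by rewrite !sumr_const !card_ord -[RHS]mulr_natl -[X in _ = _ * X]mulr_natl mulrA.
apply: ler_sum => i _; apply: ler_sum => h _.
rewrite (bigD1 tt) //= big1 ?addr0; last by case.
by rewrite real_normK ?num_real.
Qed.

Let V_ge0 : 0 <= V.
Proof. by apply: sumr_ge0 => i _; apply: sumr_ge0 => h _; rewrite sqr_ge0. Qed.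
Let U_ge0 : 0 <= U.
Proof. by apply: sumr_ge0 => i _; apply: sumr_ge0 => h _; rewrite sqr_ge0. Qed.

Let Y (w : Om) (t : 'I_T) : 'M[R]_(p, q) :=
  common_part w t + (error_factor_part w t + idiosyncratic_part w t).

Lemma error_le :
  efsq_le P (fun w => wprod v (Y w) (Y w) - wprod v (common_part w) (common_part w))
    (16 * (U * V * Bc + p%:R * (#|{: tidx r}|%:R * (Bc * tau * Cs ^+ 2 * Sa))
       + V * V * Bc + 2 * (V * (p%:R * q%:R * Cs ^+ 2) * Bc)
       + Bc * Cs ^+ 4 * (p%:R * q%:R ^+ 2 + p%:R ^+ 2 * (q%:R * tau)))).
Proof.
have CE := efsq_bilinear
  (f := fun t _ m => F (obs_time t) m) (g := fun t _ m => Fe (obs_time t) m)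
  entryF entryE (fun t _ _ m m' => lp_bounded_mul lpF lpE _ _ _ _).
have EE := efsq_bilinear
  (f := fun t _ m => Fe (obs_time t) m) (g := fun t _ m => Fe (obs_time t) m)
  entryE entryE (fun t _ _ m m' => lp_bounded_mul lpE lpE _ _ _ _).
have EI := efsq_bilinear
  (f := fun t _ m => Fe (obs_time t) m) (g := fun t z (_ : unit) => eps (obs_time t) z)
  (a := load Ae) (b := fun z _ => sd z)
  entryE entryI (fun t _ _ m m' => lp_bounded_mul lpE lpeps _ _ _ _).
rewrite -/V -/Sd in EI; rewrite -/V in EE; rewrite -/U -/V in CE.
have {}EI : efsq_le P (fun w => wprod v (error_factor_part w) (idiosyncratic_part w))
    (V * (p%:R * q%:R * Cs ^+ 2) * Bc).
  by apply: efsq_leW EI _; apply: ler_wpM2r => //; apply: ler_wpM2l.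
have CI := common_idiosyncratic_le.
have II := idiosyncratic_le.
have dec w : wprod v (Y w) (Y w) - wprod v (common_part w) (common_part w) =
  ((wprod v (common_part w) (error_factor_part w)
    + wprod v (common_part w) (idiosyncratic_part w))
   + ((wprod v (error_factor_part w) (common_part w)
       + wprod v (idiosyncratic_part w) (common_part w))
      + ((wprod v (error_factor_part w) (error_factor_part w)
          + wprod v (error_factor_part w) (idiosyncratic_part w))
         + (wprod v (idiosyncratic_part w) (error_factor_part w)
          + wprod v (idiosyncratic_part w) (idiosyncratic_part w))))).
  rewrite /Y !(wprodDl, wprodDr).
  move: (wprod v (common_part w) (common_part w)).
  move: (wprod v (common_part w) (error_factor_part w)).
  move: (wprod v (common_part w) (idiosyncratic_part w)).
  move: (wprod v (error_factor_part w) (common_part w)).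
  move: (wprod v (error_factor_part w) (error_factor_part w)).
  move: (wprod v (error_factor_part w) (idiosyncratic_part w)).
  move: (wprod v (idiosyncratic_part w) (common_part w)).
  move: (wprod v (idiosyncratic_part w) (error_factor_part w)).
  move: (wprod v (idiosyncratic_part w) (idiosyncratic_part w)).
  by move=> *; apply/matrixP => i j; rewrite !mxE; ring.
(* The sums are nested at most four deep and each level doubles, hence the factor 16. *)
have := efsq_leD (efsq_leD CE CI) (efsq_leD (efsq_leD (efsq_wprodC CE) (efsq_wprodC CI))
  (efsq_leD (efsq_leD EE EI) (efsq_leD (efsq_wprodC EI) II))).
rewrite -(funext dec) => /efsq_leW; apply.
have CI0 := efsq_le_ge0 CI.
have CE0 := efsq_le_ge0 CE.
have EE0 := efsq_le_ge0 EE.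
have EI0 := efsq_le_ge0 EI.
have II0 := efsq_le_ge0 II.
lra.
Qed.

End ModelMoments.

(** * Measurability *)

Section Measurability.
Context dS (S : measurableType dS) (R : realType).

Definition measurable_mx (p q : nat) (M : S -> 'M[R]_(p, q)) : Prop :=
  forall i j, measurable_fun setT (fun s => M s i j).

(** Meant for the mask: it takes finitely many values, and for each of them the estimators are
    explicit functions of the remaining data. *)
Lemma measurable_finite_dep (E : finType) (e : S -> E) (G : E -> S -> R) :
  (forall x, measurable [set s | e s = x]) ->
  (forall x, measurable_fun setT (G x)) ->
  measurable_fun setT (fun s => G (e s) s).
Proof.
move=> me mG.
rewrite (_ : (fun s => _) = (fun s => \sum_x \1_[set s | e s = x] s * G x s)).
  by apply: measurable_sum => x; apply: measurable_funM.
apply/funext => s; rewrite (bigD1 (e s)) //= indicE mem_set // mul1r big1 ?addr0 //.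
move=> x xs; rewrite indicE memNset ?mul0r // => /= h.
by rewrite -h eqxx in xs.
Qed.

(** Inversion is a power function on each open half-line, and its value at 0 is 0. *)
Lemma measurable_invr : measurable_fun setT (@GRing.inv R).
Proof.
rewrite (_ : @GRing.inv R = fun x => if 0 < x then x `^ (- 1)
  else if x < 0 then - ((- x) `^ (- 1)) else 0).
  apply: measurable_fun_ifT; first exact: measurable_fun_ltr.
    exact: measurable_powR.
  apply: measurable_fun_ifT => //; first exact: measurable_fun_ltr.
  apply: measurableT_comp => //.
  by apply: (measurableT_comp (f := fun x : R => x `^ (- 1))); first exact: measurable_powR.
apply/funext => x; case: (ltrgt0P x) => [x0|x0|->]; last by rewrite invr0.
  by rewrite powR_inv1 // ltW.
by rewrite powR_inv1 ?oppr_ge0 ?(ltW x0) // invrN opprK.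
Qed.

Lemma measurable_mx_mul (p q s : nat) (M : S -> 'M[R]_(p, q)) (N : S -> 'M[R]_(q, s)) :
  measurable_mx M -> measurable_mx N -> measurable_mx (fun x => M x *m N x).
Proof.
move=> mM mN i j; under eq_fun do rewrite mxE.
by apply: measurable_sum => l; apply: measurable_funM.
Qed.

Lemma measurable_mxB (p q : nat) (M N : S -> 'M[R]_(p, q)) :
  measurable_mx M -> measurable_mx N -> measurable_mx (fun x => M x - N x).
Proof.
by move=> mM mN i j; under eq_fun do rewrite !mxE; apply: measurable_funB.
Qed.

Lemma measurable_mxZ (p q : nat) (c : S -> R) (M : S -> 'M[R]_(p, q)) :
  measurable_fun setT c -> measurable_mx M -> measurable_mx (fun x => c x *: M x).
Proof.
by move=> mc mM i j; under eq_fun do rewrite mxE; apply: measurable_funM.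
Qed.

Lemma measurable_mx_tr (p q : nat) (M : S -> 'M[R]_(p, q)) :
  measurable_mx M -> measurable_mx (fun x => (M x)^T).
Proof. by move=> mM i j; under eq_fun do rewrite mxE; exact: mM. Qed.

Lemma measurable_mx_sum (I : Type) (l : seq I) (Pr : pred I) (p q : nat)
    (M : I -> S -> 'M[R]_(p, q)) :
  (forall i, measurable_mx (M i)) -> measurable_mx (fun x => \sum_(i <- l | Pr i) M i x).
Proof.
move=> mM i j; under eq_fun do rewrite summxE big_mkcond.
apply: measurable_sum => h; case: (Pr h) => //; exact: mM.
Qed.

Lemma measurable_det (p : nat) (M : S -> 'M[R]_p) :
  measurable_mx M -> measurable_fun setT (fun x => \det (M x)).
Proof.
move=> mM; apply: measurable_sum => s; apply: measurable_funM => //.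
by apply: measurable_prod => i _.
Qed.

(** Cramer's rule where the determinant is nonzero; elsewhere [invmx] returns its argument. *)
Lemma measurable_invmx (p : nat) (M : S -> 'M[R]_p) :
  measurable_mx M -> measurable_mx (fun x => invmx (M x)).
Proof.
move=> mM i j.
have mdet := measurable_det mM.
have -> : (fun x => invmx (M x) i j) = (fun x =>
    if \det (M x) != 0 then (\det (M x))^-1 * cofactor (M x) j i else M x i j).
  apply/funext => x; rewrite /invmx unitmxE unitfE; case: ifP => // _.
  by rewrite !mxE.
apply: measurable_fun_ifT => //.
- by apply: measurable_neg; exact: measurable_fun_eqr.
- apply: measurable_funM; first exact: (measurableT_comp measurable_invr).
  apply: measurable_funM => //; apply: measurable_det => a b.
  by under eq_fun do rewrite !mxE; exact: mM.
Qed.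

Lemma measurable_rowv (p q : nat) (M : S -> 'M[R]_(p, q)) a :
  measurable_mx M -> measurable_mx (fun x => rowv (M x) a).
Proof. by move=> mM i j; under eq_fun do rewrite /rowv !mxE; exact: mM. Qed.

Lemma measurable_Zdiag (p q : nat) (M : S -> 'M[R]_(p, q)) j :
  measurable_mx M -> measurable_fun setT (fun x => Zdiag (M x) 0 j).
Proof.
move=> mM; under eq_fun do rewrite mxE.
by apply: measurable_mx_mul => //; exact: measurable_mx_tr.
Qed.

Lemma measurable_sqrt : measurable_fun setT (@Num.sqrt R).
Proof. by apply: continuous_measurable_fun; exact: sqrt_continuous. Qed.

Lemma measurable_Zhalf (p q : nat) (M : S -> 'M[R]_(p, q)) :
  measurable_mx M -> measurable_mx (fun x => Zhalf (M x)).
Proof.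
move=> mM i j; have [->|ij] := eqVneq i j; last first.
  by under eq_fun do rewrite /Zhalf mxE (negbTE ij); exact: measurable_cst.
under eq_fun do rewrite /Zhalf mxE eqxx mulr1n mxE.
by apply: (measurableT_comp measurable_sqrt); exact: measurable_Zdiag.
Qed.

Lemma measurable_Zinvhalf (p q : nat) (M : S -> 'M[R]_(p, q)) :
  measurable_mx M -> measurable_mx (fun x => Zinvhalf (M x)).
Proof.
move=> mM i j; have [->|ij] := eqVneq i j; last first.
  by under eq_fun do rewrite /Zinvhalf mxE (negbTE ij); exact: measurable_cst.
under eq_fun do rewrite /Zinvhalf mxE eqxx mulr1n mxE.
apply: (measurableT_comp measurable_invr); apply: (measurableT_comp measurable_sqrt).
exact: measurable_Zdiag.
Qed.

Lemma measurable_normalized (p q : nat) (M : S -> 'M[R]_(p, q)) :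
  measurable_mx M -> measurable_mx (fun x => normalized (M x)).
Proof.
move=> mM; rewrite /normalized; apply: measurable_mx_mul => //.
exact: measurable_Zinvhalf.
Qed.

Section Model.
Variables (K T : nat) (d r : 'I_K -> nat).
Variables (A : S -> forall l, 'M[R]_(d l, r l)) (F : S -> 'I_T -> tidx r -> R).
Hypotheses (mA : forall l, measurable_mx (fun s => A s l))
  (mF : forall t m, measurable_fun setT (fun s => F s t m)).

Lemma measurable_tucker (d' r' : 'I_K -> nat) (B : S -> forall l, 'M[R]_(d' l, r' l))
    (X : S -> tidx r' -> R) i :
  (forall l, measurable_mx (fun s => B s l)) ->
  (forall m, measurable_fun setT (fun s => X s m)) ->
  measurable_fun setT (fun s => tucker (B s) (X s) i).
Proof.
move=> mB mX; apply: measurable_sum => m; apply: measurable_funM => //.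
by apply: measurable_prod => l _; exact: mB.
Qed.

Lemma measurable_unfold (d' : 'I_K -> nat) (X : S -> tidx d' -> R) k :
  (forall m, measurable_fun setT (fun s => X s m)) ->
  measurable_mx (fun s => unfold k (X s)).
Proof. by move=> mX i j; under eq_fun do rewrite mxE; exact: mX. Qed.

Lemma measurable_kron_but (d' r' : 'I_K -> nat)
    (B : S -> forall l, 'M[R]_(d' l, r' l)) k :
  (forall l, measurable_mx (fun s => B s l)) ->
  measurable_mx (fun s => kron_but (B s) k).
Proof.
move=> mB i j; under eq_fun do rewrite mxE.
by apply: measurable_prod => l _; exact: mB.
Qed.

Lemma measurable_common k t : measurable_mx (fun s => common (A s) (F s) k t).
Proof.
by apply: measurable_unfold => m; apply: measurable_tucker.
Qed.

Lemma measurable_FZ t m : measurable_fun setT (fun s => FZ (A s) (F s) t m).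
Proof. by apply: measurable_tucker => // l; exact: measurable_Zhalf. Qed.

Lemma measurable_Lam k : measurable_mx (fun s => Lam (A s) k).
Proof.
by apply: (measurable_kron_but (B := fun s l => normalized (A s l))) => l;
  exact: measurable_normalized.
Qed.

Lemma measurable_uvec k t h : measurable_mx (fun s => uvec (A s) (F s) (k := k) t h).
Proof.
apply: measurable_mx_mul; first by apply: measurable_unfold => m; exact: measurable_FZ.
by apply: measurable_rowv; exact: measurable_Lam.
Qed.

Lemma measurable_wprod (p q : nat) (v : 'I_p -> 'I_p -> 'I_q -> 'I_T -> R)
    (X Z : S -> 'I_T -> 'M[R]_(p, q)) :
  (forall t, measurable_mx (fun s => X s t)) ->
  (forall t, measurable_mx (fun s => Z s t)) ->
  measurable_mx (fun s => wprod v (X s) (Z s)).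
Proof.
move=> mX mZ i j; under eq_fun do rewrite mxE.
apply: measurable_sum => h; apply: measurable_sum => t; apply: measurable_funM => //.
by apply: measurable_funM; [exact: mX|exact: mZ].
Qed.

Variables (W : 'I_T -> tidx d -> bool) (Y : S -> 'I_T -> tidx d -> R).
Hypothesis mY : forall t i, measurable_fun setT (fun s => Y s t i).

Lemma measurable_Shat k : measurable_mx (fun s => Shat W (Y s) k).
Proof.
have -> : (fun s => Shat W (Y s) k) = (fun s => wprod (obs_weight W (k := k))
    (fun t => unfold k (Y s t)) (fun t => unfold k (Y s t))).
  by apply/funext => s; exact: Shat_wprod.
by apply: measurable_wprod => t; exact: measurable_unfold.
Qed.

Variables (k : 'I_K) (Qh : S -> 'M[R]_(d k, r k)).
Hypothesis mQ : measurable_mx Qh.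

Lemma measurable_Dhat : measurable_mx (fun s => Dhat W (Y s) (Qh s)).
Proof.
apply: measurable_mx_mul => //; apply: measurable_mx_mul; last exact: measurable_Shat.
exact: measurable_mx_tr.
Qed.

Lemma measurable_Hrow j : measurable_mx (fun s => Hrow W (Y s) (A s) (F s) (Qh s) j).
Proof.
apply: measurable_mx_mul; first exact/measurable_invmx/measurable_Dhat.
apply: measurable_mx_sum => i; apply: measurable_mx_mul; first exact: measurable_rowv.
apply: measurable_mx_sum => h; apply: measurable_mxZ => //.
apply: measurable_mx_sum => t; apply: measurable_mxZ.
  apply: measurable_mx_mul; first exact/measurable_mx_tr/measurable_uvec.
  by apply: measurable_rowv; exact: measurable_normalized.
exact/measurable_mx_tr/measurable_uvec.
Qed.

Lemma measurable_Hall : measurable_mx (fun s => Hall W (Y s) (A s) (F s) (Qh s)).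
Proof.
apply: measurable_mxZ => //; apply: measurable_mx_sum => t.
have mu : measurable_mx (fun s => unfold k (FZ (A s) (F s) t)).
  by apply: measurable_unfold => m; exact: measurable_FZ.
apply: measurable_mx_mul; last exact: measurable_mx_tr.
apply: measurable_mx_mul; last exact: measurable_Lam.
apply: measurable_mx_mul; last exact/measurable_mx_tr/measurable_Lam.
apply: measurable_mx_mul => //.
apply: measurable_mx_mul; last exact: measurable_normalized.
apply: measurable_mx_mul; last exact: measurable_mx_tr.
exact/measurable_invmx/measurable_Dhat.
Qed.

End Model.

Lemma measurable_l2norm (p : nat) (M : S -> 'cV[R]_p) :
  measurable_mx M -> measurable_fun setT (fun s => l2norm (M s)).
Proof.
move=> mM; apply: (measurableT_comp measurable_sqrt).
by apply: measurable_sum => i; apply: measurable_funX; exact: mM.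
Qed.

End Measurability.

(** * Rates *)

Section StochasticOrders.
Context d (Om : measurableType d) (R : realType) (P : probability Om R).

Lemma measurable_tail (X : Om -> R) (c : R) : measurable_fun setT X ->
  measurable [set w | c < `|X w|].
Proof.
move=> mX; rewrite -[X in measurable X]setTI; apply: measurable_fun_ltr => //.
exact: measurableT_comp.
Qed.

Lemma is_OP_intro (X : nat -> Om -> R) (b : nat -> R) :
  (forall n, measurable_fun setT (X n)) ->
  (forall e, 0 < e -> exists2 C, 0 < C & \forall n \near \oo, exists G : set Om,
     [/\ measurable G, (P (~` G) <= e%:E)%E &
         forall w, G w -> `|X n w| <= C * `|b n|]) ->
  is_OP P X b.
Proof.
move=> mX XG e e0; have [C C0 near_G] := XG e e0; exists C => //.
apply: filterS near_G => n [G [mG PG GX]].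
apply: le_trans PG; apply: le_measure; rewrite ?inE.
- exact: measurable_tail.
- exact: measurableC.
- by move=> w /= Cb Gw; move: (GX w Gw); rewrite leNgt Cb.
Qed.

Lemma is_oP_of_OP (X : nat -> Om -> R) (b : nat -> R) :
  (forall n, measurable_fun setT (X n)) -> is_OP P X b ->
  b n @[n --> \oo] --> 0 -> is_oP P X (fun=> 1).
Proof.
move=> mX XO b0 e e0.
apply/fine_cvgP; split.
  by apply: nearW => n; rewrite fin_num_measure //; exact: measurable_tail.
apply/cvgr0Pnorm_le => e' e'0.
have [C C0 near_C] := XO e' e'0.
have near_b : \forall n \near \oo, C * `|b n| <= e.
  move/cvgr0Pnorm_le : b0 => /(_ (e / C) (divr_gt0 e0 C0)).
  by apply: filterS => n; rewrite ler_pdivlMr // mulrC.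
near=> n.
have mt : measurable [set w | e * `|1 : R| < `|X n w|] by exact: measurable_tail.
rewrite ger0_norm ?fine_ge0 // -lee_fin fineK ?fin_num_measure //.
apply: (@le_trans _ _ (P [set w | C * `|b n| < `|X n w|])); last by near: n.
apply: le_measure; rewrite ?inE //; first exact: measurable_tail.
move=> w /=; rewrite normr1 mulr1; apply: le_lt_trans.
by near: n.
Unshelve. all: by end_near. Qed.

End StochasticOrders.

Section Rates.
Context (R : realType).

(* [p], [q] are the dimensions of the unfolding, [g] stands for g_s, [T] for the
   sample size and [u] for p^(spread). *)
Lemma rate_identity (p q g T u : R) : 0 < p -> 0 < q -> 0 < g -> 0 < T ->
  u ^+ 2 / p * ((T * q)^-1 + p^-1) * ((p * q) ^+ 2 / g ^+ 2)
  = p^-1 * ((p * q ^+ 2 + p ^+ 2 * (q / T)) * (u / g) ^+ 2).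
Proof. by move=> p0 q0 g0 T0; field; rewrite !gt_eqF. Qed.

(** The first summand is the square of the third quantity in (R1), the second is the first quantity
    in (R1). *)
Lemma rate_split (p q g T u : R) : 0 < p -> 0 < q -> 0 < g -> 0 < T ->
  (p * q ^+ 2 + p ^+ 2 * (q / T)) * (u / g) ^+ 2
  = (p * q * g^-1 * u) ^+ 2 / p + p * q * (g ^+ 2)^-1 * T^-1 * (u ^+ 2 * p).
Proof. by move=> p0 q0 g0 T0; field; rewrite !gt_eqF. Qed.

Lemma powR_rates (p s : R) : 0 < p ->
  [/\ p `^ (2 * s + 1) = (p `^ s) ^+ 2 * p, p `^ (2 * s) = (p `^ s) ^+ 2,
      p `^ (2 * s - 1) = (p `^ s) ^+ 2 / p &
      (p `^ (s - 1 / 2)) ^+ 2 = (p `^ s) ^+ 2 / p].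
Proof.
move=> p0; have pD x y : p `^ (x + y) = p `^ x * p `^ y.
  by rewrite powRD // (gt_eqF p0) implybT.
have pp x : p `^ (2 * x) = (p `^ x) ^+ 2 by rewrite mulr_natl mulr2n pD.
have p1 : p `^ 1 = p by rewrite powRr1 // ltW.
have pN1 : p `^ (- 1) = p^-1 by rewrite powR_inv1 // ltW.
split=> //.
- by rewrite pD pp p1.
- by rewrite pD pp pN1.
- by rewrite -pp mulrBr mul1r mulfV // pD pp pN1.
Qed.

End Rates.

(** * Well-behaved loadings *)

(** Evaluating the nonnegative form at y - F^-1 x with x = S^-1 y yields the bound directly, without
    a spectral decomposition or compactness. *)
Lemma posdef_coercive (R : realType) (p : nat) (S : 'M[R]_p) : posdef S ->
  exists2 sig : R, 0 < sig & forall y : 'cV_p, sig * fsq y <= (y^T *m S *m y) 0 0.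
Proof.
move=> [Ssym Spos].
have SU : S \in unitmx.
  rewrite -row_free_unit -kermx_eq0; apply/eqP/row_matrixP => i.
  rewrite row0; apply/eqP; apply: contraT => x0.
  have := Spos (row i (kermx S))^T; rewrite trmx_eq0 => /(_ x0).
  by rewrite trmxK -row_mul mulmx_ker row0 mul0mx mxE ltxx.
(* With n the squared Frobenius norm of the inverse, x' y <= sqrt n |y|^2 <= F |y|^2; adding 1 gives
   both F > 0 and n <= F^2. *)
pose F := fsq (invmx S) + 1.
have F0 : 0 < F by rewrite ltr_wpDl // fsq_ge0.
exists F^-1; first by rewrite invr_gt0.
move=> y; pose x := invmx S *m y.
have Sx : S *m x = y by rewrite mulmxA mulmxV // mul1mx.
have xy : (x^T *m y) 0 0 <= F * fsq y.
  have h1 : fsq x <= fsq (invmx S) * fsq y.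
    rewrite fsq_cV [fsq (invmx S)]/fsq mulr_suml; apply: ler_sum => i _.
    rewrite mxE fsq_cV; apply: sum_sqr_le => j; rewrite ?sqr_ge0 //.
    by rewrite exprMn.
  have h2 := dot_sqr_le x y.
  have y0 := fsq_ge0 y; have n0 := fsq_ge0 (invmx S); have x0 := fsq_ge0 x.
  have b0 : 0 <= F * fsq y by rewrite mulr_ge0 // ltW.
  have h3 : (x^T *m y) 0 0 ^+ 2 <= (F * fsq y) ^+ 2.
    apply: le_trans h2 _; rewrite exprMn [X in _ <= _ * X]expr2 mulrA.
    apply: ler_wpM2r => //; apply: le_trans h1 _; apply: ler_wpM2r => //.
    by rewrite /F; nra.
  rewrite leNgt; apply/negP => h.
  by move: h3; rewrite ler_sqr ?nnegrE ?(le_trans b0 (ltW h)) // leNgt h.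
have S0 (z : 'cV[R]_p) : 0 <= (z^T *m S *m z) 0 0.
  have [->|z0] := eqVneq z 0; first by rewrite mulmx0 mxE.
  exact: ltW (Spos _ z0).
have := S0 (y - F^-1 *: x).
have -> : ((y - F^-1 *: x)^T *m S *m (y - F^-1 *: x)) 0 0 =
    (y^T *m S *m y) 0 0 - 2 * F^-1 * fsq y + (F^-1) ^+ 2 * (x^T *m y) 0 0.
  have xS : x^T *m S = y^T by rewrite -{1}Ssym -trmx_mul Sx.
  have e1 : S *m (y - F^-1 *: x) = S *m y - F^-1 *: y.
    by rewrite mulmxBr -scalemxAr Sx.
  have e2 : (y - F^-1 *: x)^T = y^T - F^-1 *: x^T by rewrite linearB /= linearZ.
  have e3 : x^T *m (S *m y) = y^T *m y by rewrite mulmxA xS.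
  rewrite -mulmxA e1 e2 mulmxBl !mulmxBr -!scalemxAl -!scalemxAr e3.
  rewrite -fsq_dot -mulmxA.
  move: (y^T *m (S *m y)) (y^T *m y) (x^T *m y) => m1 m2 m3.
  by rewrite !mxE; ring.
have := ler_wpM2l (sqr_ge0 F^-1) xy.
have -> : F^-1 ^+ 2 * (F * fsq y) = F^-1 * fsq y by field; rewrite gt_eqF.
lra.
Qed.

Section GoodLoadings.
Context {R : realType} {K : nat}.
Variables (d r : 'I_K -> nat) (A : forall l, 'M[R]_(d l, r l)).
Variables (v : forall l, 'I_(r l) -> R) (g : 'I_K -> R) (c : R).
Hypotheses (c_ge1 : 1 <= c) (v_gt0 : forall l (j : 'I_(r l)), 0 < v j)
  (vg : forall l (j : 'I_(r l)), v j <= g l)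
  (Z_up : forall l j, Zdiag (A l) 0 j <= c * v j)
  (Z_lo : forall l j, v j <= c * Zdiag (A l) 0 j).

Let c_gt0 : 0 < c := lt_le_trans ltr01 c_ge1.

Lemma good_Zdiag_gt0 l j : 0 < Zdiag (A l) 0 j.
Proof. by have := lt_le_trans (v_gt0 j) (Z_lo j); rewrite pmulr_rgt0. Qed.

(** [v] stands for d_l^alpha_(l,j) and [g] for d_l^alpha_(l,1). Each core index contributes a
    product of diagonal entries of the Z_l, hence at most c^K g_s. *)
Lemma good_load_le :
  \sum_x \sum_m load A x m ^+ 2 <= #|{: tidx r}|%:R * (c ^+ K * \prod_(l < K) g l).
Proof.
rewrite exchange_big /= mulr_natl -sumr_const; apply: ler_sum => m _.
rewrite sum_load_sqr -[K in c ^+ K]card_ord -prodr_const -big_split /=.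
apply: ler_prod => l _; rewrite (ltW (good_Zdiag_gt0 _)) /=.
by apply: le_trans (Z_up _) _; apply: ler_wpM2l; [exact: ltW|exact: vg].
Qed.

(** [j0] selects the strongest column of each mode; the exponent [K] in place of K - 1 is harmless
    because c >= 1. *)
Lemma good_kron_ge k (j0 : forall l, 'I_(r l)) : (forall l, v (j0 l) = g l) ->
  \prod_(l < K | l != k) g l <= c ^+ K * fsq (kron_but A k).
Proof.
move=> gj0; apply: (@le_trans _ _ (c ^+ K * \prod_(l < K | l != k) Zdiag (A l) 0 (j0 l)));
  last by rewrite ler_wpM2l ?exprn_ge0 ?fsq_kron_ge // ltW.
apply: (@le_trans _ _ (\prod_(l < K | l != k) (c * Zdiag (A l) 0 (j0 l)))).
  apply: ler_prod => l _; rewrite -gj0 (ltW (v_gt0 _)) /=; exact: Z_lo.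
rewrite big_split /= prodr_const; apply: ler_wpM2r.
  by apply: prodr_ge0 => l _; exact/ltW/good_Zdiag_gt0.
by apply: ler_weXn2l => //; rewrite -[X in (_ <= X)%N]card_ord max_card.
Qed.

(** With z = Z^(1/2) y, |A y|^2 is the form of the normalized Gram matrix at [z]. That matrix keeps
    half of the coercivity of [S], and |z|^2 >= (vmin / c) |y|^2. *)
Lemma good_singular_ge k (S : 'M[R]_(r k)) (sig vmin : R) :
  0 < sig -> (forall y : 'cV_(r k), sig * fsq y <= (y^T *m S *m y) 0 0) ->
  fsq (Zinvhalf (A k) *m (A k)^T *m A k *m Zinvhalf (A k) - S) <= (sig / 2) ^+ 2 ->
  (forall j : 'I_(r k), vmin <= v j) ->
  forall y : 'cV_(r k), sig / 2 / c * vmin * fsq y <= fsq (A k *m y).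
Proof.
move=> sig0 Scoer MS vminv y.
set M := Zinvhalf (A k) *m (A k)^T *m A k *m Zinvhalf (A k).
pose z := Zhalf (A k) *m y.
have ZZ : Zinvhalf (A k) *m Zhalf (A k) = 1%:M.
  rewrite mulmx_diag; apply/matrixP => i j; rewrite !mxE; congr (_ *+ _).
  by rewrite mulVf // sqrtr_eq0 -ltNge; have := @good_Zdiag_gt0 k i; rewrite !mxE.
have Az : fsq (A k *m y) = (z^T *m M *m z) 0 0.
  rewrite -fsq_dot; congr (fun_of_matrix _ 0 0).
  have tr : (Zhalf (A k))^T = Zhalf (A k) by rewrite tr_diag_mx.
  have ZZ' : Zhalf (A k) *m Zinvhalf (A k) = 1%:M by exact: mulmx1C.
  rewrite /z /M !trmx_mul tr !mulmxA -(mulmxA y^T (Zhalf (A k))) ZZ' mulmx1.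
  by rewrite -[in RHS](mulmxA _ (Zinvhalf (A k)) (Zhalf _)) ZZ mulmx1.
have Mz : sig / 2 * fsq z <= (z^T *m M *m z) 0 0.
  have h1 := Scoer z; have h2 := quad_form_le z (divr_ge0 (ltW sig0) (ler0n R 2)) MS.
  have e : (z^T *m M *m z) 0 0 = (z^T *m S *m z) 0 0 + (z^T *m (M - S) *m z) 0 0.
    by rewrite mulmxBr mulmxBl !mxE; ring.
  rewrite e; move: h1 h2; lra.
rewrite Az; apply: le_trans Mz.
rewrite -!mulrA ler_wpM2l ?(ltW sig0) // ler_wpM2l ?invr_ge0 //.
rewrite !fsq_cV !mulr_sumr; apply: ler_sum => j _.
rewrite /z mul_diag_mx !mxE exprMn sqr_sqrtr; last first.
  by have := ltW (@good_Zdiag_gt0 k j); rewrite !mxE.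
have Zj := Z_lo j; rewrite !mxE in Zj.
rewrite mulrA ler_wpM2r ?sqr_ge0 // mulrC ler_pdivrMr // mulrC.
exact: le_trans (vminv j) Zj.
Qed.

End GoodLoadings.

(** * The model along the asymptotic sequence *)

Lemma sigma_of_measurable dO (Om : measurableType dO) (R : realType)
    (P : probability Om R) (I : Type) dV (V : measurableType dV) (D : set I)
    (X : I -> {RV P >-> V}) : sigma_of D X `<=` measurable.
Proof.
apply: g_sigma_measurable => A [i _ [B mB <-]].
by apply: (measurable_funPT (X i)).
Qed.

Lemma sub_sigma_of dO (Om : measurableType dO) (R : realType)
    (P : probability Om R) (I : Type) dV (V : measurableType dV) (D : set I)
    (X : I -> {RV P >-> V}) i : D i ->
  preimage_set_system setT (X i) measurable `<=` sigma_of D X.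
Proof. by move=> Di A XA; apply: sub_sigma_algebra; exists i. Qed.

Section Sizes.
Context (R : realType) (K : nat) (d : 'I_K -> nat).

Lemma nfib_prod (k : 'I_K) :
  ((d k)%:R * (nfib d k)%:R = \prod_(l < K) (d l)%:R :> R).
Proof.
have h := sum_on_fibre k (fun _ : tidx d => 1 : R).
have <- : \sum_(x : tidx d) (\prod_(l < K) 1 : R) = \prod_(l < K) (d l)%:R.
  rewrite (sum_dffun_prod (fun l _ => 1 : R)); apply: eq_bigr => l _.
  by rewrite sumr_const card_ord.
rewrite (eq_bigr (fun=> 1)) => [|x _]; last by rewrite big1.
by rewrite -h !sumr_const !card_ord -[RHS]mulr_natl.
Qed.

End Sizes.

(** * Weights given by the mask *)

Section ObservationWeights.
Context (R : realType) (K T : nat) (d : 'I_K -> nat) (W : 'I_T -> tidx d -> bool).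
Variables (k : 'I_K) (psi0 : R).
Hypotheses (T_gt0 : (0 < T)%N) (psi0_gt0 : 0 < psi0)
  (Wpsi : forall (i j : 'I_(d k)) h, psi0 <= #|psi W i j h|%:R / T%:R).

Lemma obs_weight_ge0 (i j : 'I_(d k)) h t : 0 <= obs_weight W i j h t :> R.
Proof. by rewrite /obs_weight divr_ge0. Qed.

Let psi_gt0 (i j : 'I_(d k)) h : 0 < #|psi W i j h|%:R :> R.
Proof.
have := lt_le_trans psi0_gt0 (Wpsi i j h).
by rewrite pmulr_lgt0 // invr_gt0 ltr0n.
Qed.

Lemma obs_weight_sum (i j : 'I_(d k)) h : \sum_t obs_weight W i j h t = 1 :> R.
Proof.
rewrite -mulr_suml -natr_sum -big_mkcond /= sum1_card divff //.
by rewrite gt_eqF.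
Qed.

(** Each weight is 0 or the reciprocal of the cardinality, so the squares sum to that reciprocal. *)
Lemma obs_weight_sqr (i j : 'I_(d k)) h :
  \sum_t obs_weight W i j h t ^+ 2 <= (psi0 * T%:R)^-1 :> R.
Proof.
have -> : \sum_t obs_weight W i j h t ^+ 2 = #|psi W i j h|%:R^-1 :> R.
  transitivity ((\sum_t obs_weight W i j h t) * #|psi W i j h|%:R^-1 : R);
    last by rewrite obs_weight_sum mul1r.
  rewrite mulr_suml; apply: eq_bigr => t _.
  by rewrite /obs_weight; case: (t \in _); rewrite ?mul0r ?expr0n ?mul0r // mul1r expr2.
rewrite lef_pV2 ?posrE ?psi_gt0 ?mulr_gt0 ?ltr0n //.
by have := Wpsi i j h; rewrite ler_pdivlMr ?ltr0n.
Qed.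

End ObservationWeights.

Section ModelLemmas.
Context {R : realType} {dO : measure_display} {Om : measurableType dO}.
Context {P : probability Om R} {K : nat} {r re : 'I_K -> nat}.
Variables (m : factor_model P r re) (alpha : 'I_K -> nat -> R) (psi0 : R).
Hypotheses (r_gt0 : forall k, (0 < r k)%N) (regime : asymptotic_regime m)
  (O1 : assumption_O1 m psi0) (F1 : assumption_F1 m) (L1 : assumption_L1 m alpha)
  (E1 : assumption_E1 m) (E2 : assumption_E2 m) (R1 : assumption_R1 m alpha).

Lemma l1_bounded_partial (a : nat -> R) : l1_bounded a ->
  exists L, forall N, \sum_(0 <= q < N) `|a q| <= L.
Proof.
move=> [c ac]; exists c => N; rewrite -lee_fin -sumEFin; apply: le_trans ac.
exact: (nneseries_lim_ge N).
Qed.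

Lemma model_lp_bounded : exists L C, [/\ 0 <= C,
  lp_bounded (coef_f m) (innov_f m) (core m) L C,
  lp_bounded (coef_e m) (innov_e m) (core_e m) L C &
  forall n, lp_bounded (coef_eps m) (innov_eps m n) (eps m n) L C].
Proof.
have [linf [indf _ stdf [Cf f4]] _ l1f] := F1.
have [[line lineps] _ [inde stde [Ce e4]] [indeps [Ceps eps4]] [_ _ l1e l1eps]] := E2.
have [Lf LfP] := l1_bounded_partial l1f.
have [Le LeP] := l1_bounded_partial l1e.
have [Leps LepsP] := l1_bounded_partial l1eps.
exists (Num.max Lf (Num.max Le Leps)), (Num.max 0 (Num.max Cf (Num.max Ce Ceps))).
have fle (X : {RV P >-> R}) C C' : fourth_moment_le C X -> C <= C' ->
    fourth_moment_le C' X.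
  by move=> XC CC'; apply: le_trans XC _; rewrite lee_fin.
split; first by rewrite le_max lexx.
- split=> //; last by move=> N; rewrite le_max LfP.
  by move=> p; apply: fle (f4 p) _; rewrite !le_max lexx ?orbT.
- split=> //; last by move=> N; rewrite !le_max LeP orbT.
  by move=> p; apply: fle (e4 p) _; rewrite !le_max lexx ?orbT.
- move=> n; have [ind std] := indeps n; split=> //; first exact: lineps.
    by move=> p; apply: fle (eps4 n p) _; rewrite !le_max lexx ?orbT.
  by move=> N; rewrite !le_max LepsP !orbT.
Qed.

(** A sum of squares of nonnegative numbers is at most the square of their sum, and the total
    absolute load factors into column sums of the A_e. *)
Lemma error_load_bounded (k : 'I_K) : exists2 E0 : R, 0 <= E0 &
  \forall n \near \oo, \sum_i \sum_h (\sum_p `|load (loading_e m n)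
     (on_fibre (k := k) i (fibre h)) p|) ^+ 2 <= E0.
Proof.
have [_ _ _ _ [_ nAe]] := E1.
have [C C0 near_C] : exists2 C : R, 0 < C & \forall n \near \oo,
    forall l, norm1 (loading_e m n l) <= C.
  have Cl l : \forall C \near +oo, \forall n \near \oo, norm1 (loading_e m n l) <= C.
    have /eqO_exP[c c0 near_c] := nAe l.
    exists c; split; first exact: num_real.
    move=> C cC; apply: filterS near_c => n.
    rewrite normr1 mulr1 => h; apply: le_trans (ltW cC); apply: le_trans h.
    exact: ler_norm.
  have := @filter_forall _ _ _ (+oo : set_system R) _ Cl.
  move=> hC; near (+oo : set_system R) => C; exists C; first by near: C; apply: nbhs_pinfty_gt.
  apply: filter_forall; near: C; exact: hC.
pose E := #|{: tidx re}|%:R * C ^+ K.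
exists (E ^+ 2); first exact: sqr_ge0.
apply: filterS near_C => n nC.
have colC l p : \sum_i `|loading_e m n l i p| <= C.
  apply: le_trans (nC l); rewrite /norm1.
  exact: (le_bigmax_cond _ (fun p => \sum_i `|loading_e m n l i p|)).
have sumE : \sum_x \sum_p `|load (loading_e m n) x p| <= E.
  rewrite exchange_big /E mulr_natl -sumr_const /=; apply: ler_sum => p _.
  rewrite sum_load_norm -[K in C ^+ K]card_ord -prodr_const.
  by apply: ler_prod => l _; rewrite sumr_ge0 //= colC.
have sum0 x : 0 <= \sum_p `|load (loading_e m n) x p| by exact: sumr_ge0.
rewrite (sum_on_fibre k (fun x => (\sum_p `|load (loading_e m n) x p|) ^+ 2)).
apply: (@le_trans _ _ ((\sum_x \sum_p `|load (loading_e m n) x p|) ^+ 2)).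
  rewrite expr2 mulr_suml; apply: ler_sum => x _; rewrite expr2 ler_wpM2l //.
  by rewrite (bigD1 x) //= lerDl sumr_ge0.
by rewrite ler_sqr ?nnegrE ?sumr_ge0 // (le_trans _ sumE) ?sumr_ge0.
Unshelve. all: by end_near. Qed.

Lemma dims_gt0 : \forall n \near \oo, (0 < sampleT m n)%N /\ forall l, (0 < dims m n l)%N.
Proof.
have [regT regd] := regime.
have h1 : \forall n \near \oo, (0 < sampleT m n)%N.
  by have := regT _ (nbhs_infty_gt 0%N).
have h2 : \forall n \near \oo, forall l, (0 < dims m n l)%N.
  by apply: filter_forall => l; have := regd l _ (nbhs_infty_gt 0%N).
by apply: filterS2 h1 h2.
Qed.

End ModelLemmas.

(** * Rates of the loadings on an event of high probability *)

Section LoadingEvent.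
Context {R : realType} {dO : measure_display} {Om : measurableType dO}.
Context {P : probability Om R} {K : nat} {r re : 'I_K -> nat}.
Variables (m : factor_model P r re) (alpha : 'I_K -> nat -> R).
Hypothesis L1 : assumption_L1 m alpha.

(** The order of the [j]-th diagonal entry of Z_l; [j] counts from 0, the exponents from 1. *)
Definition rate n (l : 'I_K) (j : 'I_(r l)) : R := dk m n l `^ alpha l j.+1.

Definition gram n (w : Om) (k : 'I_K) : 'M[R]_(r k) :=
  let A := loading_mx m n w k in Zinvhalf A *m A^T *m A *m Zinvhalf A.

Lemma measurable_loading_mx n k : measurable_mx (fun w => loading_mx m n w k).
Proof. by move=> i j; under eq_fun do rewrite mxE; exact: measurable_funP. Qed.

Lemma measurable_gram n k : measurable_mx (fun w => gram n w k).
Proof.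
have mA := @measurable_loading_mx n k.
apply: measurable_mx_mul; last exact: measurable_Zinvhalf.
apply: measurable_mx_mul => //; apply: measurable_mx_mul; last exact: measurable_mx_tr.
exact: measurable_Zinvhalf.
Qed.

Lemma Zdiag_ge0 (p q : nat) (M : 'M[R]_(p, q)) j : 0 <= Zdiag M 0 j.
Proof. by rewrite !mxE; apply: sumr_ge0 => i _; rewrite mxE -expr2 sqr_ge0. Qed.

(** Replaces the random constants of (L1) by a single [c]. The tolerance sig / 2 leaves to the Gram
    matrix half of the coercivity of its limit. *)
Lemma loading_event (k : 'I_K) : exists (S : 'M[R]_(r k)) (sig : R),
  [/\ 0 < sig, forall y : 'cV_(r k), sig * fsq y <= (y^T *m S *m y) 0 0 &
   forall e, 0 < e -> exists2 c : R, 1 <= c & \forall n \near \oo,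
     exists G : set Om, [/\ measurable G, (P (~` G) <= e%:E)%E &
       forall w, G w -> fsq (gram n w k - S) <= (sig / 2) ^+ 2 /\
         forall l (j : 'I_(r l)),
           Zdiag (loading_mx m n w l) 0 j <= c * rate n j /\
           rate n j <= c * Zdiag (loading_mx m n w l) 0 j]].
Proof.
have [_ _ lim_gram rates _] := L1.
have [S [Spos _] gramS] := lim_gram k.
have [sig sig0 Scoer] := posdef_coercive Spos.
exists S, sig; split=> // e e0.
pose Qz (c n : nat) (x : {l : 'I_K & 'I_(r l)}) : set Om :=
  [set w | Zdiag (loading_mx m n w (tag x)) 0 (tagged x) <= c%:R * rate n (tagged x)] `&`
  [set w | rate n (tagged x) <= c%:R * Zdiag (loading_mx m n w (tag x)) 0 (tagged x)].
pose Q (c n : nat) : set Om :=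
  [set w | fsq (gram n w k - S) <= (sig / 2) ^+ 2] `&`
  \bigcap_(x in [set: {l : 'I_K & 'I_(r l)}]) Qz c n x.
have mQ c n : measurable (Q c n).
  apply: measurableI.
    rewrite -[X in measurable X]setTI; apply: measurable_fun_ler => //.
    apply: measurable_fsq => i j; apply: measurable_mxB; first exact: measurable_gram.
    by move=> i' j'; exact: measurable_cst.
  apply: fin_bigcap_measurable; first exact: finite_finset.
  move=> x _; have mZ := measurable_Zdiag (tagged x) (@measurable_loading_mx n (tag x)).
  apply: measurableI; rewrite -[X in measurable X]setTI; apply: measurable_fun_ler => //.
  exact: measurable_funM.
have rate_ge0 n l (j : 'I_(r l)) : 0 <= rate n j by exact: powR_ge0.
have Qmono c c' n : (c <= c')%N -> Q c n `<=` Q c' n.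
  move=> cc' w [w1 w2]; split=> // x _; have [h1 h2] := w2 x I; split=> /=.
    by apply: le_trans h1 _; rewrite ler_wpM2r // ler_nat.
  by apply: le_trans h2 _; rewrite ler_wpM2r ?Zdiag_ge0 // ler_nat.
have aeQ : {ae P, forall w, exists c, forall n, (c <= n)%N -> Q c n w}.
  have aer : {ae P, forall w, forall l, forall j : 'I_(r l),
      let z := fun n => Zdiag (loading_mx m n w l) 0 j : R^o in
      let v := fun n => dk m n l `^ alpha l j.+1 : R^o in
      z =O_\oo v /\ v =O_\oo z}.
    by apply: filter_forall => l; apply: filter_forall => j; exact: rates.
  apply: filterS2 aer gramS => w wr wg.
  have nearz (x : {l : 'I_K & 'I_(r l)}) : \forall c \near \oo, forall n, (c <= n)%N -> Qz c n x w.
    have [/eqO_exP[c1 c10 h1] /eqO_exP[c2 c20 h2]] := wr (tag x) (tagged x).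
    have [N1 _ hN1] := h1; have [N2 _ hN2] := h2.
    near=> c => n cn; split=> /=.
      have := hN1 n; rewrite /= ger0_norm ?Zdiag_ge0 // ger0_norm ?powR_ge0 // => h.
      apply: le_trans (h _) _.
        by apply: leq_trans cn; near: c; exact: nbhs_infty_ge.
      rewrite ler_wpM2r ?powR_ge0 //; near: c; exact: nbhs_infty_ger.
    have := hN2 n; rewrite /= ger0_norm ?powR_ge0 // ger0_norm ?Zdiag_ge0 // => h.
    apply: le_trans (h _) _.
      by apply: leq_trans cn; near: c; exact: nbhs_infty_ge.
    rewrite ler_wpM2r ?Zdiag_ge0 //; near: c; exact: nbhs_infty_ger.
  have nearg : \forall n \near \oo, fsq (gram n w k - S) <= (sig / 2) ^+ 2.
    have h : fsq (gram n w k - S) @[n --> \oo] --> (0 : R).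
      rewrite (_ : 0 = \sum_(i < r k) \sum_(j < r k) (S i j - S i j) ^+ 2); last first.
        by rewrite big1 // => i _; rewrite big1 // => j _; rewrite subrr expr0n.
      apply: cvg_big => [z|i _]; first exact: add_continuous.
      apply: cvg_big => [z|j _]; first exact: add_continuous.
      rewrite (_ : (fun n => _) = fun n => (gram n w k i j - S i j) ^+ 2); last first.
        by apply/funext => n; rewrite mxE [X in _ + X]mxE.
      apply: (@cvg_comp _ _ _ _ (fun x : R => x ^+ 2)); last exact: exprn_continuous.
      by apply: cvgB; [exact: wg|exact: cvg_cst].
    have s0 : 0 < (sig / 2) ^+ 2 by rewrite exprn_gt0 // divr_gt0.
    move/cvgr0Pnorm_le : h => /(_ _ s0); apply: filterS => n; apply: le_trans; exact: ler_norm.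
  have [N _ hN] := nearg.
  have := @filter_forall _ _ _ (\oo : set_system nat) _ nearz => nearz'.
  near \oo => c; exists c => n cn; split.
    by apply: hN; apply: leq_trans cn; near: c; exact: nbhs_infty_ge.
  have h : forall x, forall n, (c <= n)%N -> Qz c n x w by near: c; exact: nearz'.
  by move=> x _; exact: (h x n cn).
have [c [G [mG PG GQ]]] := ae_uniform e0 mQ Qmono aeQ.
exists (Num.max 1 c%:R); first by rewrite le_max lexx.
exists c => // n /= cn; exists G; split=> // w Gw.
have [h1 h2] := GQ w n Gw cn; split=> // l j.
have [h3 h4] := h2 (Tagged (fun l => 'I_(r l)) j) I; split.
  by apply: le_trans h3 _; rewrite ler_wpM2r // le_max lexx orbT.
by apply: le_trans h4 _; rewrite ler_wpM2r ?Zdiag_ge0 // le_max lexx orbT.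
Unshelve. all: by end_near. Qed.

End LoadingEvent.

(** With D = p q^2 + p^2 q tau, every term is at most a constant times p q, p^2 q tau, 1 or D
    itself, and p, q >= 1 makes all of these at most D. The hypotheses on [U] and [S] come from g_s
    <= d = p q. *)
Lemma noise_rate (R : realFieldType) (U V S Bc N tau Cs p q a b : R) :
  0 <= U -> 0 <= V -> 0 <= S -> 0 <= Bc -> 0 <= N -> 0 <= tau -> 1 <= p -> 1 <= q ->
  U <= a * (p * q) -> S <= a * (p * q) -> V <= b ->
  16 * (U * V * Bc + p * (N * (Bc * tau * Cs ^+ 2 * S)) + V * V * Bc
    + 2 * (V * (p * q * Cs ^+ 2) * Bc) + Bc * Cs ^+ 4 * (p * q ^+ 2 + p ^+ 2 * (q * tau)))
  <= 16 * Bc * (a * b + N * Cs ^+ 2 * a + b ^+ 2 + 2 * b * Cs ^+ 2 + Cs ^+ 4)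
     * (p * q ^+ 2 + p ^+ 2 * (q * tau)).
Proof.
move=> U0 V0 S0 B0 N0 t0 p1 q1 Ua Sa Vb.
have p0 : 0 <= p := le_trans ler01 p1; have q0 : 0 <= q := le_trans ler01 q1.
have b0 : 0 <= b := le_trans V0 Vb.
set D := p * q ^+ 2 + p ^+ 2 * (q * tau).
have D2 : p ^+ 2 * (q * tau) <= D by rewrite lerDr mulr_ge0 // sqr_ge0.
have pqD : p * q <= D.
  rewrite (@le_trans _ _ (p * q ^+ 2)) ?lerDl ?mulr_ge0 ?sqr_ge0 //.
  by rewrite ler_wpM2l // expr2 ler_peMl.
have D1 : 1 <= D by apply: le_trans pqD; rewrite mulr_ege1.
have a0 : 0 <= a.
  have : 0 <= a * (p * q) := le_trans S0 Sa.
  by rewrite pmulr_lge0 // mulr_gt0 // (lt_le_trans ltr01).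
have C0 : 0 <= Cs ^+ 2 := sqr_ge0 Cs.
have h1 : U * V * Bc <= a * b * Bc * D.
  apply: (@le_trans _ _ (a * (p * q) * b * Bc)); first by rewrite ler_wpM2r // ler_pM.
  rewrite [leLHS](_ : _ = a * b * Bc * (p * q)); last by ring.
  by rewrite ler_wpM2l //; do ![apply: mulr_ge0 => //].
have h2 : p * (N * (Bc * tau * Cs ^+ 2 * S)) <= N * Cs ^+ 2 * a * Bc * D.
  apply: (@le_trans _ _ (p * (N * (Bc * tau * Cs ^+ 2 * (a * (p * q)))))).
    apply: ler_wpM2l => //; apply: ler_wpM2l => //; apply: ler_wpM2l => //.
    by apply: mulr_ge0 => //; apply: mulr_ge0.
  rewrite [leLHS](_ : _ = N * Cs ^+ 2 * a * Bc * (p ^+ 2 * (q * tau))); last by ring.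
  by rewrite ler_wpM2l //; do ![apply: mulr_ge0 => //].
have h3 : V * V * Bc <= b ^+ 2 * Bc * D.
  apply: (@le_trans _ _ (b ^+ 2 * Bc)); first by rewrite ler_wpM2r // expr2 ler_pM.
  by rewrite ler_peMr // mulr_ge0 // sqr_ge0.
have h4 : V * (p * q * Cs ^+ 2) * Bc <= b * Cs ^+ 2 * Bc * D.
  apply: (@le_trans _ _ (b * (p * q * Cs ^+ 2) * Bc)).
    apply: ler_wpM2r => //; apply: ler_wpM2r => //.
    by do ![apply: mulr_ge0 => //].
  rewrite [leLHS](_ : _ = b * Cs ^+ 2 * Bc * (p * q)); last by ring.
  by rewrite ler_wpM2l //; do ![apply: mulr_ge0 => //].
have -> : 16 * Bc * (a * b + N * Cs ^+ 2 * a + b ^+ 2 + 2 * b * Cs ^+ 2 + Cs ^+ 4) * D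
  = 16 * (a * b * Bc * D + N * Cs ^+ 2 * a * Bc * D + b ^+ 2 * Bc * D
    + 2 * (b * Cs ^+ 2 * Bc * D) + Bc * Cs ^+ 4 * D) by ring.
by move: h1 h2 h3 h4; lra.
Qed.

(** * Noise and sampling error with high probability *)

Section KeyEvent.
Context {R : realType} {dO : measure_display} {Om : measurableType dO}.
Context {P : probability Om R} {K : nat} {r re : 'I_K -> nat}.
Variables (m : factor_model P r re) (alpha : 'I_K -> nat -> R) (psi0 : R).
Hypotheses (r_gt0 : forall k, (0 < r k)%N) (regime : asymptotic_regime m)
  (O1 : assumption_O1 m psi0) (F1 : assumption_F1 m) (L1 : assumption_L1 m alpha)
  (E1 : assumption_E1 m) (E2 : assumption_E2 m).
Variable k : 'I_K.

(* The loadings and the mask are read at [w], the factors and the errors at [w']; the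
   model is the diagonal [w = w'], and independence allows the two to be decoupled. *)
Definition signal n (w w' : Om) (t : 'I_(sampleT m n)) : 'M[R]_(dims m n k, nfib (dims m n) k) :=
  common (loading_mx m n w) (core_at w') k t.

Definition response n (w w' : Om) (t : 'I_(sampleT m n)) :
    'M[R]_(dims m n k, nfib (dims m n) k) :=
  unfold k (fun i => tucker (loading_mx m n w) (core_at w' t) i
                     + err m n (obs_time t) i w').

(* The conditional expectation of the averaged signals given loadings and mask. *)
Definition signal_mean n (w : Om) : 'M[R]_(dims m n k) :=
  let A := loading_mx m n w in fsq (kron_but A k) *: (A k *m (A k)^T).

Definition noise_sq n (z : Om * Om) : R :=
  fsq (wprod (obs_weight (mask_at z.1) (k := k))
         (@response n z.1 z.2) (@response n z.1 z.2)
       - wprod (obs_weight (mask_at z.1) (k := k))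
         (@signal n z.1 z.2) (@signal n z.1 z.2)).

Definition sampling_sq n (z : Om * Om) : R :=
  fsq (wprod (obs_weight (mask_at z.1) (k := k))
         (@signal n z.1 z.2) (@signal n z.1 z.2) - signal_mean n z.1).

Definition full_sampling_sq n (z : Om * Om) : R :=
  fsq (wprod (fun _ _ _ _ => (sampleT m n)%:R^-1)
         (@signal n z.1 z.2) (@signal n z.1 z.2) - signal_mean n z.1).

(** The whole mask of a stage as a point of a finite type, as [measurable_finite_dep] requires. *)
Definition mask_pattern n (w : Om) : {ffun 'I_(sampleT m n) * tidx (dims m n) -> bool} :=
  [ffun ti => observed m n ti.1 ti.2 w].

Lemma mask_at_pattern n (w : Om) :
  mask_at w = (fun (t : 'I_(sampleT m n)) i => mask_pattern n w (t, i)).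
Proof. by apply/funext => t; apply/funext => i; rewrite ffunE. Qed.

Lemma measurable_mask_pattern n d (S : measurableType d) (f : S -> Om) x :
  (forall t i, measurable_fun setT (fun s => observed m n t i (f s))) ->
  measurable [set s | mask_pattern n (f s) = x].
Proof.
move=> mo; rewrite (_ : [set s | _] =
    \bigcap_(ti in [set: 'I_(sampleT m n) * tidx (dims m n)])
    [set s | observed m n ti.1 ti.2 (f s) = x ti]); last first.
  apply/seteqP; split=> s /=; first by move=> <- ti _ /=; rewrite ffunE.
  by move=> h; apply/ffunP => ti; rewrite ffunE; exact: (h ti I).
apply: fin_bigcap_measurable; first exact: finite_finset.
by move=> ti _; have := mo ti.1 ti.2 measurableT [set x ti] I; rewrite setTI.
Qed.

Lemma gs_le_dtot n : (forall l, (0 < dims m n l)%N) -> gs m alpha n <= dtot m n.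
Proof.
move=> d_gt0; apply: ler_prod => l _; rewrite powR_ge0 /=.
have [_ _ _ _ /(_ l) [_ _ a1]] := L1.
have dk1 : 1 <= dk m n l by rewrite ler1n.
rewrite -[leRHS]powRr1; last by rewrite (le_trans ler01).
by apply: ler_powR.
Qed.

Section Stage.
Variable n : nat.
(** Generators of the two joined sigma-fields whose independence is asserted in (O1). *)
Let H1 := sigma_loading m n `|` sigma_mask m n.
Let times : set int := [set s | exists t : 'I_(sampleT m n), s = obs_time t].
Let H2 := sigma_of [set p : int * tidx r | times p.1] (fun p => core m p.1 p.2) `|`
  sigma_of [set p : int * tidx (dims m n) | times p.1] (fun p => err m n p.1 p.2).

Let mH1 : H1 `<=` measurable.
Proof. by move=> A [|]; exact: sigma_of_measurable. Qed.
Let mH2 : H2 `<=` measurable.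
Proof. by move=> A [|]; exact: sigma_of_measurable. Qed.
Let indepH : independent_fields P <<s H1 >> <<s H2 >>.
Proof. by case: O1 => ind _ _; exact: ind. Qed.

Notation S1 := (g_sigma_algebraType H1).
Notation S2 := (g_sigma_algebraType H2).

(** Decoupling takes place on the product of the two sub-sigma-fields, so measurability is checked
    there: loadings and mask in the first coordinate, core and errors at the observed times in the
    second. *)
Let m_loading l : measurable_mx (fun z : S1 * S2 => loading_mx m n z.1 l).
Proof.
move=> i j; under eq_fun do rewrite mxE.
apply: (measurableT_comp (f := (loading m n l i j : S1 -> R))) => //.
apply: measurable_fun_g_sigma => A hA; left.
exact: (sub_sigma_of (X := fun p : {l : 'I_K & ('I_(dims m n l) * 'I_(r l))%type} =>
  loading m n (tag p) (tagged p).1 (tagged p).2)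
  (i := Tagged (fun l => ('I_(dims m n l) * 'I_(r l))%type) (i, j)) I hA).
Qed.

Let m_core t i : measurable_fun setT (fun z : S1 * S2 => core_at (m := m) (n := n) z.2 t i).
Proof.
apply: (measurableT_comp (f := (core m (obs_time t) i : S2 -> R))) => //.
apply: measurable_fun_g_sigma => A hA; left.
apply: (sub_sigma_of (X := fun p : int * tidx r => core m p.1 p.2)
  (i := (obs_time t, i)) _ hA).
by exists t.
Qed.

Let m_err t i : measurable_fun setT
  (fun z : S1 * S2 => err m n (@obs_time (sampleT m n) t) i z.2).
Proof.
apply: (measurableT_comp (f := (err m n (obs_time t) i : S2 -> R))) => //.
apply: measurable_fun_g_sigma => A hA; right.
apply: (sub_sigma_of (X := fun p : int * tidx (dims m n) => err m n p.1 p.2)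
  (i := (obs_time t, i)) _ hA).
by exists t.
Qed.

Let m_pattern x : measurable [set z : S1 * S2 | mask_pattern n z.1 = x].
Proof.
apply: measurable_mask_pattern => t i.
apply: (measurableT_comp (f := (observed m n t i : S1 -> bool))) => //.
apply: measurable_fun_g_sigma => A hA; right.
exact: (sub_sigma_of (X := fun p : 'I_(sampleT m n) * tidx (dims m n) =>
  observed m n p.1 p.2) (i := (t, i)) I hA).
Qed.

Let m_signal t : measurable_mx (fun z : S1 * S2 => @signal n z.1 z.2 t).
Proof. exact: (measurable_common m_loading m_core). Qed.

Let m_response t : measurable_mx (fun z : S1 * S2 => @response n z.1 z.2 t).
Proof.
apply: measurable_unfold => i; apply: measurable_funD => //.
exact: (measurable_tucker _ m_loading (m_core t)).
Qed.

Let m_mean : measurable_mx (fun z : S1 * S2 => signal_mean n z.1).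
Proof.
apply: measurable_mxZ.
  apply: measurable_fsq.
  exact: (measurable_kron_but (B := fun (z : S1 * S2) l => loading_mx m n z.1 l) m_loading).
by apply: measurable_mx_mul => //; exact: measurable_mx_tr.
Qed.

Lemma measurable_noise_sq : measurable_fun setT (fun z : S1 * S2 => noise_sq n z).
Proof.
pose G (x : {ffun 'I_(sampleT m n) * tidx (dims m n) -> bool}) (z : S1 * S2) : R :=
  fsq (wprod (obs_weight (fun t i => x (t, i)) (k := k))
         (@response n z.1 z.2) (@response n z.1 z.2)
       - wprod (obs_weight (fun t i => x (t, i)) (k := k))
         (@signal n z.1 z.2) (@signal n z.1 z.2)).
rewrite (_ : (fun z => _) = fun z => G (mask_pattern n z.1) z); last first.
  by apply/funext => z; rewrite /noise_sq mask_at_pattern.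
apply: measurable_finite_dep => // x; apply: measurable_fsq.
apply: measurable_mxB.
  exact: (measurable_wprod (X := fun z : S1 * S2 => @response n z.1 z.2)
    (Z := fun z : S1 * S2 => @response n z.1 z.2) _ m_response m_response).
exact: (measurable_wprod (X := fun z : S1 * S2 => @signal n z.1 z.2)
    (Z := fun z : S1 * S2 => @signal n z.1 z.2) _ m_signal m_signal).
Qed.

Lemma measurable_sampling_sq : measurable_fun setT (fun z : S1 * S2 => sampling_sq n z).
Proof.
pose G (x : {ffun 'I_(sampleT m n) * tidx (dims m n) -> bool}) (z : S1 * S2) : R :=
  fsq (wprod (obs_weight (fun t i => x (t, i)) (k := k))
         (@signal n z.1 z.2) (@signal n z.1 z.2) - signal_mean n z.1).
rewrite (_ : (fun z => _) = fun z => G (mask_pattern n z.1) z); last first.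
  by apply/funext => z; rewrite /sampling_sq mask_at_pattern.
apply: measurable_finite_dep => // x; apply: measurable_fsq.
apply: measurable_mxB => //.
exact: (measurable_wprod (X := fun z : S1 * S2 => @signal n z.1 z.2)
    (Z := fun z : S1 * S2 => @signal n z.1 z.2) _ m_signal m_signal).
Qed.

Lemma measurable_full_sampling_sq :
  measurable_fun setT (fun z : S1 * S2 => full_sampling_sq n z).
Proof.
apply: measurable_fsq; apply: measurable_mxB => //.
exact: (measurable_wprod (X := fun z : S1 * S2 => @signal n z.1 z.2)
    (Z := fun z : S1 * S2 => @signal n z.1 z.2) _ m_signal m_signal).
Qed.

Lemma stage_tail (g : S1 * S2 -> R) (G : set Om) (B e : R) :
  measurable_fun setT g -> (forall z, 0 <= g z) -> measurable G -> 0 < B -> 0 < e ->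
  (P (~` G) <= e%:E)%E -> (forall w, G w -> \int[P]_w' (g (w, w'))%:E <= B%:E)%E ->
  exists G' : set Om, [/\ measurable G', (P (~` G') <= (e + e)%:E)%E &
    forall w, G' w -> g (w, w) <= B / e].
Proof.
move=> mg g0 mG B0 e0 PG GB.
exact: (tail_decouple mH1 mH2 indepH mg g0 mG B0 e0 PG GB).
Qed.

Section Bounds.
Variables (L C E0 Cs c e : R).
Let p : R := (dims m n k)%:R.
Let q : R := (nfib (dims m n) k)%:R.
Let T : R := (sampleT m n)%:R.
Let g : R := gs m alpha n.
Let N : R := #|{: tidx r}|%:R.
Let Bc := (L * L) ^+ 2 * (2 * (C + 1)).
(** N c^K bounds [Sa] relative to g_s, and a factor N passes from l2 to l1 over the core; N + 1 in
    its place makes [a] an upper bound for both. *)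
Let a := (N + 1) * (N * c ^+ K).
(** kap / T bounds the sum of squared weights both for the mask and for the constant weights 1/T. *)
Let kap := Num.max 1 psi0^-1.
Let K1 := 16 * Bc * (a * E0 + N * Cs ^+ 2 * a + E0 ^+ 2 + 2 * E0 * Cs ^+ 2 + Cs ^+ 4) * kap.
Let K2 := a ^+ 2 * Bc * kap.

Hypotheses (C_ge0 : 0 <= C) (E0_ge0 : 0 <= E0) (c_ge1 : 1 <= c) (e_gt0 : 0 < e)
  (lpF : lp_bounded (coef_f m) (innov_f m) (core m) L C)
  (lpE : lp_bounded (coef_e m) (innov_e m) (core_e m) L C)
  (lpeps : lp_bounded (coef_eps m) (innov_eps m n) (eps m n) L C)
  (error_load : \sum_i \sum_h (\sum_p `|load (loading_e m n)
     (on_fibre (k := k) i (fibre h)) p|) ^+ 2 <= E0)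
  (sd_le : forall i, 0 <= sd_eps m n i <= Cs)
  (T_gt0 : (0 < sampleT m n)%N) (d_gt0 : forall l, (0 < dims m n l)%N).

Let p_ge1 : 1 <= p. Proof. by rewrite ler1n. Qed.
Let T_gt0' : 0 < T. Proof. by rewrite ltr0n. Qed.
Let pq : p * q = dtot m n. Proof. by rewrite /p /q nfib_prod. Qed.
Let q_ge1 : 1 <= q.
Proof.
have h : 0 < p * q by rewrite pq; apply: prodr_gt0 => l _; rewrite ltr0n.
have p0 : 0 < p := lt_le_trans ltr01 p_ge1.
by move: h; rewrite pmulr_rgt0 // /q ltr0n ler1n.
Qed.
Let dk_ge1 l : 1 <= dk m n l. Proof. by rewrite ler1n. Qed.
Let g_gt0 : 0 < g.
Proof. by apply: prodr_gt0 => l _; rewrite powR_gt0 // ltr0n. Qed.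
Let g_le : g <= p * q. Proof. by rewrite pq; exact: gs_le_dtot. Qed.
Let N_ge0 : 0 <= N. Proof. by []. Qed.
Let kap_ge1 : 1 <= kap. Proof. by rewrite le_max lexx. Qed.
Let Bc_ge0 : 0 <= Bc.
Proof. by rewrite mulr_ge0 ?sqr_ge0 //; move: C_ge0; lra. Qed.
Let a0 : 0 <= N * c ^+ K.
Proof. by rewrite mulr_ge0 // exprn_ge0 // (le_trans ler01). Qed.
Let a_ge0 : 0 <= a. Proof. by rewrite mulr_ge0 // addr_ge0. Qed.
Let psi0_gt0 : 0 < psi0. Proof. by case: O1. Qed.

Section Realization.
Variable w : Om.
Hypothesis rates_w : forall l (j : 'I_(r l)),
  Zdiag (loading_mx m n w l) 0 j <= c * rate m alpha n j /\
  rate m alpha n j <= c * Zdiag (loading_mx m n w l) 0 j.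

Let rate_gt0 l (j : 'I_(r l)) : 0 < rate m alpha n j.
Proof. by rewrite powR_gt0 // ltr0n. Qed.

Lemma rate_le_gs l (j : 'I_(r l)) : rate m alpha n j <= dk m n l `^ alpha l 1.
Proof.
have [_ _ _ _ /(_ l) [_ amono _]] := L1.
by apply: ler_powR => //; apply: amono.
Qed.

Let Sa := \sum_x \sum_(mm : tidx r) load (loading_mx m n w) x mm ^+ 2.
Let U := \sum_i \sum_h (\sum_(mm : tidx r)
  `|load (loading_mx m n w) (on_fibre (k := k) i (fibre h)) mm|) ^+ 2.

Let Sa_ge0 : 0 <= Sa.
Proof. by apply: sumr_ge0 => x _; apply: sumr_ge0 => mm _; exact: sqr_ge0. Qed.

Lemma load_sq_le : Sa <= N * c ^+ K * g.
Proof.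
rewrite -mulrA; apply: (good_load_le (v := fun l j => rate m alpha n j)
  (g := fun l => dk m n l `^ alpha l 1) c_ge1) => //.
- by move=> l j; exact: rate_le_gs.
- by move=> l j; case: (rates_w j).
- by move=> l j; case: (rates_w j).
Qed.

Lemma load_abs_le : U <= a * g.
Proof.
apply: (@le_trans _ _ (N * Sa)).
  rewrite /U (sum_on_fibre k (fun x => (\sum_(mm : tidx r)
    `|load (loading_mx m n w) x mm|) ^+ 2)) /Sa mulr_sumr.
  apply: ler_sum => x _; rewrite /N -sum1_card natr_sum.
  apply: sum_sqr_le => // mm; rewrite ?sqr_ge0 //.
  by rewrite mul1r real_normK ?num_real.
rewrite /a; apply: (@le_trans _ _ ((N + 1) * Sa)).
  by apply: ler_wpM2r => //; lra.
by rewrite -!mulrA ler_wpM2l ?addr_ge0 // mulrA load_sq_le.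
Qed.

Let U_ge0 : 0 <= U.
Proof. by apply: sumr_ge0 => i _; apply: sumr_ge0 => h _; rewrite sqr_ge0. Qed.

Variables (v : 'I_(dims m n k) -> 'I_(dims m n k) -> 'I_(nfib (dims m n) k) ->
  'I_(sampleT m n) -> R).
Hypotheses (v_ge0 : forall i j h t, 0 <= v i j h t)
  (v_sum : forall i j h, \sum_t v i j h t = 1)
  (v_sqr : forall i j h, \sum_t v i j h t ^+ 2 <= kap / T)
  (vC : forall i j h t, v i j h t = v j i h t).

Let tau_ge0 : 0 <= kap / T.
Proof. by rewrite divr_ge0 ?(ltW T_gt0') // (le_trans ler01). Qed.

(** The weights are arbitrary so that masked and full averages are both covered. The [+ 1] keeps the
    bound positive, as Markov's inequality requires. *)
Lemma sampling_mean_le :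
  (\int[P]_w' (fsq (wprod v (@signal n w w') (@signal n w w') - signal_mean n w))%:E
     <= ((K2 + 1) * (g ^+ 2 / T))%:E)%E.
Proof.
have [_ _ af2 _] := F1.
have [_ h] := common_fluctuation_le lpF af2 (loading_mx m n w) C_ge0 tau_ge0
  v_sum v_sqr.
apply: le_trans h _; rewrite lee_fin -/U.
apply: (@le_trans _ _ ((a * g) ^+ 2 * (Bc * (kap / T)))).
  apply: ler_wpM2r; first by rewrite mulr_ge0.
  rewrite ler_sqr ?nnegrE; [exact: load_abs_le|exact: U_ge0|].
  by rewrite mulr_ge0 // ltW.
rewrite [leLHS](_ : _ = K2 * (g ^+ 2 / T)); last by rewrite /K2; ring.
by rewrite ler_wpM2r ?lerDl // divr_ge0 ?sqr_ge0 // ltW.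
Qed.

Lemma noise_mean_le :
  (\int[P]_w' (fsq (wprod v (@response n w w') (@response n w w')
      - wprod v (@signal n w w') (@signal n w w')))%:E
     <= ((K1 + 1) * (p * q ^+ 2 + p ^+ 2 * (q / T)))%:E)%E.
Proof.
have [_ indE2 _ _ _] := E2.
have [_ indFe] := indE2 n.
pose Xf := fun z : int * tidx r => innov_f m z.1 z.2.
pose Xe := fun z : int * tidx re => innov_e m z.1 z.2.
pose Xeps := fun z : int * tidx (dims m n) => innov_eps m n z.1 z.2.
pose HF := \bigcup_(i in setT) preimage_set_system setT (Xf i) measurable.
(* (E2) makes the factor innovations independent of the join of both error innovations; the
   idiosyncratic ones are measurable for that join. *)
pose HE := sigma_of setT Xe `|` sigma_of setT Xeps.
have mHF : HF `<=` measurable.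
  by move=> A [i _ [B mB <-]]; exact: (measurable_funPT (Xf i)).
have mHE : HE `<=` measurable by move=> A [|]; exact: sigma_of_measurable.
have XH z : preimage_set_system setT (innov_f m z.1 z.2) measurable `<=` HF.
  by move=> A hA; exists z.
have YH z : preimage_set_system setT (innov_eps m n z.1 z.2) measurable `<=` HE.
  by move=> A hA; right; exact: (sub_sigma_of (X := Xeps) (i := z) I hA).
have [_ h] := error_le (k := k) lpF lpE lpeps indFe mHF mHE XH YH (loading_mx m n w)
  (loading_e m n) sd_le C_ge0 tau_ge0 v_ge0 v_sum v_sqr vC.
have respE w' : @response n w w' = (fun t =>
    common_part k (core m) (loading_mx m n w) w' t +
    (error_factor_part k (core_e m) (loading_e m n) w' t +
     idiosyncratic_part k (eps m n) (sd_eps m n) w' t)).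
  apply/funext => t; apply/matrixP => i h'; rewrite !mxE.
  by have [-> _ _ _ _] := E1.
have -> : (\int[P]_w' (fsq (wprod v (@response n w w') (@response n w w')
      - wprod v (@signal n w w') (@signal n w w')))%:E)%E =
  (\int[P]_w' (fsq (wprod v
    (fun t => common_part k (core m) (loading_mx m n w) w' t +
     (error_factor_part k (core_e m) (loading_e m n) w' t +
      idiosyncratic_part k (eps m n) (sd_eps m n) w' t))
    (fun t => common_part k (core m) (loading_mx m n w) w' t +
     (error_factor_part k (core_e m) (loading_e m n) w' t +
      idiosyncratic_part k (eps m n) (sd_eps m n) w' t)) -
    wprod v (common_part k (core m) (loading_mx m n w) w')
      (common_part k (core m) (loading_mx m n w) w')))%:E)%E.
  by apply: eq_integral => w' _; rewrite respE.
apply: (le_trans h); rewrite lee_fin.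
have g_le' : a * g <= a * (p * q) by rewrite ler_wpM2l.
have Vb := error_load.
apply: (le_trans (noise_rate Cs U_ge0 _ Sa_ge0 Bc_ge0 N_ge0 tau_ge0 p_ge1 q_ge1
  (le_trans load_abs_le g_le') _ Vb)).
- by apply: sumr_ge0 => i _; apply: sumr_ge0 => h' _; exact: sqr_ge0.
- apply: le_trans load_sq_le _; apply: le_trans g_le'; apply: ler_wpM2r; first exact: ltW.
  by rewrite /a ler_peMl // lerDr.
have Kpos : 0 <= 16 * Bc * (a * E0 + N * Cs ^+ 2 * a + E0 ^+ 2 + 2 * E0 * Cs ^+ 2 + Cs ^+ 4).
  have C2 : 0 <= Cs ^+ 2 := sqr_ge0 Cs.
  have C4 : 0 <= Cs ^+ 4 by rewrite (exprM Cs 2 2) sqr_ge0.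
  have E2' : 0 <= E0 ^+ 2 := sqr_ge0 E0.
  apply: mulr_ge0; first by apply: mulr_ge0.
  by do ![apply: addr_ge0 => //]; do ![apply: mulr_ge0 => //].
have q0 : 0 <= q := le_trans ler01 q_ge1.
have p0 : 0 <= p := le_trans ler01 p_ge1.
have D0 : 0 <= p * q ^+ 2 + p ^+ 2 * (q / T).
  by rewrite addr_ge0 ?mulr_ge0 ?sqr_ge0 // invr_ge0 ltW.
apply: (@le_trans _ _ (K1 * (p * q ^+ 2 + p ^+ 2 * (q / T)))); last first.
  by rewrite ler_wpM2r // lerDl.
rewrite /K1 -[leRHS]mulrA; apply: ler_wpM2l => //.
rewrite [leRHS]mulrDr; apply: lerD; first by rewrite ler_peMl // mulr_ge0 // sqr_ge0.
by rewrite le_eqVlt; apply/orP; left; apply/eqP; ring.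
Qed.

End Realization.

(** The complement of [G] costs [e], and each of the three decouplings costs 2 e, one [e] for its
    event and one for Markov's inequality. *)
Lemma stage_event (G : set Om) : measurable G -> (P (~` G) <= e%:E)%E ->
  (forall w, G w ->
    (forall l (j : 'I_(r l)), Zdiag (loading_mx m n w l) 0 j <= c * rate m alpha n j /\
       rate m alpha n j <= c * Zdiag (loading_mx m n w l) 0 j) /\
    (forall i j h, psi0 <= observed_ratio (m := m) (n := n) (k := k) w i j h)) ->
  exists G' : set Om, [/\ measurable G', (P (~` G') <= (7 * e)%:E)%E &
    forall w, G' w -> [/\ G w,
      noise_sq n (w, w) <= (K1 + 1) * (p * q ^+ 2 + p ^+ 2 * (q / T)) / e,
      sampling_sq n (w, w) <= (K2 + 1) * (g ^+ 2 / T) / e &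
      full_sampling_sq n (w, w) <= (K2 + 1) * (g ^+ 2 / T) / e]].
Proof.
move=> mG PG Gw.
have kap0 : 0 <= kap := le_trans ler01 kap_ge1.
have K2_ge0 : 0 <= K2.
  by apply: mulr_ge0 => //; apply: mulr_ge0 => //; exact: sqr_ge0.
have K1_ge0 : 0 <= K1.
  have C2 : 0 <= Cs ^+ 2 := sqr_ge0 Cs.
  have C4 : 0 <= Cs ^+ 4 by rewrite (exprM Cs 2 2) sqr_ge0.
  have E2' : 0 <= E0 ^+ 2 := sqr_ge0 E0.
  apply: mulr_ge0; last by rewrite (le_trans ler01).
  apply: mulr_ge0; first by apply: mulr_ge0.
  by do ![apply: addr_ge0 => //]; do ![apply: mulr_ge0 => //].
have q0 : 0 < q := lt_le_trans ltr01 q_ge1.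
have p0 : 0 < p := lt_le_trans ltr01 p_ge1.
have B1 : 0 < (K1 + 1) * (p * q ^+ 2 + p ^+ 2 * (q / T)).
  apply: mulr_gt0; first by rewrite ltr_wpDl.
  by apply: addr_gt0; rewrite mulr_gt0 ?exprn_gt0 ?divr_gt0.
have B2 : 0 < (K2 + 1) * (g ^+ 2 / T).
  by apply: mulr_gt0; [rewrite ltr_wpDl|rewrite divr_gt0 // exprn_gt0].
have sqr_kap (i j : 'I_(dims m n k)) h w : G w ->
    \sum_t obs_weight (mask_at w) i j h t ^+ 2 <= kap / T.
  move=> /Gw[_ psiw]; apply: (le_trans (obs_weight_sqr T_gt0 psi0_gt0 psiw i j h)).
  rewrite invfM ler_wpM2r ?invr_ge0 ?(ltW T_gt0') //.
  by rewrite le_max lexx orbT.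
have w_ge0 (i j : 'I_(dims m n k)) h t w : 0 <= obs_weight (mask_at w) i j h t :> R.
  exact: obs_weight_ge0.
have wC (i j : 'I_(dims m n k)) h t w :
  obs_weight (mask_at w) i j h t = obs_weight (mask_at w) j i h t :> R.
  exact: obs_weightC.
have w_sum (i j : 'I_(dims m n k)) h w : G w -> \sum_t obs_weight (mask_at w) i j h t = 1 :> R.
  by move=> /Gw[_ psiw]; exact: (obs_weight_sum T_gt0 psi0_gt0 psiw i j h).
have [G1 [mG1 PG1 G1w]] := stage_tail measurable_noise_sq (fun z => fsq_ge0 _) mG B1 e_gt0 PG
  (fun w gw => noise_mean_le (proj1 (Gw w gw)) (fun i j h t => w_ge0 i j h t w)
    (fun i j h => w_sum i j h w gw)
    (fun i j h => sqr_kap i j h w gw) (fun i j h t => wC i j h t w)).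
have [G2 [mG2 PG2 G2w]] := stage_tail measurable_sampling_sq (fun z => fsq_ge0 _) mG B2 e_gt0 PG
  (fun w gw => sampling_mean_le (proj1 (Gw w gw))
    (fun i j h => w_sum i j h w gw)
    (fun i j h => sqr_kap i j h w gw)).
have full1 : \sum_(t < sampleT m n) T^-1 = 1.
  by rewrite sumr_const card_ord -mulr_natl mulfV // gt_eqF.
have full2 : \sum_(t < sampleT m n) T^-1 ^+ 2 <= kap / T.
  rewrite sumr_const card_ord -mulr_natl expr2 mulrA mulfV ?gt_eqF // ler_wpM2r //.
  by rewrite invr_ge0 ltW.
have [G3 [mG3 PG3 G3w]] := stage_tail measurable_full_sampling_sq (fun z => fsq_ge0 _)
  mG B2 e_gt0 PG
  (fun w gw => sampling_mean_le (proj1 (Gw w gw)) (v := fun _ _ _ _ => T^-1)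
    (fun i j h => full1) (fun i j h => full2)).
exists (G `&` (G1 `&` (G2 `&` G3))).
have mG23 : measurable (G2 `&` G3) by exact: measurableI.
have mG123 : measurable (G1 `&` (G2 `&` G3)) by exact: measurableI.
split; first exact: measurableI.
- rewrite (_ : 7 * e = e + ((e + e) + ((e + e) + (e + e)))); last by ring.
  apply: (probability_le_cover (B := ~` G) (C := ~` (G1 `&` (G2 `&` G3)))) => //.
  + by apply: measurableC; exact: measurableI.
  + exact: measurableC.
  + exact: measurableC.
  + by rewrite setCI.
  apply: (probability_le_cover (B := ~` G1) (C := ~` (G2 `&` G3))) => //.
  + exact: measurableC.
  + exact: measurableC.
  + exact: measurableC.
  + by rewrite setCI.
  apply: (probability_le_cover (B := ~` G2) (C := ~` G3)) => //.
  + exact: measurableC.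
  + exact: measurableC.
  + exact: measurableC.
  + by rewrite setCI.
- by move=> w [Gw0 [/G1w h1 [/G2w h2 /G3w h3]]].
Qed.

End Bounds.

End Stage.

(** [S] and [sig] belong to the deterministic limit of the Gram matrices and precede [e]; only [c]
    and [M] depend on the probability. *)
Lemma key_event : exists (S : 'M[R]_(r k)) (sig : R),
  [/\ 0 < sig, forall y : 'cV_(r k), sig * fsq y <= (y^T *m S *m y) 0 0 &
   forall e, 0 < e -> exists c M : R, [/\ 1 <= c, 0 < M & \forall n \near \oo,
     [/\ (0 < sampleT m n)%N, forall l, (0 < dims m n l)%N &
     exists G : set Om, [/\ measurable G, (P (~` G) <= e%:E)%E &
       forall w, G w ->
         [/\ fsq (gram m n w k - S) <= (sig / 2) ^+ 2,
          forall l (j : 'I_(r l)),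
            Zdiag (loading_mx m n w l) 0 j <= c * rate m alpha n j /\
            rate m alpha n j <= c * Zdiag (loading_mx m n w l) 0 j,
          forall i j h, psi0 <= observed_ratio (m := m) (n := n) (k := k) w i j h &
          let p : R := (dims m n k)%:R in
          let q : R := (nfib (dims m n) k)%:R in
          let T : R := (sampleT m n)%:R in
          [/\ noise_sq n (w, w) <= M * (p * q ^+ 2 + p ^+ 2 * (q / T)),
             sampling_sq n (w, w) <= M * (gs m alpha n ^+ 2 / T) &
             full_sampling_sq n (w, w) <= M * (gs m alpha n ^+ 2 / T)]]]]]].
Proof.
have [S [sig [sig0 Scoer Sev]]] := loading_event L1 k.
exists S, sig; split=> // e0 e00.
pose e := e0 / 7; have e_gt0 : 0 < e by rewrite divr_gt0.
have [c c1 near_G] := Sev e e_gt0.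
have [L [C [C0 lpF lpE lpeps]]] := model_lp_bounded F1 E2.
have [E0 E00 near_E] := error_load_bounded E1 k.
have [_ _ _ _ [[Cs sdCs] _]] := E1.
have [_ psi0_gt0 ae_psi] := O1.
(* [K1] and [K2] are the constants of [stage_event], including the factor 1/e from Markov's
   inequality. *)
pose K1 := (16 * ((L * L) ^+ 2 * (2 * (C + 1))) *
  (((#|{: tidx r}|%:R + 1) * (#|{: tidx r}|%:R * c ^+ K)) * E0 + #|{: tidx r}|%:R * Cs ^+ 2
   * ((#|{: tidx r}|%:R + 1) * (#|{: tidx r}|%:R * c ^+ K)) + E0 ^+ 2
   + 2 * E0 * Cs ^+ 2 + Cs ^+ 4) * Num.max 1 psi0^-1 + 1) / e.
pose K2 := (((#|{: tidx r}|%:R + 1) * (#|{: tidx r}|%:R * c ^+ K)) ^+ 2 *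
  ((L * L) ^+ 2 * (2 * (C + 1))) * Num.max 1 psi0^-1 + 1) / e.
pose M := `|K1| + `|K2| + 1.
exists c, M; split=> //.
  by rewrite ltr_wpDl // addr_ge0.
have near_d := dims_gt0 regime.
near=> n.
have [T_gt0 d_gt0] : (0 < sampleT m n)%N /\ forall l, (0 < dims m n l)%N by near: n.
split=> //.
have [G [mG PG Gw]] : exists G : set Om, [/\ measurable G, (P (~` G) <= e%:E)%E &
       forall w, G w -> fsq (gram m n w k - S) <= (sig / 2) ^+ 2 /\
         forall l (j : 'I_(r l)),
           Zdiag (loading_mx m n w l) 0 j <= c * rate m alpha n j /\
           rate m alpha n j <= c * Zdiag (loading_mx m n w l) 0 j] by near: n.
have En : \sum_i \sum_h (\sum_p `|load (loading_e m n)
     (on_fibre (k := k) i (fibre h)) p|) ^+ 2 <= E0 by near: n.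
have ae_psi' : {ae P, forall w, forall i, forall j, forall h,
    psi0 <= observed_ratio (m := m) (n := n) (k := k) w i j h}.
  by do 3!apply: filter_forall => ?; exact: ae_psi.
have [G1 [mG1 PG1 G1w]] := event_ae mG PG ae_psi'.
have := stage_event C0 E00 c1 e_gt0 lpF lpE (lpeps n) En (sdCs n) T_gt0 d_gt0 mG1 PG1
  (fun w gw => conj (proj2 (Gw w (proj1 (G1w w gw)))) (proj2 (G1w w gw))).
move=> [G' [mG' PG' G'w]].
exists G'; split=> //.
  by apply: le_trans PG' _; rewrite lee_fin /e mulrC divfK.
move=> w /G'w[/G1w[/Gw[h1 h2] nN] h3 h4 h5]; split=> //.
have D1 : 0 <= (dims m n k)%:R * (nfib (dims m n) k)%:R ^+ 2
    + (dims m n k)%:R ^+ 2 * ((nfib (dims m n) k)%:R / (sampleT m n)%:R) :> R.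
  by rewrite addr_ge0 // ?mulr_ge0 ?sqr_ge0 ?divr_ge0.
have D2 : 0 <= gs m alpha n ^+ 2 / (sampleT m n)%:R by rewrite divr_ge0 ?sqr_ge0.
have K1M : K1 <= M by rewrite /M; have := ler_norm K1; have := normr_ge0 K2; lra.
have K2M : K2 <= M by rewrite /M; have := ler_norm K2; have := normr_ge0 K1; lra.
split.
- by apply: le_trans h3 _; rewrite mulrAC; exact: ler_wpM2r.
- by apply: le_trans h4 _; rewrite mulrAC; exact: ler_wpM2r.
- by apply: le_trans h5 _; rewrite mulrAC; exact: ler_wpM2r.
Unshelve. all: by end_near. Qed.

End KeyEvent.

(** * Consistency *)

Section Consistency.
Context {R : realType} {dO : measure_display} {Om : measurableType dO}.
Context {P : probability Om R} {K : nat} {r re : 'I_K -> nat}.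
Variables (m : factor_model P r re) (alpha : 'I_K -> nat -> R) (psi0 : R).
Hypotheses (r_gt0 : forall k, (0 < r k)%N) (regime : asymptotic_regime m)
  (O1 : assumption_O1 m psi0) (F1 : assumption_F1 m) (L1 : assumption_L1 m alpha)
  (E1 : assumption_E1 m) (E2 : assumption_E2 m) (R1 : assumption_R1 m alpha).
Variables (k : 'I_K) (Qhat : forall n, 'I_(dims m n k) -> 'I_(r k) -> {RV P >-> R}).
Hypothesis Qhat_est : is_estimator Qhat.

(** The order in the bound on the mean of [noise_sq]: p q^2 from the idiosyncratic diagonal, p^2 q /
    T from the orthogonal sums. *)
Definition noise_bound n : R :=
  let p : R := (dims m n k)%:R in let q : R := (nfib (dims m n) k)%:R in
  p * q ^+ 2 + p ^+ 2 * (q / Tn m n).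

Definition spread_rate n : R := dk m n k `^ spread r alpha k.

Definition err_rows n (w : Om) : R := \sum_(j < dims m n k)
  l2norm (rowv (Qhat_mx Qhat n w) j - H_mx Qhat w j *m rowv (Q_mx m k n w) j) ^+ 2.

Definition err_all n (w : Om) : R := \sum_(j < dims m n k)
  l2norm (rowv (Qhat_mx Qhat n w) j - Ha_mx Qhat n w *m rowv (Q_mx m k n w) j) ^+ 2.

Let m_loading n l : measurable_mx (fun w => loading_mx m n w l).
Proof. exact: measurable_loading_mx. Qed.

Let m_core n t i : measurable_fun setT (fun w => core_at (m := m) (n := n) w t i).
Proof. exact: measurable_funP. Qed.

Let m_obs n t i : measurable_fun setT (fun w => obs (m := m) (n := n) w t i).
Proof.
apply: measurable_funD; last exact: measurable_funP.
exact: (measurable_tucker _ (@m_loading n) (@m_core n t)).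
Qed.

Let m_Qhat n : measurable_mx (Qhat_mx Qhat n).
Proof. by move=> i j; under eq_fun do rewrite mxE; exact: measurable_funP. Qed.

Let m_Q n : measurable_mx (Q_mx m k n).
Proof. exact: measurable_normalized. Qed.

Let m_pattern n x : measurable [set w : Om | mask_pattern m n w = x].
Proof. by apply: measurable_mask_pattern => t i; exact: measurable_funP. Qed.

Lemma measurable_err_rows n : measurable_fun setT (err_rows n).
Proof.
apply: measurable_sum => j; apply: measurable_funX.
pose G (x : {ffun 'I_(sampleT m n) * tidx (dims m n) -> bool}) (w : Om) : R :=
  l2norm (rowv (Qhat_mx Qhat n w) j - Hrow (fun t i => x (t, i)) (obs w)
    (loading_mx m n w) (core_at w) (Qhat_mx Qhat n w) j *m rowv (Q_mx m k n w) j).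
rewrite (_ : (fun w => _) = fun w => G (mask_pattern m n w) w); last first.
  by apply/funext => w; rewrite /H_mx mask_at_pattern.
apply: measurable_finite_dep => x; first exact: m_pattern.
rewrite /G; apply: measurable_l2norm.
apply: measurable_mxB; first exact: measurable_rowv.
apply: measurable_mx_mul; last exact: measurable_rowv.
exact: (measurable_Hrow (@m_loading n) (@m_core n) _ (@m_obs n) (@m_Qhat n)).
Qed.

Lemma measurable_err_all n : measurable_fun setT (err_all n).
Proof.
apply: measurable_sum => j; apply: measurable_funX.
pose G (x : {ffun 'I_(sampleT m n) * tidx (dims m n) -> bool}) (w : Om) : R :=
  l2norm (rowv (Qhat_mx Qhat n w) j - Hall (fun t i => x (t, i)) (obs w)
    (loading_mx m n w) (core_at w) (Qhat_mx Qhat n w) *m rowv (Q_mx m k n w) j).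
rewrite (_ : (fun w => _) = fun w => G (mask_pattern m n w) w); last first.
  by apply/funext => w; rewrite /Ha_mx mask_at_pattern.
apply: measurable_finite_dep => x; first exact: m_pattern.
rewrite /G; apply: measurable_l2norm.
apply: measurable_mxB; first exact: measurable_rowv.
apply: measurable_mx_mul; last exact: measurable_rowv.
exact: (measurable_Hall (@m_loading n) (@m_core n) _ (@m_obs n) (@m_Qhat n)).
Qed.

(** The first limit combines the first and third conditions of (R1). The second follows from the
    second condition because d >= g_s. *)
Lemma rates_vanish :
  noise_bound n * (spread_rate n / gs m alpha n) ^+ 2 @[n --> \oo] --> 0 /\
  spread_rate n ^+ 2 / Tn m n @[n --> \oo] --> 0.
Proof.
have [R11 R12 R13] := R1 k; have near_d := dims_gt0 regime; split.
  have h : (dtot m n * (gs m alpha n)^-1 * dk m n k `^ (spread r alpha k - 1 / 2)) ^+ 2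
      + dtot m n * (gs m alpha n ^+ 2)^-1 * (Tn m n)^-1
        * dk m n k `^ (2 * spread r alpha k + 1) @[n --> \oo] --> 0.
    by rewrite -[0 in X in _ --> X]addr0 -[X in _ --> X + _](mulr0 0);
      exact: cvgD (cvgM R13 R13) R11.
  apply: cvg_trans h; apply: near_eq_cvg; near=> n.
  have [T0 d0] : (0 < sampleT m n)%N /\ forall l, (0 < dims m n l)%N by near: n.
  have p0 : 0 < dk m n k by rewrite ltr0n.
  have D0 : 0 < dtot m n by apply: prodr_gt0 => l _; rewrite ltr0n.
  have q0 : 0 < (nfib (dims m n) k)%:R :> R.
    by move: D0; rewrite /dtot -(nfib_prod R (dims m n) k) pmulr_rgt0.
  have g0 : 0 < gs m alpha n by apply: prodr_gt0 => l _; rewrite powR_gt0 // ltr0n.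
  have [e1 e2 _ e4] := powR_rates (spread r alpha k) p0.
  rewrite /noise_bound rate_split // ?ltr0n // /spread_rate nfib_prod -/(dtot m n).
  by rewrite e1 exprMn e4 -/(dk m n k) [in RHS]exprMn; congr (_ + _); rewrite mulrA.
apply: (@squeeze_cvgr _ _ _ _ (fun=> 0) (fun n => dtot m n * (gs m alpha n)^-1 * (Tn m n)^-1
   * dk m n k `^ (2 * spread r alpha k))) => //; last exact: cvg_cst.
near=> n.
have [T0 d0] : (0 < sampleT m n)%N /\ forall l, (0 < dims m n l)%N by near: n.
have p0 : 0 < dk m n k by rewrite ltr0n.
have g0 : 0 < gs m alpha n by apply: prodr_gt0 => l _; rewrite powR_gt0 // ltr0n.
have [_ -> _ _] := powR_rates (spread r alpha k) p0.
rewrite divr_ge0 ?sqr_ge0 //= mulrC -mulrA [leRHS]mulrC -/(spread_rate n).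
rewrite [leRHS](_ : _ = (dtot m n / gs m alpha n) * (spread_rate n ^+ 2 / Tn m n)); last by ring.
rewrite mulrC ler_peMl ?divr_ge0 ?sqr_ge0 //.
by rewrite ler_pdivlMr // mul1r (gs_le_dtot L1).
Unshelve. all: by end_near. Qed.

Section Realization.
Variables (n : nat) (w : Om) (S : 'M[R]_(r k)) (sig c : R).
Hypotheses (T_gt0 : (0 < sampleT m n)%N) (d_gt0 : forall l, (0 < dims m n l)%N)
  (sig_gt0 : 0 < sig) (S_ge : forall y : 'cV_(r k), sig * fsq y <= (y^T *m S *m y) 0 0)
  (c_ge1 : 1 <= c) (gram_S : fsq (gram m n w k - S) <= (sig / 2) ^+ 2)
  (rates_w : forall l (j : 'I_(r l)),
     Zdiag (loading_mx m n w l) 0 j <= c * rate m alpha n j /\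
     rate m alpha n j <= c * Zdiag (loading_mx m n w l) 0 j).

Let g := gs m alpha n.
Let u := spread_rate n.
(** Half of the lower bound for the signal eigenvalues. That bound loses c^K in the Kronecker
    factor, [c] in the entries of Z_k and a factor 2 in the Gram matrix; the second factor 2 is
    reserved for the deviation of [Shat]. *)
Let delta := sig / (4 * c ^+ K.+1) * (g / u).

Hypothesis dev_le :
  2 * (noise_sq m k n (w, w) + sampling_sq m k n (w, w)) <= delta ^+ 2.

Let rate_gt0 l (j : 'I_(r l)) : 0 < rate m alpha n j.
Proof. by rewrite powR_gt0 // ltr0n. Qed.

Let Z_up l (j : 'I_(r l)) : Zdiag (loading_mx m n w l) 0 j <= c * rate m alpha n j.
Proof. by case: (rates_w j). Qed.

Let Z_lo l (j : 'I_(r l)) : rate m alpha n j <= c * Zdiag (loading_mx m n w l) 0 j.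
Proof. by case: (rates_w j). Qed.

Let g_gt0 : 0 < g.
Proof. by apply: prodr_gt0 => l _; rewrite powR_gt0 // ltr0n. Qed.

Let u_gt0 : 0 < u.
Proof. by rewrite powR_gt0 // ltr0n. Qed.

Let delta_gt0 : 0 < delta.
Proof.
have c0 : 0 < c := lt_le_trans ltr01 c_ge1.
by rewrite !(mulr_gt0, invr_gt0, exprn_gt0).
Qed.

(** [Shat] deviates from [signal_mean] by at most [delta] in Frobenius norm, while the signal is at
    least 2 delta on the image of A_k. *)
Lemma top_eigenvalues_ge : exists lam : 'rV[R]_(r k),
  [/\ (Qhat_mx Qhat n w)^T *m Shat (mask_at w) (obs w) k
        = diag_mx lam *m (Qhat_mx Qhat n w)^T,
      (Qhat_mx Qhat n w)^T *m Qhat_mx Qhat n w = 1%:M &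
      forall a, delta <= lam 0 a].
Proof.
have c0 : 0 < c := lt_le_trans ltr01 c_ge1.
pose A := loading_mx m n w.
pose kap := fsq (kron_but A k).
pose vmin := dk m n k `^ alpha k (r k).
have vmin0 : 0 < vmin by rewrite powR_gt0 // ltr0n.
pose gam := sig / 2 / c * vmin.
have gam0 : 0 < gam by rewrite !(mulr_gt0, invr_gt0).
have Alow (y : 'cV_(r k)) : gam * fsq y <= fsq (A k *m y).
  apply: (good_singular_ge (v := fun l j => rate m alpha n j) c_ge1 _ Z_lo sig_gt0 S_ge
    gram_S) => // j.
  have [_ _ _ _ /(_ k) [_ amono _]] := L1.
  by apply: ler_powR; rewrite ?ler1n //; apply: amono => //; rewrite ltn_ord.
have kap_ge : \prod_(l < K | l != k) dk m n l `^ alpha l 1 <= c ^+ K * kap.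
  exact: (good_kron_ge (v := fun l j => rate m alpha n j)
    (g := fun l => dk m n l `^ alpha l 1) c_ge1 rate_gt0 Z_lo k
    (j0 := fun l => Ordinal (r_gt0 l)) (fun=> erefl)).
(* g / u is d_k^alpha_(k,r_k) times the product of d_l^alpha_(l,1) over the other modes: the weakest
   direction in mode [k], the strongest in every other. *)
have kg : 2 * delta <= kap * gam.
  have pp : 0 < dk m n k `^ alpha k 1 by rewrite powR_gt0 // ltr0n.
  have uE : u * vmin = dk m n k `^ alpha k 1.
    have p0 : 0 < dk m n k by rewrite ltr0n.
    by rewrite /u /vmin /spread_rate -powRD ?subrK // (gt_eqF p0) implybT.
  have gE : g / u = vmin * \prod_(l < K | l != k) dk m n l `^ alpha l 1.
    by rewrite /g /gs (bigD1 k) //= -uE; field; rewrite gt_eqF.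
  rewrite /delta gE.
  rewrite [leLHS](_ : _ = sig / 2 / c * vmin / c ^+ K *
     \prod_(l < K | l != k) dk m n l `^ alpha l 1); last first.
    by rewrite exprS; field; rewrite !gt_eqF ?exprn_gt0.
  rewrite [leRHS](_ : _ = gam / c ^+ K * (c ^+ K * kap)); last first.
    by field; rewrite gt_eqF ?exprn_gt0.
  by rewrite ler_wpM2l // divr_ge0 ?exprn_ge0 ?(ltW gam0) // ltW.
have dev : fsq (Shat (mask_at w) (obs w) k - signal_mean m k n w) <= delta ^+ 2.
  apply: le_trans dev_le; rewrite Shat_wprod.
  set X := wprod _ _ _; set Y := wprod (obs_weight (mask_at w) (k := k))
    (@signal _ _ _ _ _ _ _ m k n w w) (@signal _ _ _ _ _ _ _ m k n w w).
  rewrite (_ : X - signal_mean m k n w = (X - Y) + (Y - signal_mean m k n w)).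
    exact: fsqD.
  by rewrite addrA subrK.
have Slow (x : 'cV_(dims m n k)) : kap * fsq ((A k)^T *m x) - delta * fsq x
    <= (x^T *m Shat (mask_at w) (obs w) k *m x) 0 0.
  have h := quad_form_le x (ltW delta_gt0) dev.
  rewrite (_ : Shat _ _ k = (Shat (mask_at w) (obs w) k - signal_mean m k n w)
      + signal_mean m k n w); last by rewrite subrK.
  rewrite mulmxDr mulmxDl [leRHS]mxE.
  have -> : (x^T *m signal_mean m k n w *m x) 0 0 = kap * fsq ((A k)^T *m x).
    rewrite /signal_mean -/A -/kap -scalemxAr -scalemxAl mxE -fsq_dot; congr (_ * _).
    by rewrite trmx_mul trmxK !mulmxA.
  by move: h; lra.
have [lam [h1 h2 h3]] := top_eigenvectors_lower (Shat_sym (mask_at w) (obs w) k) (Qhat_est n w)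
  (fsq_ge0 _) gam0 Slow Alow.
by exists lam; split=> // a; apply: le_trans (h3 a); move: kg; rewrite /kap; lra.
Qed.

Let full_dev : R :=
  fsq (Shat (mask_at w) (obs w) k - wprod (fun _ _ _ _ => (sampleT m n)%:R^-1)
    (@signal _ _ _ _ _ _ _ m k n w w) (@signal _ _ _ _ _ _ _ m k n w w)).

(** The second bound passes through the mean shared by both averages. Under full observation the
    averages coincide, and the sampling errors drop out. *)
Lemma realized_error_le :
  [/\ err_rows n w <= (delta ^+ 2)^-1 * noise_sq m k n (w, w),
      err_all n w <= (delta ^+ 2)^-1 *
        (4 * (noise_sq m k n (w, w) + sampling_sq m k n (w, w) + full_sampling_sq m k n (w, w))) &
      (forall i j h, observed_ratio (m := m) (n := n) (k := k) w i j h = 1) ->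
        err_all n w <= (delta ^+ 2)^-1 * noise_sq m k n (w, w)].
Proof.
have [lam [QS QQ lam_ge]] := top_eigenvalues_ge.
have Zpos := good_Zdiag_gt0 c_ge1 rate_gt0 Z_lo.
have all_le : err_all n w <= (delta ^+ 2)^-1 * full_dev.
  exact: (Hall_error_le (core_at w) Zpos QS QQ delta_gt0 lam_ge).
have noiseE : noise_sq m k n (w, w) =
    fsq (Shat (mask_at w) (obs w) k - wprod (obs_weight (mask_at w) (k := k))
    (@signal _ _ _ _ _ _ _ m k n w w) (@signal _ _ _ _ _ _ _ m k n w w)).
  by rewrite Shat_wprod.
have d0 : 0 <= (delta ^+ 2)^-1 by rewrite invr_ge0 sqr_ge0.
split.
- rewrite noiseE; exact: (Hrow_error_le (core_at w) Zpos QS QQ delta_gt0 lam_ge).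
- apply: (le_trans all_le); apply: ler_wpM2l => //.
  rewrite noiseE; exact: fsq_detour.
- move=> full; apply: (le_trans all_le); apply: ler_wpM2l => //.
  rewrite noiseE /full_dev.
  rewrite (_ : obs_weight (mask_at w) (k := k) = (fun _ _ _ _ => (sampleT m n)%:R^-1)) //.
  apply/funext => i; apply/funext => j; apply/funext => h; apply/funext => t.
  have T0 : (sampleT m n)%:R != 0 :> R by rewrite pnatr_eq0 -lt0n.
  have /eqP := full i j h; rewrite -(inj_eq (mulIf T0)) divfK // mul1r eqr_nat => /eqP cardT.
  have psiT : psi (mask_at w) i j h = [set: 'I_(sampleT m n)]%SET.
    by apply/eqP; rewrite eqEcard finset.subsetT cardsT card_ord cardT leqnn.
  by rewrite /obs_weight psiT inE cardsT card_ord mul1r.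
Qed.

End Realization.

(* d_k times the first rate of the theorem, see [row_rateE]. *)
Definition row_rate n : R := noise_bound n * (spread_rate n / gs m alpha n) ^+ 2.

Lemma error_event (e : R) : 0 < e -> exists2 B : R, 0 < B & \forall n \near \oo,
  exists G : set Om, [/\ measurable G, (P (~` G) <= e%:E)%E & forall w, G w ->
    [/\ err_rows n w <= B * row_rate n,
        err_all n w <= B * (row_rate n + spread_rate n ^+ 2 / Tn m n) &
        (forall i j h, observed_ratio (m := m) (n := n) (k := k) w i j h = 1) ->
          err_all n w <= B * row_rate n]].
Proof.
move=> e0; have [S [sig [sig0 S_ge key]]] := key_event regime O1 F1 L1 E1 E2 k.
have [c [M [c1 M0 near_G]]] := key e e0.
have c0 : 0 < c := lt_le_trans ltr01 c1.
pose kap := sig / (4 * c ^+ K.+1).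
have kap0 : 0 < kap by rewrite divr_gt0 // mulr_gt0 // exprn_gt0.
(* The 8 is the 4 of [fsq_detour] doubled, since sampling error occurs in the masked and in the full
   average. *)
exists (8 * M / kap ^+ 2); first by rewrite divr_gt0 ?exprn_gt0 // mulr_gt0.
have [lim1 lim2] := rates_vanish.
(* Below this threshold, noise and sampling error are each at most delta^2 / 4, so that twice their
   sum is at most delta^2. *)
have s0 : 0 < kap ^+ 2 / (4 * M) by rewrite divr_gt0 ?exprn_gt0 // mulr_gt0.
have near1 : \forall n \near \oo, row_rate n <= kap ^+ 2 / (4 * M).
  move/cvgr0Pnorm_le : lim1 => /(_ _ s0); apply: filterS => n; apply: le_trans.
  exact: ler_norm.
have near2 : \forall n \near \oo, spread_rate n ^+ 2 / Tn m n <= kap ^+ 2 / (4 * M).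
  move/cvgr0Pnorm_le : lim2 => /(_ _ s0); apply: filterS => n; apply: le_trans.
  exact: ler_norm.
near=> n.
have [T0 d0 [G [mG PG Gw]]] : [/\ (0 < sampleT m n)%N, forall l, (0 < dims m n l)%N &
     exists G : set Om, [/\ measurable G, (P (~` G) <= e%:E)%E &
       forall w, G w ->
         [/\ fsq (gram m n w k - S) <= (sig / 2) ^+ 2,
          forall l (j : 'I_(r l)),
            Zdiag (loading_mx m n w l) 0 j <= c * rate m alpha n j /\
            rate m alpha n j <= c * Zdiag (loading_mx m n w l) 0 j,
          forall i j h, psi0 <= observed_ratio (m := m) (n := n) (k := k) w i j h &
          [/\ noise_sq m k n (w, w) <= M * noise_bound n,
             sampling_sq m k n (w, w) <= M * (gs m alpha n ^+ 2 / Tn m n) &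
             full_sampling_sq m k n (w, w) <= M * (gs m alpha n ^+ 2 / Tn m n)]]]].
  by near: n.
exists G; split=> // w /Gw[gramS rates_w _ [h1 h2 h3]].
have g0 : 0 < gs m alpha n by apply: prodr_gt0 => l _; rewrite powR_gt0 // ltr0n.
have u0 : 0 < spread_rate n by rewrite powR_gt0 // ltr0n.
have near1n : row_rate n <= kap ^+ 2 / (4 * M) by near: n.
have near2n : spread_rate n ^+ 2 / Tn m n <= kap ^+ 2 / (4 * M) by near: n.
set g := gs m alpha n in g0 h2 h3 *; set u := spread_rate n in u0 near2n *.
have T0' : 0 < Tn m n by rewrite ltr0n.
have gu : 0 <= (g / u) ^+ 2 := sqr_ge0 _.
have NE : noise_bound n = row_rate n * (g / u) ^+ 2.
  by rewrite /row_rate -/u -/g; field; rewrite !gt_eqF.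
have SE : g ^+ 2 / Tn m n = u ^+ 2 / Tn m n * (g / u) ^+ 2 by field; rewrite !gt_eqF.
have dev : 2 * (noise_sq m k n (w, w) + sampling_sq m k n (w, w)) <=
    (sig / (4 * c ^+ K.+1) * (g / u)) ^+ 2.
  rewrite -/kap exprMn.
  have b1 : M * noise_bound n <= kap ^+ 2 / 4 * (g / u) ^+ 2.
    rewrite NE mulrA ler_wpM2r // mulrC -ler_pdivlMr //.
    by rewrite [leRHS](_ : _ = kap ^+ 2 / (4 * M)) //; field; rewrite gt_eqF.
  have b2 : M * (g ^+ 2 / Tn m n) <= kap ^+ 2 / 4 * (g / u) ^+ 2.
    rewrite SE mulrA ler_wpM2r // mulrC -ler_pdivlMr //.
    by rewrite [leRHS](_ : _ = kap ^+ 2 / (4 * M)) //; field; rewrite gt_eqF.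
  by move: h1 h2 b1 b2; lra.
have [e1 e2 e3] := realized_error_le T0 d0 sig0 S_ge c1 gramS rates_w dev.
rewrite -/kap -/g -/u in e1 e2 e3.
have dpos : 0 <= ((kap * (g / u)) ^+ 2)^-1 by rewrite invr_ge0 sqr_ge0.
have N0 : 0 <= noise_bound n.
  apply: addr_ge0; first by rewrite mulr_ge0 // sqr_ge0.
  by rewrite mulr_ge0 ?sqr_ge0 // divr_ge0 // ltW.
have dN : ((kap * (g / u)) ^+ 2)^-1 * noise_sq m k n (w, w) <= 8 * M / kap ^+ 2 * row_rate n.
  apply: (@le_trans _ _ (((kap * (g / u)) ^+ 2)^-1 * (8 * (M * noise_bound n)))).
    apply: ler_wpM2l => //; apply: (le_trans h1).
    by rewrite ler_peMl ?ler1n // mulr_ge0 // ltW.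
  rewrite NE le_eqVlt; apply/orP; left; apply/eqP.
  by field; rewrite !gt_eqF.
split=> [||full]; [exact: le_trans e1 dN| |exact: le_trans (e3 full) dN].
apply: (le_trans e2).
apply: (@le_trans _ _ (((kap * (g / u)) ^+ 2)^-1 *
    (8 * (M * noise_bound n + M * (g ^+ 2 / Tn m n))))).
  apply: ler_wpM2l => //.
  have : 0 <= M * noise_bound n by rewrite mulr_ge0 // ltW.
  by move: h1 h2 h3; lra.
rewrite NE SE le_eqVlt; apply/orP; left; apply/eqP.
by field; rewrite !gt_eqF.
Unshelve. all: by end_near. Qed.

Let b1 n := dk m n k `^ (2 * spread r alpha k - 1)
  * ((Tn m n * dmk m n k)^-1 + (dk m n k)^-1) * (dtot m n ^+ 2 / gs m alpha n ^+ 2).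

Lemma row_rateE n : (0 < sampleT m n)%N -> (forall l, (0 < dims m n l)%N) ->
  b1 n = (dk m n k)^-1 * row_rate n.
Proof.
move=> T0 d0; have p0 : 0 < dk m n k by rewrite ltr0n.
have [_ _ e3 _] := powR_rates (spread r alpha k) p0.
have D0 : 0 < dtot m n by apply: prodr_gt0 => l _; rewrite ltr0n.
have pq : dk m n k * (nfib (dims m n) k)%:R = dtot m n by rewrite /dtot -(nfib_prod R (dims m n) k).
have q0 : 0 < (nfib (dims m n) k)%:R :> R by move: D0; rewrite -pq pmulr_rgt0.
have g0 : 0 < gs m alpha n by apply: prodr_gt0 => l _; rewrite powR_gt0 // ltr0n.
have dmkE : dmk m n k = (nfib (dims m n) k)%:R.
  by rewrite /dmk -pq mulrC mulKf // gt_eqF.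
have T0' : 0 < Tn m n by rewrite ltr0n.
by rewrite /b1 dmkE e3 -pq rate_identity.
Qed.

Lemma row_rate_ge0 n : 0 <= row_rate n.
Proof.
apply: mulr_ge0; last exact: sqr_ge0.
by apply: addr_ge0; rewrite mulr_ge0 ?sqr_ge0 // divr_ge0.
Qed.

Let inv_dk_ge0 n : 0 <= (dk m n k)^-1. Proof. by rewrite invr_ge0. Qed.

Let err_rows_ge0 n w : 0 <= err_rows n w.
Proof. by apply: sumr_ge0 => j _; exact: sqr_ge0. Qed.

Let err_all_ge0 n w : 0 <= err_all n w.
Proof. by apply: sumr_ge0 => j _; exact: sqr_ge0. Qed.

Lemma scaled_vanish (x : nat -> R) : (forall n, 0 <= x n) -> x n @[n --> \oo] --> 0 ->
  (dk m n k)^-1 * x n @[n --> \oo] --> 0.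
Proof.
move=> x0 xlim; apply: (@squeeze_cvgr _ _ _ _ (fun=> 0) x) => //; last exact: cvg_cst.
near=> n; rewrite mulr_ge0 //= ler_piMl // invf_le1 ?ltr0n ?ler1n //; near: n.
all: by apply: filterS (dims_gt0 regime) => n [].
Unshelve. all: by end_near. Qed.

Lemma mean_rows_OP : is_OP P (fun n w => (dk m n k)^-1 * err_rows n w) b1 /\
  is_oP P (fun n w => (dk m n k)^-1 * err_rows n w) (fun=> 1).
Proof.
have mX n : measurable_fun setT (fun w => (dk m n k)^-1 * err_rows n w).
  by apply: measurable_funM => //; exact: measurable_err_rows.
have XO : is_OP P (fun n w => (dk m n k)^-1 * err_rows n w) b1.
  apply: is_OP_intro => // e e0; have [B B0 near_G] := error_event e0; exists B => //.
  near=> n.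
  have [T0 d0] : (0 < sampleT m n)%N /\ forall l, (0 < dims m n l)%N.
    by near: n; exact: dims_gt0.
  have [G [mG PG Gw]] : exists G : set Om, [/\ measurable G, (P (~` G) <= e%:E)%E &
    forall w, G w -> [/\ err_rows n w <= B * row_rate n,
        err_all n w <= B * (row_rate n + spread_rate n ^+ 2 / Tn m n) &
        (forall i j h, observed_ratio (m := m) (n := n) (k := k) w i j h = 1) ->
          err_all n w <= B * row_rate n]] by near: n.
  exists G; split=> // w /Gw[h _ _].
  rewrite row_rateE // ger0_norm; last by apply: mulr_ge0.
  rewrite ger0_norm; last by apply: mulr_ge0 => //; exact: row_rate_ge0.
  by rewrite mulrCA ler_wpM2l.
split=> //; apply: is_oP_of_OP XO _ => //.
have h := scaled_vanish row_rate_ge0 (proj1 rates_vanish).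
apply: (cvg_trans _ h); apply: near_eq_cvg; near=> n.
have [T0 d0] : (0 < sampleT m n)%N /\ forall l, (0 < dims m n l)%N.
  by near: n; exact: dims_gt0.
by rewrite row_rateE.
Unshelve. all: by end_near. Qed.

Section CommonRotation.
Variables (eta : R) (eta_ : forall n, 'I_(dims m n k) -> 'I_(dims m n k) ->
  'I_(nfib (dims m n) k) -> Om -> R).
Hypotheses (eta_le : forall n i j h, {ae P, forall w,
    observed_ratio (m := m) w i j h = 1 - eta_ (n := n) i j h w /\
    1 - eta <= 1 - eta_ i j h w}) (eta_psi0 : 1 - eta = psi0).

Let b2 n := dk m n k `^ (2 * spread r alpha k - 1)
  * (((Tn m n * dmk m n k)^-1 + (dk m n k)^-1) * (dtot m n ^+ 2 / gs m alpha n ^+ 2)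
     + Num.min (Tn m n)^-1 (eta ^+ 2 / (1 - eta) ^+ 2)).

Let kap := eta ^+ 2 / (1 - eta) ^+ 2.
Let kap_ge0 : 0 <= kap. Proof. by rewrite divr_ge0 ?sqr_ge0. Qed.

Let psi0_gt0 : 0 < psi0. Proof. by case: O1. Qed.

Let b2E n : (0 < sampleT m n)%N -> (forall l, (0 < dims m n l)%N) ->
  b2 n = (dk m n k)^-1 * (row_rate n + spread_rate n ^+ 2 * Num.min (Tn m n)^-1 kap).
Proof.
move=> T0 d0; have p0 : 0 < dk m n k by rewrite ltr0n.
have [_ _ e3 _] := powR_rates (spread r alpha k) p0.
rewrite /b2 mulrDr mulrA -/(b1 n) row_rateE // e3 -/(spread_rate n) -/kap.
by rewrite [RHS]mulrDr; congr (_ + _); ring.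
Qed.

Let min_ge0 n : 0 <= Num.min (Tn m n)^-1 kap.
Proof. by rewrite le_min kap_ge0 invr_ge0 ler0n. Qed.

Let bound_ge0 n : 0 <= row_rate n + spread_rate n ^+ 2 * Num.min (Tn m n)^-1 kap.
Proof.
by apply: addr_ge0; [exact: row_rate_ge0|apply: mulr_ge0 => //; exact: sqr_ge0].
Qed.

(** The ratio is at least 1 by hypothesis and at most 1 as a proportion; for an empty sample it is 0
    by the convention on division. *)
Let fully_observed n : eta = 0 -> {ae P, forall w, forall i, forall j, forall h,
  observed_ratio (m := m) (n := n) (k := k) w i j h = 1}.
Proof.
move=> eta0; apply: filter_forall => i; apply: filter_forall => j.
apply: filter_forall => h; apply: filterS (eta_le i j h) => w [h1 h2].
apply/eqP; rewrite eq_le {2}h1 (le_trans _ h2) ?eta0 ?subr0 // andbT.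
rewrite /observed_ratio; have [T0|T0] := posnP (sampleT m n).
  by rewrite [X in _ / X%:R]T0 invr0 mulr0.
rewrite ler_pdivrMr ?ltr0n // mul1r ler_nat -[leqRHS]card_ord; exact: max_card.
Qed.

Lemma mean_all_OP : is_OP P (fun n w => (dk m n k)^-1 * err_all n w) b2 /\
  is_oP P (fun n w => (dk m n k)^-1 * err_all n w) (fun=> 1).
Proof.
have mX n : measurable_fun setT (fun w => (dk m n k)^-1 * err_all n w).
  by apply: measurable_funM => //; exact: measurable_err_all.
have XO : is_OP P (fun n w => (dk m n k)^-1 * err_all n w) b2.
  apply: is_OP_intro => // e e0; have [B B0 near_G] := error_event e0.
  (* As T >= 1, min(1, kap) / T <= min(1/T, kap), so dividing by min(1, kap) restores 1/T. Here kap
     > 0 because eta is nonzero and 1 - eta = psi0 > 0. *)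
  pose C := if eta == 0 then B else B / Num.min 1 kap.
  have C0 : 0 < C.
    rewrite /C; case: eqVneq => // eta_n0; rewrite divr_gt0 // lt_min ltr01 /=.
    by rewrite divr_gt0 // exprn_even_gt0 //= eta_psi0 gt_eqF.
  exists C => //; near=> n.
  have [T0 d0] : (0 < sampleT m n)%N /\ forall l, (0 < dims m n l)%N.
    by near: n; exact: dims_gt0.
  have [G [mG PG Gw]] : exists G : set Om, [/\ measurable G, (P (~` G) <= e%:E)%E &
    forall w, G w -> [/\ err_rows n w <= B * row_rate n,
        err_all n w <= B * (row_rate n + spread_rate n ^+ 2 / Tn m n) &
        (forall i j h, observed_ratio (m := m) (n := n) (k := k) w i j h = 1) ->
          err_all n w <= B * row_rate n]] by near: n.
  have [G' [mG' PG' G'w]] : exists G' : set Om, [/\ measurable G', (P (~` G') <= e%:E)%E &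
      forall w, G' w -> err_all n w
        <= C * (row_rate n + spread_rate n ^+ 2 * Num.min (Tn m n)^-1 kap)].
    (* If eta = 0 everything is observed and the two averages agree; otherwise the
       minimum has the order of 1/T. *)
    rewrite /C; case: eqVneq => eta0.
      have [G' [mG' PG' G'w]] := event_ae mG PG (fully_observed n eta0).
      exists G'; split=> // w /G'w[/Gw[_ _ h] /h]; move/le_trans; apply.
      by rewrite ler_pM2l // lerDl mulr_ge0 // sqr_ge0.
    exists G; split=> // w /Gw[_ h _]; apply: (le_trans h).
    rewrite -mulrA ler_pM2l //.
    have k0 : 0 < Num.min 1 kap by rewrite /C (negbTE eta0) pmulr_rgt0 // invr_gt0 in C0.
    rewrite [leRHS]mulrC ler_pdivlMr // mulrDl; apply: lerD.
      by rewrite ler_piMr ?row_rate_ge0 // ge_min lexx.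
    rewrite -mulrA ler_wpM2l ?sqr_ge0 // le_min; apply/andP; split.
      by rewrite ler_piMr ?invr_ge0 ?ler0n // ge_min lexx.
    apply: (@le_trans _ _ (1 * kap)); last by rewrite mul1r.
    apply: ler_pM; rewrite ?invr_ge0 ?ler0n ?(ltW k0) //.
      by rewrite invf_le1 ?ltr0n ?ler1n.
    by rewrite ge_min lexx orbT.
  exists G'; split=> // w /G'w h.
  rewrite b2E // ger0_norm; last by apply: mulr_ge0.
  rewrite ger0_norm; last by apply: mulr_ge0.
  by rewrite mulrCA ler_wpM2l.
split=> //; apply: is_oP_of_OP XO _ => //.
have [lim1 lim2] := rates_vanish.
have h : row_rate n + spread_rate n ^+ 2 / Tn m n @[n --> \oo] --> 0.
  by rewrite -[0 in X in _ --> X]addr0; exact: cvgD lim1 lim2.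
have h' : row_rate n + spread_rate n ^+ 2 * Num.min (Tn m n)^-1 kap @[n --> \oo] --> 0.
  apply: (@squeeze_cvgr _ _ _ _ (fun=> 0) _ _ _ _ _ h); last exact: cvg_cst.
  apply: nearW => n; rewrite bound_ge0 /=.
  by rewrite lerD2l ler_wpM2l ?sqr_ge0 // ge_min lexx.
have h2 : (dk m n k)^-1 * (row_rate n + spread_rate n ^+ 2 * Num.min (Tn m n)^-1 kap)
    @[n --> \oo] --> 0.
  exact: scaled_vanish bound_ge0 h'.
apply: (cvg_trans _ h2); apply: near_eq_cvg; near=> n.
have [T0 d0] : (0 < sampleT m n)%N /\ forall l, (0 < dims m n l)%N.
  by near: n; exact: dims_gt0.
by rewrite b2E.
Unshelve. all: by end_near. Qed.

End CommonRotation.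
End Consistency.

Theorem theorem1 (R : realType) (dO : measure_display) (Om : measurableType dO)
    (P : probability Om R) (K : nat) (r re : 'I_K -> nat)
    (m : factor_model P r re) (alpha : 'I_K -> nat -> R) (psi0 : R)
    (r_gt0 : forall k, (0 < r k)%N)
    (regime : asymptotic_regime m) (Y0 : mean_zero m)
    (O1 : assumption_O1 m psi0) (M1 : assumption_M1 m) (F1 : assumption_F1 m)
    (L1 : assumption_L1 m alpha) (E1 : assumption_E1 m) (E2 : assumption_E2 m)
    (R1 : assumption_R1 m alpha)
    (k : 'I_K)
    (Qhat : forall n, 'I_(dims m n k) -> 'I_(r k) -> {RV P >-> R})
    (Qhat_est : is_estimator Qhat) :
  (let err1 := fun n (w : Om) => (dk m n k)^-1 * \sum_(j < dims m n k)
     l2norm (rowv (Qhat_mx Qhat n w) j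
             - H_mx Qhat w j *m rowv (Q_mx m k n w) j) ^+ 2 in
   is_OP P err1 (fun n => dk m n k `^ (2 * spread r alpha k - 1)
     * ((Tn m n * dmk m n k)^-1 + (dk m n k)^-1)
     * (dtot m n ^+ 2 / gs m alpha n ^+ 2)) /\
   is_oP P err1 (fun=> 1)) /\
  (forall (eta : R)
     (eta_ : forall n, 'I_(dims m n k) -> 'I_(dims m n k) ->
               'I_(nfib (dims m n) k) -> Om -> R),
   (forall n i j h, {ae P, forall w,
      observed_ratio w i j h = 1 - eta_ n i j h w /\
      1 - eta <= 1 - eta_ n i j h w}) ->
   1 - eta = psi0 ->
   let err2 := fun n (w : Om) => (dk m n k)^-1 * \sum_(j < dims m n k)
     l2norm (rowv (Qhat_mx Qhat n w) j
             - Ha_mx Qhat n w *m rowv (Q_mx m k n w) j) ^+ 2 in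
   [/\ forall n w, err2 n w = (dk m n k)^-1 *
         frobenius_norm (Qhat_mx Qhat n w
                         - Q_mx m k n w *m (Ha_mx Qhat n w)^T) ^+ 2,
       is_OP P err2 (fun n => dk m n k `^ (2 * spread r alpha k - 1)
         * (((Tn m n * dmk m n k)^-1 + (dk m n k)^-1)
              * (dtot m n ^+ 2 / gs m alpha n ^+ 2)
            + Num.min (Tn m n)^-1 (eta ^+ 2 / (1 - eta) ^+ 2))) &
       is_oP P err2 (fun=> 1)]).
Proof.
split; first exact: (mean_rows_OP r_gt0 regime O1 F1 L1 E1 E2 R1 Qhat_est).
move=> eta eta_ eta_le eta_psi0 err2.
have [h1 h2] := mean_all_OP r_gt0 regime O1 F1 L1 E1 E2 R1 Qhat_est eta_le eta_psi0.
split=> // n w; congr (_ * _).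
exact: (Hall_error_frobenius (Qhat_mx Qhat n w) (Q_mx m k n w) (Ha_mx Qhat n w)).
Qed.
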